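(* Let $L=K_0\cup K_1\cup\cdots\cup K_n$ be an $(n+1)$-component link in $S^3$ such that $L-K_0=K_1\cup\cdots\cup K_n$ is a trivial link. If $L-K_0$ bounds a disjoint union $F$ of orientable surfaces $F_1,\dots,F_n$ embedded in $S^3$ with $\partial F_i=K_i$ $(i=1,\dots,n)$ and $F\cap K_0=\emptyset$, then $K_0$ is null-homotopic in $S^3\setminus(L-K_0)$.
   Context: Links are oriented and tame (smooth). Surfaces are compact. A link is trivial if its components bound pairwise disjoint embedded disks. $L-K_0$ denotes the sublink of $L$ obtained by deleting $K_0$. Null-homotopic means freely homotopic to a constant loop. *)

(* Defs.v *)
From HB Require Import structures.
From mathcomp Require Import all_boot all_order all_algebra.
From mathcomp Require Import all_classical all_reals all_analysis.

Set Implicit Arguments.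
Unset Strict Implicit.
Unset Printing Implicit Defensive.

Import Order.TTheory GRing.Theory Num.Theory.
Import numFieldNormedType.Exports.

Local Open Scope classical_set_scope.
Local Open Scope ring_scope.

Section Smooth.
Context {R : realType} {V W : normedModType R}.

(* For k > 0: f is differentiable on D and all its directional derivatives are
   of class C^(k-1). The domain V is meant to be finite-dimensional and D open. *)
Fixpoint class_C (k : nat) (D : set V) (f : V -> W) : Prop :=
  if k is k'.+1 then
    (forall x, D x -> differentiable f x) /\
    (forall v : V, class_C k' D ('D_v f))
  else forall x, D x -> {for x, continuous f}.

Definition smooth_on (D : set V) (f : V -> W) : Prop :=
  forall k, class_C k D f.

End Smooth.

Section Spheres.
Context {R : realType}.

(* The library norm on row vectors is the sup norm, hence this Euclidean one. *)
Definition sqnorm n (x : 'rV[R]_n) : R := \sum_i x 0 i ^+ 2.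

Definition sphere3 : set 'rV[R]_4 := [set x | sqnorm x = 1].
Definition disk : set 'rV[R]_2 := [set x | sqnorm x <= 1].
Definition circle : set 'rV[R]_2 := [set x | sqnorm x = 1].

End Spheres.

Section Links.
Context {R : realType}.

(* The circle is R / Z: a closed curve is a 1-periodic function on R. A map into
   the 3-sphere is smooth iff it is smooth as a map into R^4. *)
Definition is_knot (c : R -> 'rV[R]_4) : Prop :=
  [/\ smooth_on setT c,
      (forall t, sphere3 (c t)),
      (forall t, c (t + 1) = c t),
      (forall s t, c s = c t -> exists k : int, s = t + k%:~R) &
      (forall t, derive1 c t != 0)].

Definition is_link n (L : 'I_n -> R -> 'rV[R]_4) : Prop :=
  (forall i, is_knot (L i)) /\ trivIset setT (fun i => range (L i)).

Definition link_set n (L : 'I_n -> R -> 'rV[R]_4) : set 'rV[R]_4 :=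
  \bigcup_i range (L i).

Definition delete_component n (L : 'I_n.+1 -> R -> 'rV[R]_4) (i : 'I_n.+1) :
  'I_n -> R -> 'rV[R]_4 := fun j => L (lift i j).

Definition is_embedded_disk (d : 'rV[R]_2 -> 'rV[R]_4) : Prop :=
  [/\ (exists2 U : set 'rV[R]_2, open U /\ disk `<=` U & smooth_on U d),
      (forall x, disk x -> row_free ('J d x)),
      set_inj disk d &
      d @` disk `<=` sphere3].

Definition trivial_link n (L : 'I_n -> R -> 'rV[R]_4) : Prop :=
  exists d : 'I_n -> 'rV[R]_2 -> 'rV[R]_4,
    [/\ (forall i, is_embedded_disk (d i)),
        (forall i, d i @` circle = range (L i)) &
        trivIset setT (fun i => d i @` disk)].

End Links.

Section Surfaces.
Context {R : realType}.

Definition half_plane : set 'rV[R]_2 := [set x | 0 <= x 0 ord_max].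
Definition edge : set 'rV[R]_2 := [set x | x 0 ord_max = 0].

(* Local parametrizations, i.e. inverses of charts; the domain of the chart is
   chart_dom, and the map is defined and smooth on an open set of the plane
   around it. Interior charts are those with dom disjoint from edge. *)
Record param := Param {
  dom : set 'rV[R]_2;
  pmap : 'rV[R]_2 -> 'rV[R]_4 }.

Definition chart_dom (p : param) : set 'rV[R]_2 := dom p `&` half_plane.

(* The last clause says that pmap p is an open map from chart_dom p to F, so
   that it is a homeomorphism onto a relatively open subset of F. *)
Definition is_param (F : set 'rV[R]_4) (p : param) : Prop :=
  [/\ open (dom p) /\ smooth_on (dom p) (pmap p),
      (forall x, chart_dom p x -> row_free ('J (pmap p) x)),
      set_inj (chart_dom p) (pmap p) &
      (forall O : set 'rV[R]_2, open O ->
         exists2 V : set 'rV[R]_4,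
           open V & pmap p @` (O `&` chart_dom p) = F `&` V)].

Definition is_atlas (F : set 'rV[R]_4) (A : set param) : Prop :=
  (forall p, A p -> is_param F p) /\
  F = \bigcup_(p in A) (pmap p @` chart_dom p).

(* Compact smoothly embedded surface with boundary in the 3-sphere. *)
Definition is_surface (F : set 'rV[R]_4) : Prop :=
  [/\ compact F, F `<=` sphere3 & exists A, is_atlas F A].

Definition surface_boundary (F : set 'rV[R]_4) : set 'rV[R]_4 :=
  \bigcup_(p in is_param F) (pmap p @` (chart_dom p `&` edge)).

(* A is the Jacobian matrix at x of the change of coordinates from p to q. *)
Definition positively_compatible (p q : param) : Prop :=
  forall x y, chart_dom p x -> chart_dom q y -> pmap p x = pmap q y ->
    exists2 A : 'M[R]_2, 0 < \det A & 'J (pmap p) x = A *m 'J (pmap q) y.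

Definition orientable (F : set 'rV[R]_4) : Prop :=
  exists2 A, is_atlas F A &
    forall p q, A p -> A q -> positively_compatible p q.

End Surfaces.

Section Homotopy.
Context {R : realType} {T : topologicalType}.

Definition freely_homotopic (X : set T) (c c' : R -> T) : Prop :=
  exists H : R * R -> T,
    [/\ {within `[0, 1]%classic `*` `[0, 1]%classic, continuous H},
        (forall t s, t \in `[0, 1] -> s \in `[0, 1] -> X (H (t, s))),
        (forall s, s \in `[0, 1] -> H (0, s) = H (1, s)),
        (forall t, t \in `[0, 1] -> H (t, 0) = c t) &
        (forall t, t \in `[0, 1] -> H (t, 1) = c' t)].

Definition null_homotopic (X : set T) (c : R -> T) : Prop :=
  exists x : T, freely_homotopic X c (cst x).

End Homotopy.

(* Main.v *)
Require Import Defs.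
From HB Require Import structures.
From mathcomp Require Import all_boot all_order all_fingroup all_algebra all_solvable.
From mathcomp Require Import all_classical all_reals all_analysis.
From mathcomp Require Import lra ring zify.

(** Two spaces have to be handled without a triangulation. For the complement of the disks, a radial
    push inside thin ellipsoidal tubes trades each disk for its centre. What remains is a cone in
    R^4 with finitely many rays removed, where every path can be coned off with straight segments
    from a generic apex: a triangle with such an apex misses a ray because its span with the ray is
    a proper subspace of R^4. For the surfaces, neither a tubular neighbourhood of F_i nor a general
    position argument is available. The side of a point off F_i is read from a nearest point of F_i
    and the conormal there, and it only has to be locally constant near interior points. The bundle
    is accordingly a discontinuous transport that composes locally; near a boundary point nothing is
    asked, since the boundary is removed. The conjugators u_i come from the tails that join the base
    point to the meridians. They are out of control, but they change only modulo N when s does; this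
    is why the lower central series is used. Many factors 2 and 4 compare the sup norm with the
    Euclidean norm of R^4. *)

(* The disks bounded by K_1, ..., K_n have tubular neighbourhoods, and the complement of the disks
   is simply connected; hence in the groupoid of paths of X = S^3 - (K_1 u ... u K_n) every path is
   a word in loops g_1, ..., g_n, up to fixed tails (no van Kampen theorem is needed). The surface
   F_i is cooriented, so a family s of elements of a finite group defines a flat bundle on X with
   transition s_i across F_i; let T(s) be its holonomies along the g_i. A meridian of K_i crosses
   F_i once, so that the word w_i which it spells satisfies w_i(T(s)) = u_i s_i^(+-1) u_i^-1. Thus
   s is determined by T(s) modulo the steps of the lower central series, and over a finite
   nilpotent group T is injective, hence surjective. The curve K_0 misses the surfaces, so its word
   w satisfies w(T(s)) = 1 for all s, i.e. w vanishes on all finite nilpotent groups. Unitriangular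
   matrices over F_p detect every nontrivial reduced word, hence w is trivial in the free group. *)

Set Implicit Arguments.
Unset Strict Implicit.
Unset Printing Implicit Defensive.

Import Order.TTheory GRing.Theory Num.Theory.
Import numFieldNormedType.Exports.

Local Open Scope classical_set_scope.
Local Open Scope ring_scope.

(** * Paths and homotopies *)

Section ContinuityAtPoint.
Context {T U W : topologicalType}.

Lemma forc_comp (f : T -> U) (g : U -> W) x :
  continuous_at x f -> continuous_at (f x) g -> continuous_at x (fun y => g (f y)).
Proof. exact: continuous_comp. Qed.

Lemma forc_pair (f : T -> U) (g : T -> W) x :
  continuous_at x f -> continuous_at x g -> continuous_at x (fun y => (f y, g y)).
Proof. exact: (@cvg_pair _ _ _ (nbhs x) (nbhs (f x)) (nbhs (g x))). Qed.

Lemma forc_cst (a : U) (x : T) : continuous_at x (fun _ : T => a).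
Proof. exact: cvg_cst. Qed.

Lemma forc_id (x : T) : continuous_at x (fun y : T => y).
Proof. exact: cvg_id. Qed.

Lemma forc_fst (f : T -> U * W) (x : T) :
  continuous_at x f -> continuous_at x (fun y => (f y).1).
Proof. by move=> cf; apply: (continuous_comp cf); exact: cvg_fst. Qed.

Lemma forc_snd (f : T -> U * W) (x : T) :
  continuous_at x f -> continuous_at x (fun y => (f y).2).
Proof. by move=> cf; apply: (continuous_comp cf); exact: cvg_snd. Qed.

End ContinuityAtPoint.

Section ContinuityAtPointAlgebra.
Context {R : realType} {T : topologicalType} {V : normedModType R}.
Implicit Types (f g : T -> V) (k l : T -> R) (x : T).

Lemma forcD f g x : continuous_at x f -> continuous_at x g ->
  continuous_at x (fun y => f y + g y).
Proof. exact: cvgD. Qed.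

Lemma forcN f x : continuous_at x f -> continuous_at x (fun y => - f y).
Proof. exact: cvgN. Qed.

Lemma forcZ k f x : continuous_at x k -> continuous_at x f ->
  continuous_at x (fun y => k y *: f y).
Proof. exact: cvgZ. Qed.

Lemma forcDr k l x : continuous_at x k -> continuous_at x l ->
  continuous_at x (fun y => k y + l y).
Proof. exact: cvgD. Qed.

Lemma forcNr k x : continuous_at x k -> continuous_at x (fun y => - k y).
Proof. exact: cvgN. Qed.

Lemma forcM k l x : continuous_at x k -> continuous_at x l ->
  continuous_at x (fun y => k y * l y).
Proof. exact: cvgM. Qed.

Lemma forcV k x : k x != 0 -> continuous_at x k -> continuous_at x (fun y => (k y)^-1).
Proof. by move=> k0; exact: cvgV. Qed.

Lemma forcX k m x : continuous_at x k -> continuous_at x (fun y => k y ^+ m).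
Proof.
move=> ck; elim: m => [|m IHm]; first exact: forc_cst.
have -> : (fun y => k y ^+ m.+1) = (fun y => k y * k y ^+ m) by apply/funext => y; rewrite exprS.
exact: forcM.
Qed.

End ContinuityAtPointAlgebra.

Ltac cont := repeat lazymatch goal with
  | H : continuous_at ?x ?f |- continuous_at ?x ?f => exact: H
  | H : continuous ?f |- continuous_at _ ?f => exact: H
  | |- prop_for ?x (inPhantom (continuous ?f)) => change (continuous_at x f)
  | |- continuous_at _ (fun _ => ?a) => exact: forc_cst
  | |- continuous_at _ (fun x => x) => exact: forc_id
  | |- continuous_at _ fst => exact: cvg_fst
  | |- continuous_at _ snd => exact: cvg_snd
  | |- continuous_at _ (fun x => fst (@?f x)) => apply: (@forc_fst _ _ _ f)
  | |- continuous_at _ (fun x => snd (@?f x)) => apply: (@forc_snd _ _ _ f)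
  | |- continuous_at _ (fun x => pair (@?f x) (@?g x)) => apply: (@forc_pair _ _ _ f g)
  | |- continuous_at _ (fun x => GRing.opp (@?f x)) => first [apply: (@forcNr _ _ f) | apply: (@forcN _ _ _ f)]
  | |- continuous_at _ (fun x => GRing.inv (@?f x)) => apply: (@forcV _ _ f)
  | |- continuous_at _ (fun x => GRing.add (@?f x) (@?g x)) => first [apply: (@forcDr _ _ f g) | apply: (@forcD _ _ _ f g)]
  | |- continuous_at _ (fun x => GRing.exp (@?f x) ?n) => apply: (@forcX _ _ f n)
  | |- continuous_at _ (fun x => GRing.mul (@?f x) (@?g x)) => apply: (@forcM _ _ f g)
  | |- continuous_at _ (fun x => GRing.scale (@?f x) (@?g x)) => apply: (@forcZ _ _ _ f g)
  | H : continuous ?f |- continuous_at _ (fun x => ?f (@?g x)) =>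
      apply: (@forc_comp _ _ _ g f); last exact: H
  end.

(** * Induction along the unit interval *)

Section IntervalInduction.
Context {R : realType}.

(** This takes the place of a subdivision with a Lebesgue number: the supremum of the parameters
    reachable from 0 is itself reachable, and can be passed unless it is 1. *)
Lemma interval_induction (Q : R -> R -> Prop) :
  (forall a b c, a <= b -> b <= c -> Q a b -> Q b c -> Q a c) ->
  (forall t : R, 0 <= t <= 1 -> exists2 e, 0 < e & forall a b,
     a <= b -> 0 <= a -> b <= 1 -> `|a - t| < e -> `|b - t| < e -> Q a b) ->
  Q 0 1.
Proof.
move=> Qtr Qloc.
pose S := [set t | 0 <= t <= 1 /\ Q 0 t].
have S0 : S 0.
  split; first by rewrite lexx ler01.
  have [|e e0 he] := Qloc 0; first by rewrite lexx ler01.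
  by apply: he; rewrite ?subrr ?normr0 //.
have hS : has_sup S.
  split; first by exists 0.
  by exists 1 => t [/andP[]].
set s := sup S.
have s0 : 0 <= s by apply: ub_le_sup => //; exact: hS.2.
have s1 : s <= 1 by apply: ge_sup; [exists 0|move=> t [/andP[]]].
have [|e e0 he] := Qloc s; first by rewrite s0 s1.
have [t [/andP[t0 t1] Qt] st] := sup_adherent e0 hS.
have ts : t <= s by apply: ub_le_sup; [exact: hS.2|split; rewrite ?t0].
have key u : s <= u -> u <= 1 -> u < s + e -> Q 0 u.
  move=> su u1 ue; apply: (Qtr _ t) => //; first lra.
  apply: he => //; [lra| |]; rewrite ltr_norml; apply/andP; split; move: st; rewrite -/s; lra.
have : ~ s < 1.
  move=> s1'.
  pose u := Num.min 1 (s + e / 2).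
  have su : s < u by rewrite lt_min s1'; lra.
  have : u <= s.
    apply: ub_le_sup; first exact: hS.2.
    have u1 : u <= 1 by rewrite ge_min lexx.
    split; first by rewrite u1 andbT; lra.
    apply: key => //; first lra.
    by rewrite gt_min; apply/orP; right; lra.
  lra.
move=> ns; have e1 : s = 1 by lra.
by apply: key => //; lra.
Qed.

Lemma near2_ball (P Q : R -> Prop) (t : R) :
  (\forall x \near t, P x) -> (\forall x \near t, Q x) ->
  exists2 e : R, 0 < e & forall x : R, `|x - t| < e -> P x /\ Q x.
Proof.
move=> /nbhs_ballP[e e0 he] /nbhs_ballP[d d0 hd]; exists (Num.min e d).
  by rewrite lt_min e0 d0.
by move=> x; rewrite lt_min distrC => /andP[xe xd]; split; [apply: he|apply: hd].
Qed.

(** The retraction of the line onto [0, 1]. Composing with it makes paths and homotopies total and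
    continuous on the whole line or plane. *)
Definition clamp (t : R) : R := Num.max 0 (Num.min t 1).

Lemma clamp_continuous : continuous clamp.
Proof.
move=> t; apply: (@continuous_max R R (cst 0) (fun t => Num.min t 1)); first exact: cvg_cst.
by apply: (@continuous_min R R id (cst 1)); [exact: cvg_id|exact: cst_continuous].
Qed.

Lemma clamp01 t : 0 <= clamp t <= 1.
Proof. by rewrite /clamp le_max lexx /= ge_max ler01 ge_min lexx orbT. Qed.

Lemma clamp_id t : 0 <= t <= 1 -> clamp t = t.
Proof. by case/andP=> t0 t1; rewrite /clamp min_l // max_r. Qed.

Lemma clamp_le0 t : t <= 0 -> clamp t = 0.
Proof. by move=> t0; rewrite /clamp min_l ?max_l //; lra. Qed.

Lemma clamp_ge1 t : 1 <= t -> clamp t = 1.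
Proof. by move=> t1; rewrite /clamp min_r // max_r. Qed.

End IntervalInduction.

Section PathHomotopy.
Context {R : realType} {V : normedModType R}.
Implicit Types (p q r : R -> V) (X : set V).

Definition cpath X p := continuous p /\ forall t, X (p t).

(* Homotopy relative to the end points; only the values on [0, 1] matter. *)
Definition htp X p q := exists H : R * R -> V,
  [/\ continuous H, (forall x, X (H x)),
    (forall t : R, 0 <= t <= 1 -> H (t, 0) = p t /\ H (t, 1) = q t) &
    (forall s, H (0, s) = p 0 /\ H (1, s) = p 1)].

Lemma htp_intro X p q (H : R * R -> V) : continuous H ->
  (forall t s : R, 0 <= t <= 1 -> 0 <= s <= 1 -> X (H (t, s))) ->
  (forall t : R, 0 <= t <= 1 -> H (t, 0) = p t /\ H (t, 1) = q t) ->
  (forall s : R, 0 <= s <= 1 -> H (0, s) = p 0 /\ H (1, s) = p 1) -> htp X p q.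
Proof.
move=> cH XH H01 Hs.
have c01 : 0 <= (0 : R) <= 1 by rewrite lexx ler01.
have c11 : 0 <= (1 : R) <= 1 by rewrite lexx ler01.
exists (fun x => H (clamp x.1, clamp x.2)); split.
- by have cc := @clamp_continuous R; move=> x; cont.
- by move=> [t s] /=; apply: XH; exact: clamp01.
- by move=> t t01 /=; rewrite !clamp_id //; exact: H01.
- by move=> s /=; rewrite (@clamp_le0 _ 0) // (@clamp_ge1 _ 1) //; apply: Hs; exact: clamp01.
Qed.

Lemma htp_refl X p : cpath X p -> htp X p p.
Proof.
move=> [cp Xp]; exists (fun x => p x.1); split=> //.
by move=> x; cont.
Qed.

Lemma htp_ends X p q : htp X p q -> p 0 = q 0 /\ p 1 = q 1.
Proof.
move=> [H [_ _ H1 H2]]; have [h1 h2] := H2 1.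
by rewrite -h1 -h2; split; apply: (H1 _ _).2; rewrite lexx ler01.
Qed.

Lemma htp_sym X p q : htp X p q -> htp X q p.
Proof.
move=> h; have [e0 e1] := htp_ends h; case: h => H [cH XH H1 H2].
exists (fun x => H (x.1, 1 - x.2)); split=> //.
- by move=> x; cont.
- by move=> t /H1[h0 h1]; rewrite /= subr0 subrr.
- by move=> s /=; rewrite -e0 -e1; exact: H2.
Qed.

Lemma continuous_fun2 (H : R * R -> V) (f g : R * R -> R) :
  continuous H -> continuous f -> continuous g -> continuous (fun x => H (f x, g x)).
Proof.
by move=> cH cf cg x; cont.
Qed.

Lemma continuous_glue (T : topologicalType) (f g h : T -> V) :
  continuous f -> continuous g -> continuous h -> continuous (fun x => f x + g x - h x).
Proof. by move=> cf cg ch x; cont. Qed.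

Lemma continuous_clamp_affine (T : topologicalType) (f : T -> R) (k l : R) :
  continuous f -> continuous (fun x => clamp (k * f x - l)).
Proof.
by move=> cf x; have cc := @clamp_continuous R; cont.
Qed.

(** The homotopies are stacked by adding them and subtracting the common middle path: at every
    height one of the two terms equals that path. Continuity is then automatic, with no gluing along
    closed sets. *)
Lemma htp_trans X p q r : htp X p q -> htp X q r -> htp X p r.
Proof.
move=> h; have [e0 e1] := htp_ends h.
case: h => H [cH XH H1 H2] [K [cK XK K1 K2]].
have cfst : continuous (fst : R * R -> R) by move=> x; exact: cvg_fst.
have csnd : continuous (snd : R * R -> R) by move=> x; exact: cvg_snd.
pose k1 (x : R * R) := clamp (2 * x.2 - 0).
pose k2 (x : R * R) := clamp (2 * x.2 - 1).
have c1 : continuous k1 by exact: continuous_clamp_affine.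
have c2 : continuous k2 by exact: continuous_clamp_affine.
apply: (@htp_intro _ _ _ (fun x => H (x.1, k1 x) + K (x.1, k2 x) - K (x.1, 0))).
- apply: continuous_glue; apply: continuous_fun2 => //.
  by move=> x; exact: cvg_cst.
- move=> t s t01 /andP[s0 s1]; rewrite /k1 /k2 /=.
  have [s2|s2] := leP s (1 / 2).
    by rewrite (@clamp_le0 _ (2 * s - 1)) ?addrK //; lra.
  rewrite (@clamp_ge1 _ (2 * s - 0)); last lra.
  by rewrite (H1 _ t01).2 (K1 _ t01).1 addrC addKr.
- move=> t t01; rewrite /k1 /k2 /= mulr0 mulr1 !(@clamp_le0 _ (0 - _)) ?(@clamp_ge1 _ (2 - _)); [|lra..].
  by rewrite (H1 _ t01).1 (H1 _ t01).2 (K1 _ t01).1 (K1 _ t01).2 addrK addrC addKr.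
- move=> s s01 /=; rewrite (H2 _).1 (H2 _).2 !(K2 _).1 !(K2 _).2.
  by rewrite !addrK.
Qed.

Lemma htp_sub X Y p q : X `<=` Y -> htp X p q -> htp Y p q.
Proof. by move=> XY [H [cH XH H1 H2]]; exists H; split=> // x; apply: XY. Qed.

Lemma cpath_sub X Y p : X `<=` Y -> cpath X p -> cpath Y p.
Proof. by move=> XY [cp Xp]; split=> // t; apply: XY. Qed.

Lemma cpath_comp X p (f : R -> R) : cpath X p -> continuous f -> cpath X (p \o f).
Proof. by move=> [cp Xp] cf; split=> // t; rewrite /comp; cont. Qed.

Lemma htp_eq X p q : cpath X p -> (forall t : R, 0 <= t <= 1 -> p t = q t) -> htp X p q.
Proof.
move=> [cp Xp] pq; exists (fun x => p x.1); split => //.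
  by move=> x; cont.
by move=> t t01; rewrite /= pq.
Qed.

(** A straight-line homotopy between the two parameters. It may leave [0, 1], but [p] is defined on
    the line and stays in [X] there. *)
Lemma htp_reparam X p (f g : R -> R) : cpath X p ->
  continuous f -> continuous g -> f 0 = g 0 -> f 1 = g 1 -> htp X (p \o f) (p \o g).
Proof.
move=> [cp Xp] cf cg e0 e1.
apply: (@htp_intro _ _ _ (fun x => p ((1 - x.2) * f x.1 + x.2 * g x.1))) => //.
- by move=> x; cont.
- by move=> t _ /=; rewrite subr0 subrr !mul0r !mul1r addr0 add0r.
- by move=> s _ /=; rewrite -e0 -e1 -!mulrDl subrK !mul1r.
Qed.

(** Concatenation as a sum minus the junction point: when [p 1 = q 0], at each time one of the first
    two terms equals [q 0]. *)
Definition pcat p q : R -> V := fun t => p (clamp (2 * t - 0)) + q (clamp (2 * t - 1)) - q 0.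
Definition revp p : R -> V := fun t => p (1 - t).

Lemma pcat_l p q t : t <= 1 / 2 -> pcat p q t = p (clamp (2 * t)).
Proof. by move=> t2; rewrite /pcat (@clamp_le0 _ (2 * t - 1)) ?addrK ?subr0 //; lra. Qed.

Lemma pcat_r p q t : p 1 = q 0 -> 1 / 2 <= t -> pcat p q t = q (clamp (2 * t - 1)).
Proof.
move=> pq t2; rewrite /pcat (@clamp_ge1 _ (2 * t - 0)); last lra.
by rewrite pq addrC addKr.
Qed.

Lemma pcat0 p q : pcat p q 0 = p 0.
Proof. by rewrite pcat_l ?mulr0 ?clamp_le0 //; lra. Qed.

Lemma pcat1 p q : p 1 = q 0 -> pcat p q 1 = q 1.
Proof. by move=> pq; rewrite pcat_r //; [rewrite clamp_ge1//; lra|lra]. Qed.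

Lemma revp0 p : revp p 0 = p 1. Proof. by rewrite /revp subr0. Qed.
Lemma revp1 p : revp p 1 = p 0. Proof. by rewrite /revp subrr. Qed.

Lemma cpath_revp X p : cpath X p -> cpath X (revp p).
Proof.
by move=> cp; apply: (cpath_comp cp) => t; cont.
Qed.

Lemma continuous_pcat p q : continuous p -> continuous q -> continuous (pcat p q).
Proof.
by move=> cp cq t; rewrite /pcat; have cc := @clamp_continuous R; cont.
Qed.

Lemma cpath_cat X p q : cpath X p -> cpath X q -> p 1 = q 0 -> cpath X (pcat p q).
Proof.
move=> [cp Xp] [cq Xq] pq; split; first exact: continuous_pcat.
move=> t; have [t2|t2] := leP t (1 / 2); first by rewrite pcat_l.
by rewrite pcat_r // ltW.
Qed.

Lemma htp_cat X p p' q q' : p 1 = q 0 -> htp X p p' -> htp X q q' ->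
  htp X (pcat p q) (pcat p' q').
Proof.
move=> pq [H [cH XH H1 H2]] [K [cK XK K1 K2]].
have cfst : continuous (fst : R * R -> R) by move=> x; exact: cvg_fst.
have csnd : continuous (snd : R * R -> R) by move=> x; exact: cvg_snd.
pose k1 (x : R * R) := clamp (2 * x.1 - 0).
pose k2 (x : R * R) := clamp (2 * x.1 - 1).
have c1 : continuous k1 by exact: continuous_clamp_affine.
have c2 : continuous k2 by exact: continuous_clamp_affine.
have q0 : q' 0 = q 0.
  by have [|<- _] := @htp_ends X q q'; first by exists K.
apply: (@htp_intro _ _ _ (fun x => H (k1 x, x.2) + K (k2 x, x.2) - q 0)).
- apply: continuous_glue; [| |by move=> t; exact: cvg_cst]; exact: continuous_fun2.
- move=> t s _ _; rewrite /k1 /k2 /=; have [t2|t2] := leP t (1 / 2).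
    by rewrite (@clamp_le0 _ (2 * t - 1)) ?(K2 _).1 ?addrK//; lra.
  rewrite (@clamp_ge1 _ (2 * t - 0)) ?(H2 _).2 ?pq; last lra.
  by rewrite addrC addKr.
- move=> t t01; rewrite /k1 /k2 /pcat q0.
  have [h h'] := H1 _ (clamp01 (2 * t - 0)); have [k k'] := K1 _ (clamp01 (2 * t - 1)).
  by rewrite h h' k k'.
- by move=> s _; rewrite /k1 /k2 pcat0 pcat1 //= mulr0 mulr1 !(@clamp_le0 _ (0 - _)) ?(@clamp_ge1 _ (2 - _));
   [rewrite (H2 _).1 (H2 _).2 (K2 _).1 (K2 _).2 pq addrK addrC addKr|lra..].
Qed.

Lemma htp_catA X p q r : cpath X p -> cpath X q -> cpath X r -> p 1 = q 0 -> q 1 = r 0 ->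
  htp X (pcat (pcat p q) r) (pcat p (pcat q r)).
Proof.
move=> Xp Xq Xr pq qr.
pose Q t := pcat (pcat p q) r t.
have XQ : cpath X Q by apply: cpath_cat => //; [exact: cpath_cat|rewrite pcat1].
have cid : continuous (id : R -> R) by move=> t; exact: cvg_id.
(* The piecewise linear change of parameter that maps [0, 1/2], [1/2, 3/4] and [3/4, 1] onto
   [0, 1/4], [1/4, 1/2] and [1/2, 1]. *)
pose f (t : R) := clamp (2 * t - 0) / 4 + clamp (4 * t - 2) / 4 + clamp (4 * t - 3) / 2.
have cf : continuous f.
  by move=> t; rewrite /f; have cc := @clamp_continuous R; cont.
have f0 : f 0 = 0 by rewrite /f !clamp_le0; lra.
have f1 : f 1 = 1 by rewrite /f !clamp_ge1; lra.
apply: (@htp_trans _ _ (Q \o f)).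
  by apply: (htp_reparam XQ cid cf); rewrite ?f0 ?f1.
apply: htp_eq; first exact: cpath_comp.
move=> t /andP[t0 t1] /=; rewrite /Q.
have [t2|t2] := leP t (1 / 2).
  have ef : f t = t / 2.
    by rewrite /f clamp_id; [rewrite !(@clamp_le0 _ (4 * t - _)); lra|lra].
  rewrite ef pcat_l ?clamp_id; [|lra..].
  rewrite pcat_l ?[RHS]pcat_l; [|lra..].
  by rewrite clamp_id; [|lra]; rewrite clamp_id; [congr p; lra|lra].
rewrite [RHS]pcat_r ?pcat0 //; last lra.
rewrite [X in pcat q r X]clamp_id; last lra.
have [t3|t3] := leP t (3 / 4).
  have ef : f t = t - 1 / 4.
    rewrite /f clamp_ge1; last lra.
    by rewrite clamp_id; [rewrite clamp_le0; lra|lra].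
  rewrite ef pcat_l; [|lra]; rewrite clamp_id; last lra.
  rewrite pcat_r //; last lra.
  rewrite pcat_l; last lra.
  by congr (q (clamp _)); lra.
have ef : f t = 2 * t - 1.
  rewrite /f clamp_ge1; last lra.
  by rewrite clamp_ge1; [rewrite clamp_id; lra|lra].
rewrite ef pcat_r ?pcat1 //; last lra.
by rewrite pcat_r //; lra.
Qed.

Lemma htp_catVr X p : cpath X p -> htp X (pcat p (revp p)) (cst (p 0)).
Proof.
move=> Xp; pose f (t : R) := clamp (2 * t - 0) - clamp (2 * t - 1).
have cid : continuous (id : R -> R) by move=> t; exact: cvg_id.
have cf : continuous f by move=> t; rewrite /f; have cc := @clamp_continuous R; cont.
have Xf := cpath_comp Xp cf.
apply: (@htp_trans _ _ (p \o f)).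
  apply: htp_sym; apply: htp_eq => // t /andP[t0 t1] /=; rewrite /f.
  have [t2|t2] := leP t (1 / 2).
    by rewrite pcat_l //; congr p; rewrite subr0 (@clamp_le0 _ (2 * t - 1)); lra.
  rewrite pcat_r ?revp0 //; last lra.
  by rewrite /revp clamp_ge1 //; lra.
have -> : cst (p 0) = p \o (fun=> 0) by [].
apply: htp_reparam => //; first by move=> t; exact: cvg_cst.
  by rewrite /f !clamp_le0; lra.
by rewrite /f !clamp_ge1; lra.
Qed.

Lemma revpK p : revp (revp p) = p.
Proof. by apply/funext => t; rewrite /revp opprB addrCA subrr addr0. Qed.

Lemma htp_catVl X p : cpath X p -> htp X (pcat (revp p) p) (cst (p 1)).
Proof. by move=> Xp; have := htp_catVr (cpath_revp Xp); rewrite revpK revp0. Qed.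

Lemma cpath_cst X x : X x -> cpath X (cst x).
Proof. by move=> Xx; split=> // t; exact: cvg_cst. Qed.

Lemma htp_cat1r X p : cpath X p -> htp X (pcat p (cst (p 1))) p.
Proof.
move=> Xp; have cid : continuous (id : R -> R) by move=> t; exact: cvg_id.
pose f (t : R) := clamp (2 * t - 0).
have cf : continuous f by exact: continuous_clamp_affine.
apply: (@htp_trans _ _ (p \o f)).
  by apply: htp_sym; apply: htp_eq; [exact: cpath_comp|move=> t _; rewrite /pcat addrK].
by apply: (htp_reparam Xp cf cid); rewrite /f; [rewrite clamp_le0; lra|rewrite clamp_ge1; lra].
Qed.

Lemma htp_cat1l X p : cpath X p -> htp X (pcat (cst (p 0)) p) p.
Proof.
move=> Xp; have cid : continuous (id : R -> R) by move=> t; exact: cvg_id.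
pose f (t : R) := clamp (2 * t - 1).
have cf : continuous f by exact: continuous_clamp_affine.
apply: (@htp_trans _ _ (p \o f)).
  by apply: htp_sym; apply: htp_eq; [exact: cpath_comp|move=> t _; rewrite /pcat /= addrC addKr].
by apply: (htp_reparam Xp cf cid); rewrite /f; [rewrite clamp_le0; lra|rewrite clamp_ge1; lra].
Qed.

Definition subp p (a b : R) : R -> V := fun t => p (a + t * (b - a)).

Lemma cpath_subp X p a b : cpath X p -> cpath X (subp p a b).
Proof.
by move=> Xp; apply: (cpath_comp Xp) => t; cont.
Qed.

Lemma subp0 p a b : subp p a b 0 = p a. Proof. by rewrite /subp mul0r addr0. Qed.
Lemma subp1 p a b : subp p a b 1 = p b. Proof. by rewrite /subp mul1r addrC subrK. Qed.
Lemma subp01 p : subp p 0 1 = p.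
Proof. by apply/funext => t; rewrite /subp subr0 mulr1 add0r. Qed.

Lemma htp_subp X p a b c : cpath X p ->
  htp X (pcat (subp p a b) (subp p b c)) (subp p a c).
Proof.
move=> Xp; have cid : continuous (id : R -> R) by move=> t; exact: cvg_id.
pose f (t : R) := a + clamp (2 * t - 0) * (b - a) + clamp (2 * t - 1) * (c - b).
pose g (t : R) := a + t * (c - a).
have cf : continuous f.
  by move=> t; rewrite /f; have cc := @clamp_continuous R; cont.
have cg : continuous g by move=> t; rewrite /g; cont.
apply: (@htp_trans _ _ (p \o f)); last first.
  by apply: (htp_reparam Xp cf cg); rewrite /f /g; [rewrite !clamp_le0; lra|rewrite !clamp_ge1; lra].
apply: htp_sym; apply: htp_eq; first exact: cpath_comp.
move=> t _ /=; rewrite /f; have [t2|t2] := leP t (1 / 2).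
  rewrite pcat_l // /subp (@clamp_le0 _ (2 * t - 1)); last lra.
  by rewrite mul0r addr0 subr0.
rewrite pcat_r ?subp0 ?subp1 //; last lra.
by rewrite /subp (@clamp_ge1 _ (2 * t - 0)); [congr p; lra|lra].
Qed.

End PathHomotopy.

Lemma htp_map {R : realType} {V W : normedModType R} (X : set V) (Y : set W) (f : V -> W) p q :
  (forall x, X x -> {for x, continuous f}) -> (forall x, X x -> Y (f x)) ->
  htp X p q -> htp Y (f \o p) (f \o q).
Proof.
move=> cf fY [H [cH XH H1 H2]]; exists (f \o H); split.
- by move=> x; apply: continuous_comp; [exact: cH|exact: cf].
- by move=> x; apply: fY.
- by move=> t /H1[/= -> ->].
- by move=> s; have [/= -> ->] := H2 s.
Qed.

Lemma cpath_map {R : realType} {V W : normedModType R} (X : set V) (Y : set W) (f : V -> W) p :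
  (forall x, X x -> {for x, continuous f}) -> (forall x, X x -> Y (f x)) ->
  cpath X p -> cpath Y (f \o p).
Proof.
move=> cf fY [cp Xp]; split=> [t|t]; last exact: fY.
by apply: continuous_comp; [exact: cp|exact: cf].
Qed.

(** * Flat bundles with finite structure group *)

Section Holonomy.
Context {R : realType} {V : normedModType R} {gT : finGroupType}.
Implicit Types (c : V -> V -> gT) (X : set V) (p q : R -> V) (g : R -> gT).
Local Open Scope group_scope.

(* A discontinuous description of a flat gT-bundle over X: c x y is the transport from x to a
   nearby point y, and transports compose near x. *)
Definition flat X c := forall x, X x ->
  \forall y \near x, X y -> \forall z \near y, X z -> c y z = (c x y)^-1 * c x z.

(** A lift of [p] to the bundle. Only steps leading away from [t] are constrained, because [c x y]
    and [c y x] need not be inverse to each other. *)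
Definition parallel c p (a b : R) g := forall t : R, (a <= t <= b)%R ->
  \forall t' \near t, (a <= t' <= b)%R -> g t' = g t * c (p t) (p t').

Definition Hol c p (a b : R) (h : gT) := exists2 g, parallel c p a b g & h = (g a)^-1 * g b.

(** Near [t] the transport out of [p t] is a parallel section: this is exactly what flatness at
    [p t] says at the neighbouring points. *)
Lemma Hol_local X c p t : flat X c -> cpath X p -> exists2 e : R, (0 < e)%R &
  forall a b, (`|a - t| < e)%R -> (`|b - t| < e)%R ->
    Hol c p a b ((c (p t) (p a))^-1 * c (p t) (p b)).
Proof.
move=> fc [cp Xp].
have /nbhs_ballP[e e0 he] := cp t _ (fc _ (Xp t)); exists e => // a b ae be.
exists (fun u => c (p t) (p u)) => //.
move=> u /andP[au ub].
have /he/= hu : ball t e u.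
  rewrite /ball /= distrC; move: ae be; rewrite !ltr_norml => /andP[??] /andP[??].
  by apply/andP; split; lra.
have := cp u _ (hu (Xp u)); apply: (@filterS _ (nbhs u)) => v /= hv _.
by rewrite hv // mulKVg.
Qed.

Lemma Hol_cat c p a b d h k : (a <= b)%R -> (b <= d)%R -> Hol c p a b h -> Hol c p b d k ->
  Hol c p a d (h * k).
Proof.
move=> ab bd [g1 G1 ->] [g2 G2 ->].
(* The second section is translated on the left so as to agree with the first at [b]; left
   translation preserves parallelism. *)
pose g u := if (u <= b)%R then g1 u else g1 b * (g2 b)^-1 * g2 u.
have gr u : (b <= u)%R -> g u = g1 b * (g2 b)^-1 * g2 u.
  rewrite /g => bu; case: ifPn => // ub; have -> : u = b by lra.
  by rewrite mulgKV.
exists g; last by rewrite (gr d) // /g ab !mulgA.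
move=> t /andP[at_ td]; have [tb|bt|tb] := ltgtP t b.
- have := G1 t; rewrite at_ ltW // => /(_ isT) H.
  near=> t' => /andP[at' t'd].
  have t'b : (t' < b)%R by near: t'; exact: lt_nbhsl.
  rewrite /g (ltW tb) (ltW t'b); apply: (near H t') => //.
  by rewrite at' ltW.
- have := G2 t; rewrite td ltW // => /(_ isT) H.
  near=> t' => /andP[at' t'd].
  have t'b : (b < t')%R by near: t'; exact: lt_nbhsr.
  rewrite !gr ?ltW // -[RHS]mulgA; congr (_ * _); apply: (near H t') => //.
  by rewrite t'd ltW.
- subst t; have := G1 b; rewrite at_ lexx => /(_ isT) H1.
  have := G2 b; rewrite td lexx => /(_ isT) H2.
  near=> t' => /andP[at' t'd].
  rewrite {2}/g lexx; have [t'b|bt'] := leP t' b.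
    by rewrite /g t'b; apply: (near H1 t') => //; rewrite at'.
  rewrite gr ?ltW // (near H2 t') ?mulgA ?mulgKV //.
  by rewrite t'd ltW.
Unshelve. all: by end_near. Qed.

Lemma Hol_exists X c p : flat X c -> cpath X p -> exists h, Hol c p 0 1 h.
Proof.
move=> fc Xp.
apply: (@interval_induction _ (fun a b => exists h, Hol c p a b h)).
- by move=> a b d ab bd [h H] [k K]; exists (h * k); exact: (Hol_cat ab bd).
- move=> t t01; have [e e0 he] := Hol_local t fc Xp; exists e => // a b _ _ _ ha hb.
  by exists ((c (p t) (p a))^-1 * c (p t) (p b)); exact: he.
Qed.

(** The quotient of two parallel sections is locally constant, hence constant. *)
Lemma Hol_unique c p h h' : Hol c p 0 1 h -> Hol c p 0 1 h' -> h = h'.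
Proof.
move=> [g G ->] [g' G' ->].
suff : (g' 0%R * (g 0%R)^-1 = g' 1%R * (g 1%R)^-1).
  move=> e; apply: (mulgI (g' 0%R)); rewrite mulgA e mulgKV.
  by rewrite mulgA mulgV mul1g.
apply: (@interval_induction _ (fun a b => g' a * (g a)^-1 = g' b * (g b)^-1)).
  by move=> a b d _ _ -> ->.
move=> t t01; have [e e0 he] := near2_ball (G t t01) (G' t t01).
have key a : (0 <= a)%R -> (a <= 1)%R -> (`|a - t| < e)%R -> g' a * (g a)^-1 = g' t * (g t)^-1.
  move=> a0 a1 ae; have [h1 h2] := he a ae; rewrite h1 ?h2 ?a0 ?a1 //.
  by rewrite invMg mulgA mulgK.
exists e => // a b ab a0 b1 ae be; rewrite !key //; lra.
Qed.

Lemma Hol_reparam c p p' (f : R -> R) a b a' b' h : continuous f ->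
  (forall t, (a' <= t <= b')%R -> (a <= f t <= b)%R /\ p' t = p (f t)) ->
  f a' = a -> f b' = b -> Hol c p a b h -> Hol c p' a' b' h.
Proof.
move=> cf H fa fb [g G ->]; exists (g \o f); last by rewrite /= fa fb.
move=> t /H[ft ->]; have := cf t _ (G _ ft); apply: (@filterS _ (nbhs t)) => t' /= Gt' /H[ft' ->].
exact: Gt'.
Qed.

Lemma Hol_pcat c p q h k : p 1%R = q 0%R -> Hol c p 0 1 h -> Hol c q 0 1 k ->
  Hol c (pcat p q) 0 1 (h * k).
Proof.
move=> pq Hp Hq; apply: (@Hol_cat _ _ _ (1 / 2)%R); [lra|lra| |].
  apply: (@Hol_reparam _ p _ (fun t => 2 * t)%R 0%R 1%R) => //; [by move=> t; cont| |lra|lra].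
  by move=> t /andP[t0 t1]; rewrite pcat_l // clamp_id; [split => //|]; apply/andP; split; lra.
apply: (@Hol_reparam _ q _ (fun t => 2 * t - 1)%R 0%R 1%R) => //; [by move=> t; cont| |lra|lra].
by move=> t /andP[t0 t1]; rewrite pcat_r // clamp_id; [split => //|]; apply/andP; split; lra.
Qed.

Lemma Hol_trivial c p : (forall t t' : R, c (p t) (p t') = 1) -> Hol c p 0 1 1.
Proof.
move=> c1; exists (fun=> 1); last by rewrite invg1 mulg1.
by move=> t _; apply: (@filterE _ (nbhs t)) => t' _; rewrite c1 mulg1.
Qed.

Lemma flat_refl X c x : flat X c -> X x -> c x x = 1.
Proof.
move=> fc Xx; have /nbhs_singleton/(_ Xx)/nbhs_singleton/(_ Xx) := fc x Xx.
by rewrite mulVg.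
Qed.

(** As [c] is discontinuous, the holonomy over a part of the path may jump with [s]. It is corrected
    by the sideways transports [v] at the two ends, and the corrected form is additive. At the fixed
    end points of the homotopy [v] is trivial. *)
Lemma htp_Hol_near X c (H : R * R -> V) (s0 : R) : flat X c -> continuous H ->
  (forall x, X (H x)) -> (forall s, H (0, s)%R = H (0, s0)%R /\ H (1, s)%R = H (1, s0)%R) ->
  exists h, \forall s \near s0, Hol c (fun t => H (t, s)) 0 1 h.
Proof.
move=> fc cH XH He.
have cHs s : cpath X (fun t => H (t, s)) by split=> // t; cont.
have cHt t : cpath X (fun s => H (t, s)) by split=> // s; cont.
have [h0 Hh0] := Hol_exists fc (cHs s0); exists h0.
pose v a s := c (H (a, s0)) (H (a, s)).
pose Q a b := exists2 h, Hol c (fun t => H (t, s0)) a b h &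
  \forall s \near s0, Hol c (fun t => H (t, s)) a b ((v a s)^-1 * h * v b s).
have [h Hh nh] : Q 0%R 1%R.
  apply: (@interval_induction _ Q).
    move=> a b d ab bd [h Hh nh] [k Hk nk]; exists (h * k); first exact: (Hol_cat ab bd).
    near=> s; have -> : (v a s)^-1 * (h * k) * v d s = ((v a s)^-1 * h * v b s) * ((v b s)^-1 * k * v d s).
      by rewrite !mulgA mulgK.
    by apply: (Hol_cat ab bd); near: s.
  move=> t t01; set x := H (t, s0).
  have [e e0 he] : exists2 e : R, (0 < e)%R & forall a s, (`|a - t| < e)%R -> (`|s - s0| < e)%R ->
      \forall z \near H (a, s), X z -> c (H (a, s)) z = (c x (H (a, s)))^-1 * c x z.
    have /cH/nbhs_ballP[e e0 he] := fc x (XH _); exists e => // a s ae se.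
    have /he/= : ball (t, s0) e (a, s) by split; rewrite /ball /= distrC.
    by apply.
  exists e => // a b ab _ _ ae be.
  have HH s : (`|s - s0| < e)%R -> Hol c (fun t => H (t, s)) a b ((c x (H (a, s)))^-1 * c x (H (b, s))).
    move=> se; exists (fun u => c x (H (u, s))) => // u /andP[au ub].
    have ue : (`|u - t| < e)%R.
      move: ae be; rewrite !ltr_norml => /andP[??] /andP[??].
      by apply/andP; split; lra.
    have := (cHs s).1 u _ (he _ _ ue se); apply: (@filterS _ (nbhs u)) => w /= hw _.
    by rewrite hw // mulKVg.
  exists ((c x (H (a, s0)))^-1 * c x (H (b, s0))); first by apply: HH; rewrite subrr normr0.
  have ss : (`|s0 - s0| < e)%R by rewrite subrr normr0.
  have va := (cHt a).1 s0 _ (he _ _ ae ss); have vb := (cHt b).1 s0 _ (he _ _ be ss).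
  move/nbhs_ballP: va => [d d0 va]; move/nbhs_ballP: vb => [d' d'0 vb].
  near=> s; have se : (`|s - s0| < e)%R by near: s; apply/nbhs_ballP; exists e => // s; rewrite /ball /= distrC.
  rewrite /v va //; [rewrite vb //|]; last by near: s; exact: nbhsx_ballx.
    2: by near: s; exact: nbhsx_ballx.
  have -> : ((c x (H (a, s0)))^-1 * c x (H (a, s)))^-1 *
     ((c x (H (a, s0)))^-1 * c x (H (b, s0))) * ((c x (H (b, s0)))^-1 * c x (H (b, s))) =
     ((c x (H (a, s)))^-1 * c x (H (b, s))).
    by rewrite invMg invgK !mulgA mulgK mulgK.
  exact: HH.
have -> : h0 = h by exact: Hol_unique Hh0 Hh.
apply: filterS nh => s; rewrite /v (He s).1 (He s).2 !(flat_refl fc) //.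
by rewrite invg1 mul1g mulg1.
Unshelve. all: by end_near. Qed.

Lemma htp_Hol X c p q h k : flat X c -> htp X p q -> Hol c p 0 1 h -> Hol c q 0 1 k -> h = k.
Proof.
move=> fc [H [cH XH H1 H2]] Hp Hq.
have ext p' s (l : gT) : (forall t : R, (0 <= t <= 1)%R -> H (t, s) = p' t) ->
    Hol c p' 0 1 l -> Hol c (fun t => H (t, s)) 0 1 l.
  move=> e; apply: (@Hol_reparam _ _ _ id) => //; first by move=> t; exact: cvg_id.
  by move=> t t01; rewrite e.
have {}Hp : Hol c (fun t => H (t, 0%R)) 0 1 h by apply: ext Hp => t /H1[].
have {}Hq : Hol c (fun t => H (t, 1%R)) 0 1 k by apply: ext Hq => t /H1[].
suff : forall l, Hol c (fun t => H (t, 0%R)) 0 1 l -> Hol c (fun t => H (t, 1%R)) 0 1 l.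
  by move=> /(_ _ Hp) Hp'; exact: Hol_unique Hp' Hq.
apply: (@interval_induction _ (fun a b => forall l,
  Hol c (fun t => H (t, a)) 0 1 l -> Hol c (fun t => H (t, b)) 0 1 l)).
  by move=> a b d _ _ ha hb l /ha/hb.
move=> s0 _; have [|l] := @htp_Hol_near X c H s0 fc cH XH.
  by move=> s; rewrite !(H2 _).1 !(H2 _).2.
move=> /nbhs_ballP[e e0 he]; exists e => // a b _ _ _ ae be m Hm.
have {}ae : ball s0 e a by rewrite /ball /= distrC.
have {}be : ball s0 e b by rewrite /ball /= distrC.
by rewrite (Hol_unique Hm (he _ ae)); exact: he.
Qed.

Fact mulg_modulo_cat (u v u' v' : gT) :
  (u * v)^-1 * (u' * v') = (u^-1 * u') ^ v * (v^-1 * v').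
Proof. by rewrite conjgE invMg !mulgA mulgK. Qed.

Fact mulg_modulo_quo (a b a' b' : gT) :
  (a^-1 * b)^-1 * (a'^-1 * b') = ((a^-1 * a')^-1) ^ (a^-1 * b) * (b^-1 * b').
Proof. by rewrite conjgE !invMg !invgK !mulgA !mulgK. Qed.

(** Both conclusions are multiplicative in the interval, so short intervals suffice, and there a
    holonomy is a quotient of two values of the transport. With [N] a term of the lower central
    series, this controls how the conjugators vary with the family [s]. *)
Lemma Hol_modulo c c' p h h' (G N : {group gT}) : G \subset 'N(N) ->
  (forall x y, c x y \in G) -> (forall x y, (c x y)^-1 * c' x y \in N) ->
  Hol c p 0 1 h -> Hol c' p 0 1 h' -> h \in G /\ h^-1 * h' \in N.
Proof.
move=> GN cG cN [g Pg ->] [g' Pg' ->].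
apply: (@interval_induction _ (fun a b => (g a)^-1 * g b \in G /\
   ((g a)^-1 * g b)^-1 * ((g' a)^-1 * g' b) \in N)).
  move=> a b d _ _ [G1 N1] [G2 N2]; split.
    by have := groupM G1 G2; rewrite mulgA mulgK.
  set u := (g a)^-1 * g b in G1 N1 *; set v := (g b)^-1 * g d in G2 N2 *.
  set u' := (g' a)^-1 * g' b in N1 *; set v' := (g' b)^-1 * g' d in N2 *.
  have -> : (g a)^-1 * g d = u * v by rewrite /u /v mulgA mulgK.
  have -> : (g' a)^-1 * g' d = u' * v' by rewrite /u' /v' mulgA mulgK.
  have -> : (u * v)^-1 * (u' * v') = (u^-1 * u') ^ v * (v^-1 * v').
    exact: mulg_modulo_cat.
  by rewrite groupM // memJ_norm // (fintype.subsetP GN).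
move=> t t01; have [e e0 he] := near2_ball (Pg t t01) (Pg' t t01).
exists e => // a b ab a0 b1 ae be.
have key u : (0 <= u)%R -> (u <= 1)%R -> (`|u - t| < e)%R ->
    g u = g t * c (p t) (p u) /\ g' u = g' t * c' (p t) (p u).
  move=> u0 u1 ue; by have [h1 h2] := he u ue; rewrite h1 ?h2 ?u0 ?u1.
have [||ga ga'] := key a _ _ ae; [lra..|]; have [||gb gb'] := key b _ _ be; [lra..|].
have e4 (x y z : gT) : (x * y)^-1 * (x * z) = y^-1 * z by rewrite invMg -mulgA mulKg.
rewrite ga gb ga' gb' !e4; have cab : (c (p t) (p a))^-1 * c (p t) (p b) \in G.
  by rewrite groupM // groupV.
split => //; rewrite mulg_modulo_quo groupM // memJ_norm ?groupV //.
exact: (fintype.subsetP GN).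
Qed.

End Holonomy.

(** * Words in nilpotent groups *)

Section Words.
Context {n : nat}.
Local Open Scope group_scope.

Definition letter_eval (gT : groupType) (g : 'I_n -> gT) (l : 'I_n * bool) : gT :=
  if l.2 then g l.1 else (g l.1)^-1.

Definition word_eval (gT : groupType) (g : 'I_n -> gT) (w : seq ('I_n * bool)) : gT :=
  \prod_(l <- w) letter_eval g l.

Definition cancels (l l' : 'I_n * bool) := (l.1 == l'.1) && (l.2 != l'.2).
Definition reduced (w : seq ('I_n * bool)) := sorted (fun l l' => ~~ cancels l l') w.

Fixpoint syllables (w : seq ('I_n * bool)) : seq (('I_n * bool) * nat) :=
  if w is l :: w' then
    if syllables w' is (l', k) :: s then
      if l == l' then (l, k.+1) :: s else (l, 1%N) :: (l', k) :: s
    else [:: (l, 1%N)]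
  else [::].

Lemma syllables_cons l w : exists k s, syllables (l :: w) = (l, k) :: s.
Proof.
rewrite /=; case: (syllables w) => [|[l' k] s]; first by exists 1%N, [::].
by case: eqP => _; [exists k.+1, s|exists 1%N, ((l', k) :: s)].
Qed.

Lemma syllables_eval (gT : groupType) (g : 'I_n -> gT) w :
  word_eval g w = \prod_(x <- syllables w) letter_eval g x.1 ^+ x.2.
Proof.
rewrite /word_eval; elim: w => [|l w IHw]; first by rewrite !big_nil.
rewrite big_cons IHw /=; case: (syllables w) => [|[l' k] s].
  by rewrite big_nil big_cons big_nil.
case: eqP => [<-|_]; rewrite !big_cons //=.
by rewrite mulgA -expgS.
Qed.

(** The bound on the exponents keeps them nonzero modulo a prime larger than the length of the
    word. *)
Lemma syllables_bound w x : x \in syllables w -> (0 < x.2 <= size w)%N.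
Proof.
elim: w x => [|l w IHw] x //=; case: (syllables w) IHw => [|[l' k] s] IHw.
  by rewrite inE => /eqP->.
case: eqP => _; rewrite !inE => /orP[/eqP->|] //=.
- by have /= := IHw (l', k); rewrite inE eqxx => /(_ isT) /andP[_].
- by move=> xs; have /andP[-> /leqW] := IHw x (mem_behead (s := (l', k) :: s) xs).
- by move=> xs; have /andP[-> /leqW] := IHw x xs.
Qed.

(** Neighbouring syllables are made of different letters; if the indices agreed, the signs would be
    opposite and the word would cancel there. *)
Lemma syllables_sorted w : reduced w ->
  sorted (fun x y => x.1.1 != y.1.1) (syllables w).
Proof.
elim: w => [|l w IHw] // rw; have {}IHw := IHw (path_sorted rw); move: rw IHw => /=.
case: w => [|l' w] //= /andP[c _].
have [k [s /= ->]] := syllables_cons l' w.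
case: eqP => [->|ll'] /= IHw; first by case: s IHw.
rewrite IHw andbT; apply: contra c => /= /eqP e1.
apply/andP; split; first by rewrite e1.
apply/eqP => e2; apply: ll'; rewrite [l]surjective_pairing e1 e2.
by case: (l').
Qed.

End Words.

(** * The filtration of the unitriangular group by superdiagonals *)

Section Unitriangular.
Context {F : finFieldType} {m : nat}.
Implicit Types (A B : 'M[F]_m.+1) (u v : {'GL_m.+1[F]}).

Definition glmx u : 'M[F]_m.+1 := GLval u.

Lemma glmx1 : glmx 1%g = 1. Proof. by []. Qed.
Lemma glmxM u v : glmx (u * v)%g = glmx u * glmx v. Proof. by []. Qed.
Lemma glmx_unit u : glmx u \is a GRing.unit. Proof. exact: (@GL_unit m.+1 F u). Qed.

Definition band (k : nat) A := forall a b : 'I_m.+1, (b < a + k)%N -> A a b = 0.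

Lemma bandD k A B : band k A -> band k B -> band k (A + B).
Proof. by move=> hA hB a b ab; rewrite mxE hA // hB // addr0. Qed.

Lemma bandB k A B : band k A -> band k B -> band k (A - B).
Proof. by move=> hA hB a b ab; rewrite !mxE hA // hB // subr0. Qed.

Lemma bandM k l A B : band k A -> band l B -> band (k + l) (A * B).
Proof.
move=> hA hB a b ab; rewrite mxE big1 // => c _.
have [ca|ca] := ltnP c (a + k); first by rewrite hA // mul0r.
by rewrite hB ?mulr0 //; lia.
Qed.

Lemma bandW k l A : (l <= k)%N -> band k A -> band l A.
Proof. by move=> lk hA a b ab; apply: hA; lia. Qed.

Lemma band1 : band 0 (1 : 'M[F]_m.+1).
Proof. by move=> a b ab; rewrite mxE; case: eqP => // e; move: ab; rewrite e; lia. Qed.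

(** The index is shifted: [unitri 0] consists of all unitriangular matrices, and in [unitri k] the
    first k superdiagonals vanish. *)
Definition unitri (k : nat) : {set {'GL_m.+1[F]}} :=
  [set u | `[< band k.+1 (glmx u - 1) >]].

Lemma unitriP k u : reflect (band k.+1 (glmx u - 1)) (u \in unitri k).
Proof. by rewrite inE; exact: asboolP. Qed.

Lemma unitri_group_set k : group_set (unitri k).
Proof.
apply/group_setP; split.
  by apply/unitriP; rewrite glmx1 subrr => a b _; rewrite mxE.
move=> u v /unitriP hu /unitriP hv; apply/unitriP; rewrite glmxM.
have -> : glmx u * glmx v - 1 = (glmx u - 1) * (glmx v - 1) + ((glmx u - 1) + (glmx v - 1)).
  rewrite mulrBl !mulrBr !mulr1 !mul1r; move: (glmx u * glmx v) (glmx u) (glmx v) => x y z.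
  by rewrite opprB addrA; apply/matrixP => i j; rewrite !mxE; ring.
apply: bandD; last exact: bandD.
by apply: bandW (bandM hu hv); lia.
Qed.

Canonical unitri_group k := Group (unitri_group_set k).

Lemma unitri_band0 k u : u \in unitri k -> band 0 (glmx u).
Proof.
move=> /unitriP hu; rewrite -[glmx u](subrK 1); apply: bandD; last exact: band1.
by apply: bandW hu.
Qed.

(** With X = u - 1 and Y = v - 1, the commutator minus 1 is (vu)^-1 (XY - YX), and bandwidths add
    under multiplication. *)
Lemma unitri_comm k : [~: unitri k, unitri 0]%g \subset unitri k.+1.
Proof.
rewrite gen_subG; apply/fintype.subsetP => _ /imset2P[u v hu hv ->].
apply/unitriP.
have uv : (v * u)^-1%g \in unitri 0.
  rewrite groupV groupM //; apply/unitriP; have /unitriP := hu; apply: bandW; lia.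
have -> : glmx [~ u, v]%g - 1 =
    glmx (v * u)^-1%g * ((glmx u - 1) * (glmx v - 1) - (glmx v - 1) * (glmx u - 1)).
  have -> : (glmx u - 1) * (glmx v - 1) - (glmx v - 1) * (glmx u - 1) =
      glmx u * glmx v - glmx v * glmx u.
    rewrite !mulrBl !mulrBr !mulr1 !mul1r.
    by apply/matrixP => i j; rewrite !mxE; ring.
  rewrite mulrBr -!glmxM mulVg glmx1; congr (glmx _ - _).
  by rewrite /commg /conjg invMg !mulgA.
have/unitriP h1 := hu; have/unitriP h2 := hv.
have := bandM (unitri_band0 uv) (bandB (bandM h1 h2) _); rewrite add0n addSn addn1.
by apply; rewrite -addn1 addnC; apply: bandM.
Qed.

Lemma unitri_top : unitri m = 1%g.
Proof.
apply/eqP; rewrite finset.eqEsubset sub1G andbT; apply/fintype.subsetP => u /unitriP hu.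
rewrite inE; apply/eqP/val_inj => /=; apply/eqP; rewrite -subr_eq0; apply/eqP/matrixP => a b.
rewrite hu ?mxE //; have := ltn_ord b; lia.
Qed.

Lemma unitri_nilpotent : nilpotent (unitri 0).
Proof.
apply/lcnP; exists m; apply/eqP; rewrite finset.eqEsubset sub1G andbT -unitri_top.
suff: forall k, 'L_k.+1(unitri 0)%g \subset unitri k by apply.
elim=> [|k IHk]; first by [].
rewrite lcnSn; apply: fintype.subset_trans (unitri_comm k); exact: commSg.
Qed.

End Unitriangular.

Section Magnus.
Local Open Scope ring_scope.

(* With a letter of index i acting by the sum of the E_(s, s+1) over the syllables s in i, only one
   term contributes to the corner entry of a product of syllables: the product of the exponents. *)
Lemma reduced_word_trivial n (w : seq ('I_n * bool)) : reduced w ->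
  (forall (gT : finGroupType) (G : {group gT}) (g : 'I_n -> gT),
     nilpotent G -> (forall i, g i \in G) -> word_eval g w = 1%g) -> w = [::].
Proof.
move=> rw triv; case: w rw triv => // l0 w0; set w := l0 :: w0 => rw triv; exfalso.
pose s := syllables w; pose m := size s.
(* Euclid's construction of a prime above a bound: no exponent of a syllable is then zero in F_p. *)
pose p := pdiv (size w).+2`!.+1.
have pp : prime p by apply: pdiv_prime; rewrite ltnS fact_gt0.
have wp : (size w < p)%N.
  rewrite ltnNge; apply/negP => pw.
  have : (p %| (size w).+2`!)%N by rewrite dvdn_fact // pdiv_gt0; lia.
  have : (p %| (size w).+2`!.+1)%N by exact: pdiv_dvd.
  move=> h1 h2; move: h1; rewrite -addn1 dvdn_addr // dvdn1 => /eqP p1.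
  by rewrite p1 in pp.
pose F := 'F_p.
pose x0 := (l0, 0%N).
pose N (i : 'I_n) : 'M[F]_m.+1 := \matrix_(a, b) ((b == a.+1 :> nat) && ((nth x0 s a).1.1 == i))%:R.
(* This is where reducedness enters: a nonzero entry would require two consecutive syllables of the
   same index. It makes the powers of [1 + e *: N i] linear in the exponent. *)
have N2 i : N i * N i = 0.
  apply/matrixP => a b; rewrite !mxE big1 // => c _; rewrite !mxE.
  case: eqP => [ca|]; last by rewrite mul0r.
  case: eqP => [ai|]; last by rewrite mul0r.
  case: eqP => [bc|]; last by rewrite mulr0.
  case: eqP => [ci|]; last by rewrite mulr0.
  have := syllables_sorted rw; rewrite -/s => /(sortedP x0)/(_ a).
  rewrite -ca ai ci eqxx; have := ltn_ord b; rewrite bc ltnS => -> /(_ isT).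
  by [].
have U1 i (e : F) : 1 + e *: N i \is a GRing.unit.
  apply/unitrP; exists (1 - e *: N i).
  have NN : (e *: N i) * (e *: N i) = 0 by rewrite -scalerAl -scalerAr N2 !scaler0.
  split; first by rewrite mulrDr mulr1 mulrBl mul1r NN subr0 subrK.
  by rewrite mulrBr mulr1 mulrDl mul1r NN addr0 addrK.
pose g i : {'GL_m.+1[F]} := FinRing.Unit (U1 i 1).
have gE i : glmx (g i) = 1 + N i by rewrite /= scale1r.
have gU i : g i \in unitri 0.
  apply/unitriP; rewrite gE addrC addKr => a b ab; rewrite mxE.
  by case: eqP => // e; move: ab; rewrite e; lia.
have powE i (e : F) k : (1 + e *: N i) ^+ k = 1 + (e *+ k) *: N i.
  elim: k => [|k IHk]; first by rewrite expr0 mulr0n scale0r addr0.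
  rewrite exprS IHk mulrDl mul1r mulrDr mulr1 -scalerAl -scalerAr N2 !scaler0 addr0 mulrS scalerDl.
  by rewrite -addrA [_ *: N i + _]addrC.
pose sg (b : bool) : F := if b then 1 else -1.
have gl (l : 'I_n * bool) : glmx (letter_eval g l) = 1 + sg l.2 *: N l.1.
  case: l => i [] /=; rewrite /letter_eval /sg /= ?scale1r //.
  have u1 : 1 + N i \is a GRing.unit by rewrite -gE glmx_unit.
  apply: (mulrI u1); rewrite mulrV // scaleN1r mulrBr mulr1 mulrDl mul1r N2.
  by rewrite addr0 addrK.
have glX (x : ('I_n * bool) * nat) :
    glmx (letter_eval g x.1 ^+ x.2)%g = 1 + (sg x.1.2 *+ x.2) *: N x.1.1.
  rewrite -powE -gl; elim: x.2 => [|k IHk] //.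
  by rewrite expgS glmxM IHk exprS.
have e0 (x : ('I_n * bool) * nat) : x \in s -> sg x.1.2 *+ x.2 != 0.
  move=> /syllables_bound /andP[x0' xw].
  have : (x.2%:R : F) != 0.
    rewrite -(dvdn_pcharf (pchar_Fp pp)) gtnNdvd //; exact: leq_ltn_trans wp.
  by rewrite /sg; case: x.1.2 => //; rewrite mulNrn oppr_eq0.
pose P k : 'M[F]_m.+1 := \prod_(x <- take k s) (1 + (sg x.1.2 *+ x.2) *: N x.1.1).
(* Each syllable moves the support of row 0 at most one column to the right, and the new last entry
   is the old one times a nonzero exponent. *)
have key k : (k <= m)%N -> P k ord0 (inord k) != 0 /\ forall b : 'I_m.+1, (k < b)%N -> P k ord0 b = 0.
  elim: k => [|k IHk] km.
    rewrite /P take0 big_nil; split.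
      have -> : inord 0 = ord0 :> 'I_m.+1 by apply/val_inj; rewrite /= inordK.
      by rewrite mxE eqxx oner_neq0.
    by move=> b b0; rewrite mxE; case: eqP => // e; move: b0; rewrite -e.
  have [h1 h2] := IHk (ltnW km).
  have PS : P k.+1 = P k + (sg (nth x0 s k).1.2 *+ (nth x0 s k).2) *: (P k * N (nth x0 s k).1.1).
    rewrite /P (take_nth x0) // -cats1 big_cat big_seq1 /=.
    by rewrite mulrDr mulr1 -scalerAr.
  have PN (b : 'I_m.+1) (i : 'I_n) : (k < b)%N ->
      (P k * N i) ord0 b = if b == k.+1 :> nat then P k ord0 (inord k) * ((nth x0 s k).1.1 == i)%:R else 0.
    move=> kb; rewrite mxE (bigD1 (inord k)) //= big1 ?addr0.
      rewrite mxE inordK; last by apply: leqW.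
      by case: eqP => _ //=; rewrite mulr0.
    move=> c ck; rewrite mxE; case: (b =P c.+1 :> nat) => [bc|]; last by rewrite mulr0.
    rewrite h2 ?mul0r // ltn_neqAle; apply/andP; split; last by rewrite -ltnS -bc.
    by apply: contra ck => /eqP e; apply/eqP/val_inj; rewrite /= inordK // -?e //; exact: leqW.
  split.
    rewrite PS mxE h2 ?add0r; last by rewrite inordK.
    rewrite mxE PN inordK // eqxx eqxx mulr1 mulf_neq0 //.
    by apply: e0; exact: mem_nth.
  move=> b kb; rewrite PS mxE h2; last exact: ltnW.
  rewrite mxE (PN b _ (ltnW kb)).
  have -> : (b == k.+1 :> nat) = false by apply/negbTE; rewrite neq_ltn kb orbT.
  by rewrite mulr0 addr0.
have := triv _ _ g unitri_nilpotent gU; rewrite syllables_eval -/s => /(congr1 (@glmx F m)).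
have -> : glmx (\prod_(x <- s) letter_eval g x.1 ^+ x.2)%g = P m.
  rewrite /P take_size (big_morph (@glmx F m) glmxM glmx1).
  by apply: eq_bigr => x _; exact: glX.
have [h _] := key m (leqnn m); rewrite glmx1 => Pm; move: h; rewrite Pm mxE.
have [k [s' es]] := syllables_cons l0 w0.
have [/(congr1 val)|_] := eqVneq (ord0 : 'I_m.+1) (inord m); last by rewrite mulr0n eqxx.
by rewrite /= inordK // /m /s /w es.
Qed.

End Magnus.

Section Hopf.
Context {n : nat} {gT : finGroupType} {G : {group gT}}.
Local Open Scope group_scope.

Fact conj_eq_shift (x a y b : gT) : x * a * x^-1 = y * b * y^-1 -> b = a ^ (x^-1 * y).
Proof.
move=> e; apply: (mulgI y); apply: (mulIg y^-1).
by rewrite -e conjgE invMg invgK !mulgA mulgV mul1g mulgK.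
Qed.

Implicit Types s t : 'I_n -> gT.

(* A finite nilpotent instance of the Hopf property: T determines s up to conjugation by elements
   depending on s, and these conjugations are invisible in the graded pieces of the lower central
   series, so T is injective, hence surjective. *)
Lemma conjugacy_determined_surjective (T u : ('I_n -> gT) -> 'I_n -> gT)
    (W : 'I_n -> seq ('I_n * bool)) (b : 'I_n -> bool) : nilpotent G ->
  (forall s, (forall i, s i \in G) -> forall i, T s i \in G) ->
  (forall s, (forall i, s i \in G) -> forall i,
     word_eval (T s) (W i) = u s i * letter_eval s (i, b i) * (u s i)^-1) ->
  (forall (N : {group gT}) s t, normal N G -> (forall i, s i \in G) -> (forall i, t i \in G) ->
     (forall i, (s i)^-1 * t i \in N) -> forall i, u s i \in G /\ (u s i)^-1 * u t i \in N) ->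
  forall t, (forall i, t i \in G) -> exists2 s, (forall i, s i \in G) & T s =1 t.
Proof.
move=> nilG TG HW Hu t tG.
have inj s s' : (forall i, s i \in G) -> (forall i, s' i \in G) -> T s =1 T s' -> s =1 s'.
  move=> sG s'G Tss'.
  (* Equal values of [T] make [s' i] the conjugate of [s i] by [c]. If [c] lies in one term of the
     series, then [(s i)^-1 * s' i] is a commutator with [c] and lies in the next one. *)
  have step k i : (s i)^-1 * s' i \in 'L_k.+1(G).
    elim: k i => [|k IHk] i; first by rewrite lcn1 groupM // groupV.
    have [uG uN] := Hu ('L_k.+1(G))%G s s' (lcn_normal _ _) sG s'G IHk i.
    set c := (u s i)^-1 * u s' i in uN.
    have e : letter_eval s' (i, b i) = letter_eval s (i, b i) ^ c.
      have : word_eval (T s) (W i) = word_eval (T s') (W i).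
        by apply: eq_bigr => l _; rewrite /letter_eval Tss'.
      rewrite !HW //; exact: conj_eq_shift.
    have -> : s' i = s i ^ c.
      by move: e; rewrite /letter_eval /=; case: (b i) => // e; apply: invg_inj; rewrite e conjVg.
    by rewrite -/(commg (s i) c) lcnSn commGC mem_commg.
  have [k Lk] := lcnP _ nilG => i.
  have := step k i; rewrite Lk inE => /eqP e.
  by rewrite -[s' i](mulKVg (s i)) e mulg1.
(* Families with values in [G] form a finite set, on which the injective self-map [T] is onto. *)
pose S := finset (fun f : {ffun 'I_n -> gT} => [forall i, f i \in G]).
have SP (f : {ffun 'I_n -> gT}) : reflect (forall i, f i \in G) (f \in S) by rewrite finset.inE; exact: fintype.forallP.
pose T' (f : {ffun 'I_n -> gT}) : {ffun 'I_n -> gT} := [ffun i => T f i].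
have T'S : T' @: S = S.
  apply/eqP; rewrite eqEcard; apply/andP; split.
    by apply/fintype.subsetP => _ /imsetP[f /SP fS ->]; apply/SP => i; rewrite ffunE; exact: TG.
  rewrite card_in_imset // => f f' /SP fS /SP f'S /ffunP e; apply/ffunP.
  by apply: inj => // i; have := e i; rewrite !ffunE.
have /imsetP[f /SP fS /ffunP e] : [ffun i => t i] \in T' @: S.
  by rewrite T'S; apply/SP => i; rewrite ffunE.
by exists f => // i; have := e i; rewrite !ffunE.
Qed.

End Hopf.

(** * Complements of finitely many rays *)

Section MorePaths.
Context {R : realType} {V : normedModType R}.
Implicit Types (p q r : R -> V) (X : set V).

Lemma htp_cat_cancel X p r q : cpath X p -> cpath X r -> cpath X q ->
  p 1 = r 0 -> r 0 = q 0 -> htp X (pcat (pcat p r) (pcat (revp r) q)) (pcat p q).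
Proof.
move=> Xp Xr Xq pr rq; have Xr' := cpath_revp Xr.
have e1 : r 1 = revp r 0 by rewrite revp0.
have e2 : revp r 1 = q 0 by rewrite revp1.
have Xrq : cpath X (pcat (revp r) q) by apply: cpath_cat.
apply: htp_trans (htp_catA Xp Xr Xrq pr _) _; first by rewrite pcat0.
apply: htp_cat; [by rewrite pcat0|exact: htp_refl|].
apply: htp_trans (htp_sym (htp_catA Xr Xr' Xq e1 e2)) _.
apply: htp_trans (htp_cat1l Xq); rewrite -rq.
by apply: htp_cat; [rewrite pcat1|exact: htp_catVr|exact: htp_refl].
Qed.

Lemma continuous_at_dist p (t e : R) : continuous_at t p -> 0 < e ->
  exists2 d : R, 0 < d & forall u, `|u - t| < d -> `|p t - p u| < e.
Proof.
move=> cp e0; have /nbhs_ballP[d d0 hd] := cp _ (nbhsx_ballx (p t) e e0).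
exists d => // u ud; have /hd : ball t d u by rewrite -ball_normE /= distrC.
by rewrite /= -ball_normE.
Qed.

Definition seg (x y : V) : R -> V := fun t => (1 - clamp t) *: x + clamp t *: y.

Lemma continuous_seg x y : continuous (seg x y).
Proof. by have cc := @clamp_continuous R; move=> t; rewrite /seg; cont. Qed.

Lemma seg0 x y : seg x y 0 = x.
Proof. by rewrite /seg clamp_le0 // subr0 scale1r scale0r addr0. Qed.

Lemma seg1 x y : seg x y 1 = y.
Proof. by rewrite /seg clamp_ge1 // subrr scale1r scale0r add0r. Qed.

Lemma revp_seg x y : revp (seg x y) = seg y x.
Proof.
apply/funext => t; rewrite /revp /seg.
have -> : clamp (1 - t) = 1 - clamp t.
  have [t0|t0] := leP t 0; first by rewrite clamp_ge1 ?clamp_le0; lra.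
  have [t1|t1] := leP 1 t; first by rewrite clamp_le0 ?clamp_ge1; lra.
  by rewrite !clamp_id //; apply/andP; split; lra.
by rewrite opprB addrCA subrr addr0 addrC.
Qed.

Lemma cpath_seg X x y :
  (forall t : R, 0 <= t <= 1 -> X ((1 - t) *: x + t *: y)) -> cpath X (seg x y).
Proof. by move=> H; split; [exact: continuous_seg|move=> t; apply: H; exact: clamp01]. Qed.

Lemma htp_straight X p q : continuous p -> continuous q -> p 0 = q 0 -> p 1 = q 1 ->
  (forall t s : R, 0 <= t <= 1 -> 0 <= s <= 1 -> X ((1 - s) *: p t + s *: q t)) -> htp X p q.
Proof.
move=> cp cq e0 e1 XH; apply: (@htp_intro _ _ _ _ _ (fun x => (1 - x.2) *: p x.1 + x.2 *: q x.1)) => //.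
- by move=> x; cont.
- by move=> t _ /=; rewrite subr0 subrr !scale0r !scale1r addr0 add0r.
- by move=> s _ /=; rewrite -e0 -e1 -!scalerDl subrK !scale1r.
Qed.

End MorePaths.

(** * Scalar product, norms and radial projection *)

Section Euclidean.
Context {R : realType} {n : nat}.
Implicit Types x y z : 'rV[R]_n.

Definition dot x y : R := \sum_i x 0 i * y 0 i.

Lemma dotC x y : dot x y = dot y x.
Proof. by apply: eq_bigr => i _; rewrite mulrC. Qed.
Lemma dotDl x y z : dot (x + y) z = dot x z + dot y z.
Proof. by rewrite -big_split; apply: eq_bigr => i _; rewrite mxE mulrDl. Qed.
Lemma dotZl a x y : dot (a *: x) y = a * dot x y.
Proof. by rewrite mulr_sumr; apply: eq_bigr => i _; rewrite mxE mulrA. Qed.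
Lemma dotNl x y : dot (- x) y = - dot x y.
Proof. by rewrite -scaleN1r dotZl mulN1r. Qed.
Lemma dotBl x y z : dot (x - y) z = dot x z - dot y z.
Proof. by rewrite dotDl dotNl. Qed.
Lemma dotDr x y z : dot x (y + z) = dot x y + dot x z.
Proof. by rewrite !(dotC x) dotDl. Qed.
Lemma dotZr a x y : dot x (a *: y) = a * dot x y.
Proof. by rewrite !(dotC x) dotZl. Qed.
Lemma dotNr x y : dot x (- y) = - dot x y.
Proof. by rewrite !(dotC x) dotNl. Qed.
Lemma dotBr x y z : dot x (y - z) = dot x y - dot x z.
Proof. by rewrite !(dotC x) dotBl. Qed.
Lemma dot0l x : dot 0 x = 0.
Proof. by rewrite -(scale0r 0) dotZl mul0r. Qed.

Lemma sqnormE x : sqnorm x = dot x x.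
Proof. by apply: eq_bigr => i _; rewrite expr2. Qed.
Lemma sqnorm_ge0 x : 0 <= sqnorm x.
Proof. by apply: sumr_ge0 => i _; exact: sqr_ge0. Qed.
Lemma sqnorm_eq0 x : (sqnorm x == 0) = (x == 0).
Proof.
apply/eqP/eqP => [|->]; last by rewrite sqnormE dot0l.
move/eqP; rewrite psumr_eq0 => [|i _]; last exact: sqr_ge0.
move=> /allP h; apply/matrixP => i j; rewrite ord1 mxE; apply/eqP.
by have := h j; rewrite mem_index_enum sqrf_eq0 => /(_ isT).
Qed.
Lemma sqnorm_gt0 x : (0 < sqnorm x) = (x != 0).
Proof. by rewrite lt0r sqnorm_ge0 andbT sqnorm_eq0. Qed.
Lemma sqnormZ a x : sqnorm (a *: x) = a ^+ 2 * sqnorm x.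
Proof. by rewrite !sqnormE dotZl dotZr mulrA expr2. Qed.
Lemma sqnormN x : sqnorm (- x) = sqnorm x.
Proof. by rewrite -scaleN1r sqnormZ expr2 mulrNN mulr1 mul1r. Qed.
Lemma sqnormB x y : sqnorm (x - y) = sqnorm x - 2 * dot x y + sqnorm y.
Proof. by rewrite !sqnormE dotBl !dotBr (dotC y x); ring. Qed.
Lemma sqnormD x y : sqnorm (x + y) = sqnorm x + 2 * dot x y + sqnorm y.
Proof. by rewrite !sqnormE dotDl !dotDr (dotC y x); ring. Qed.

Lemma coord_le_norm x i : `|x 0 i| <= `|x|.
Proof. by rewrite [leRHS]mx_normrE; apply: (le_bigmax _ _ (0, i)). Qed.

Lemma norm_le_coord x (a : R) : 0 <= a -> (forall i, `|x 0 i| <= a) -> `|x| <= a.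
Proof. by move=> a0 h; rewrite [leLHS]mx_normrE; apply: bigmax_le => // -[i j] _; rewrite ord1. Qed.

Lemma dot_le_norm x y : `|dot x y| <= n%:R * (`|x| * `|y|).
Proof.
apply: le_trans (ler_norm_sum _ _ _) _.
rewrite mulr_natl -[X in _ *+ X](card_ord n) -sumr_const.
by apply: ler_sum => i _; rewrite normrM ler_pM // coord_le_norm.
Qed.

Lemma sqnorm_le_norm x : sqnorm x <= n%:R * `|x| ^+ 2.
Proof. by rewrite expr2 sqnormE; apply: le_trans (ler_norm _) (dot_le_norm x x). Qed.

Lemma norm_le_sqnorm x : `|x| ^+ 2 <= sqnorm x.
Proof.
have h : `|x| <= Num.sqrt (sqnorm x).
  apply: norm_le_coord => [|i]; first exact: sqrtr_ge0.
  rewrite -sqrtr_sqr ler_sqrt ?sqnorm_ge0 // /sqnorm (bigD1 i) //= lerDl.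
  by apply: sumr_ge0 => j _; exact: sqr_ge0.
by rewrite -[leRHS]sqr_sqrtr ?sqnorm_ge0 // ler_sqr ?nnegrE ?sqrtr_ge0.
Qed.

Lemma coord_cont i : continuous (fun x : 'rV[R]_n => x 0 i).
Proof. exact: coord_continuous. Qed.

Lemma dot_continuous_at (T : topologicalType) (f g : T -> 'rV[R]_n) (t : T) :
  continuous_at t f -> continuous_at t g -> continuous_at t (fun u => dot (f u) (g u)).
Proof.
move=> cf cg; rewrite /dot; apply: (@cvg_big _ _ +%R) => //; first exact: add_continuous.
by move=> i _; apply: forcM; apply: (@forc_comp _ _ _ _ (fun x : 'rV_n => x 0 i)) => //;
  exact: coord_cont.
Qed.

Lemma sqnorm_continuous : continuous (@sqnorm R n).
Proof.
move=> x; have -> : @sqnorm R n = (fun x => dot x x) by apply/funext => y; exact: sqnormE.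
by apply: dot_continuous_at; exact: forc_id.
Qed.

(** Radial projection to the unit sphere. Its value at 0 is 0, hence the side conditions on
    nonvanishing below. *)
Definition rho x := (Num.sqrt (sqnorm x))^-1 *: x.

Lemma rho_continuous x : x != 0 -> continuous_at x rho.
Proof.
move=> x0; apply: forcZ; last exact: forc_id.
apply: forcV; first by rewrite sqrtr_eq0 -ltNge sqnorm_gt0.
apply: (@forc_comp _ _ _ (@sqnorm R n) (@Num.sqrt R)); first exact: sqnorm_continuous.
exact: sqrt_continuous.
Qed.

Lemma sqnorm_rho x : x != 0 -> sqnorm (rho x) = 1.
Proof.
move=> x0; rewrite /rho sqnormZ exprVn sqr_sqrtr ?sqnorm_ge0 // mulVf //.
by rewrite sqnorm_eq0.
Qed.

Lemma rho_id x : sqnorm x = 1 -> rho x = x.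
Proof. by move=> x1; rewrite /rho x1 sqrtr1 invr1 scale1r. Qed.

Lemma rhoK x : Num.sqrt (sqnorm x) *: rho x = x.
Proof.
have [->|x0] := eqVneq x 0; first by rewrite /rho !scaler0.
by rewrite /rho scalerA mulfV ?scale1r // sqrtr_eq0 -ltNge sqnorm_gt0.
Qed.

Lemma rhoZ a x : 0 < a -> rho (a *: x) = rho x.
Proof.
move=> a0; rewrite /rho sqnormZ sqrtrM ?sqr_ge0 // sqrtr_sqr gtr0_norm // scalerA.
by rewrite invfM mulrAC mulVf ?mul1r // gt_eqF.
Qed.

Lemma sqrt_sqnorm_gt0 x : x != 0 -> 0 < Num.sqrt (sqnorm x).
Proof. by rewrite sqrtr_gt0 sqnorm_gt0. Qed.

Lemma neq0_near x : x != 0 -> \forall y \near x, y != 0.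
Proof.
move=> x0; have := @cvgr_gt _ _ _ _ _ (sqnorm x) (@sqnorm_continuous x) 0; rewrite sqnorm_gt0 => /(_ _ x0).
by apply: (@filterS _ (nbhs x)) => y; rewrite sqnorm_gt0.
Qed.

End Euclidean.

Section GenericPoint.
Context {R : realType}.

Lemma annihilator (a b c : 'rV[R]_4) : exists2 f : 'cV[R]_4, f != 0 &
  [/\ a *m f = 0, b *m f = 0 & c *m f = 0].
Proof.
pose M := col_mx a (col_mx b c).
have : cokermx M != 0.
  by rewrite cokermx_eq0 /row_full; have := rank_leq_row M; case: eqP => // ->.
move=> nz; have [j cj] : exists j, col j (cokermx M) != 0.
  apply/existsP; apply: contraNT nz => /existsPn h; apply/eqP/matrixP => i j.
  by have /negPn/eqP/matrixP/(_ i 0) := h j; rewrite !mxE.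
exists (col j (cokermx M)) => //.
have : M *m col j (cokermx M) = 0 by rewrite colE mulmxA mulmx_coker mul0mx.
rewrite /M !mul_col_mx => e; have {e} : col_mx (a *m col j (cokermx M))
   (col_mx (b *m col j (cokermx M)) (c *m col j (cokermx M))) = col_mx 0 (col_mx 0 0).
  by rewrite e !col_mx0.
by move=> /eq_col_mx[-> /eq_col_mx[-> ->]].
Qed.

Definition generic (fs : seq 'cV[R]_4) (q : 'rV[R]_4) := forall f, f \in fs -> (q *m f) 0 0 != 0.

(** The point is taken on the moment curve (1, s, s^2, s^3), where a nonzero functional becomes a
    nonzero polynomial in s. Their product cannot vanish at as many integers as its number of
    coefficients. *)
Lemma generic_exists (fs : seq 'cV[R]_4) : (forall f, f \in fs -> f != 0) -> exists q, generic fs q.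
Proof.
move=> nz; pose P (f : 'cV[R]_4) : {poly R} := \poly_(i < 4) f (inord i) 0.
have P0 f : f != 0 -> P f != 0.
  apply: contraNneq => Pf; apply/eqP/matrixP => i j; rewrite ord1 mxE.
  have := congr1 (fun p : {poly R} => p`_i) Pf; rewrite coef_poly ltn_ord coef0.
  by rewrite inord_val.
pose Q := \prod_(f <- fs) P f.
have Q0 : Q != 0 by rewrite prodf_seq_neq0; apply/allP => f ffs; apply: P0; exact: nz.
have [s Qs] : exists s : R, ~~ root Q s.
  pose rs : seq R := [seq i%:R | i <- iota 0 (size Q)].
  have : ~~ all (root Q) rs.
    apply/negP => h; have := max_poly_roots Q0 h.
    rewrite size_map size_iota ltnn map_inj_uniq ?iota_uniq; first by move=> /(_ isT).
    by move=> i j /eqP; rewrite eqr_nat => /eqP.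
  by move=> /allPn[s _ ?]; exists s.
exists (\row_j s ^+ j) => f ffs; apply: contra Qs => /eqP e.
rewrite /root horner_prod prodf_seq_eq0; apply/hasP; exists f => //=.
rewrite /P horner_poly; apply/eqP; rewrite -[RHS]e mxE; apply: eq_bigr => i _.
by rewrite mxE inord_val mulrC.
Qed.

End GenericPoint.

Section Punctured.
Context {R : realType}.
Implicit Types (ps : seq 'rV[R]_4) (a b q : 'rV[R]_4).

(** The open cone over the sphere minus the points of [ps]. Working in R^4 instead of on the sphere
    makes straight segments and triangles available. *)
Definition punctured ps : set 'rV[R]_4 := [set y | y != 0 /\ forall p, p \in ps -> rho y != p].

Lemma punctured_ball ps y : punctured ps y ->
  exists2 e : R, 0 < e & forall z, `|y - z| < e -> punctured ps z.
Proof.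
move=> [y0 yp].
have : \forall z \near y, z != 0 /\ forall p, p \in ps -> rho z != p.
  elim: ps yp => [|p ps IHps] yp.
    by have := neq0_near y0; apply: filterS.
  have /IHps : forall p, p \in ps -> rho y != p by move=> p' h; apply: yp; rewrite inE h orbT.
  have : rho y - p != 0 by rewrite subr_eq0; apply: yp; rewrite inE eqxx.
  have cr : continuous_at y (fun z => rho z - p).
    by apply: forcD; [exact: rho_continuous|exact: forc_cst].
  move=> /neq0_near/cr; apply: (@filterS2 _ (nbhs y)) => z /= zp [z0 zps]; split=> // p'.
  by rewrite inE => /orP[/eqP->|/zps //]; rewrite -subr_eq0.
by move=> /nbhs_ballP[e e0 he]; exists e => // z yz; apply: he; rewrite -ball_normE.
Qed.

(* A point of the triangle a b q with positive weight at q lies on no ray through a puncture,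
   since the functionals in fs vanish on a, b and the punctures but not at q. *)
Definition avoiding ps a b (fs : seq 'cV[R]_4) := forall q, generic fs q ->
  forall l1 l2 l3 : R, 0 < l3 -> punctured ps (l1 *: a + l2 *: b + l3 *: q).

(** For each puncture take a functional that kills it together with [a] and [b]; three vectors never
    span R^4. The extra entry 0 in the list keeps the triangle away from the origin. *)
Lemma avoiding_exists ps a b : exists2 fs : seq 'cV[R]_4,
  (forall f, f \in fs -> f != 0) & avoiding ps a b fs.
Proof.
pose F p := projT1 (cid2 (annihilator a b p)).
have FP p : [/\ F p != 0, a *m F p = 0, b *m F p = 0 & p *m F p = 0].
  by rewrite /F; case: cid2 => f /= f0 [].
exists [seq F p | p <- 0 :: ps].
  by move=> f /mapP[p _ ->]; case: (FP p).
move=> q gq l1 l2 l3 l30.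
have val p : p \in 0 :: ps -> ((l1 *: a + l2 *: b + l3 *: q) *m F p) 0 0 != 0.
  move=> pps; have [_ ha hb _] := FP p.
  rewrite !mulmxDl -!scalemxAl ha hb !scaler0 !add0r mxE mulf_neq0 ?(gt_eqF l30) //.
  by apply: gq; apply: map_f.
split.
  have := val 0 (mem_head _ _); apply: contraNneq => ->.
  by rewrite mul0mx mxE.
move=> p pps; have [_ _ _ hp] := FP p.
have := val p; rewrite inE pps orbT => /(_ isT); apply: contraNneq => e.
by rewrite -(rhoK (_ + _)) e -scalemxAl hp scaler0 mxE.
Qed.

Lemma generic_cat fs gs q : @generic R (fs ++ gs) q -> generic fs q /\ generic gs q.
Proof.
move=> h; split=> f ff; apply: h; rewrite mem_cat ff ?orbT //.
Qed.

(** The homotopy sweeps the triangle: points with positive weight at [q] are safe by genericity, the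
    others lie on the side from [a] to [b]. *)
Lemma htp_triangle ps a b q fs : avoiding ps a b fs -> generic fs q ->
  (forall t : R, 0 <= t <= 1 -> punctured ps ((1 - t) *: a + t *: b)) ->
  [/\ cpath (punctured ps) (seg a q), cpath (punctured ps) (seg q b) &
     htp (punctured ps) (seg a b) (pcat (seg a q) (seg q b))].
Proof.
move=> av gq ab.
have tri l1 l2 l3 : 0 <= l1 -> 0 <= l2 -> 0 <= l3 -> l1 + l2 + l3 = 1 ->
    punctured ps (l1 *: a + l2 *: b + l3 *: q).
  move=> l10 l20; rewrite le_eqVlt => /orP[/eqP<-|l30 _]; last exact: av.
  rewrite addr0 scale0r addr0 => e; have -> : l1 = 1 - l2 by lra.
  by apply: ab; apply/andP; split; lra.
have aq : cpath (punctured ps) (seg a q).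
  apply: cpath_seg => t /andP[t0 t1].
  have -> : (1 - t) *: a + t *: q = (1 - t) *: a + 0 *: b + t *: q by rewrite scale0r addr0.
  by apply: tri; lra.
have qb : cpath (punctured ps) (seg q b).
  apply: cpath_seg => t /andP[t0 t1].
  have -> : (1 - t) *: q + t *: b = 0 *: a + t *: b + (1 - t) *: q by rewrite scale0r add0r addrC.
  by apply: tri; lra.
split=> //; apply: htp_straight.
- exact: continuous_seg.
- by apply: continuous_pcat; exact: continuous_seg.
- by rewrite pcat0 !seg0.
- by rewrite pcat1 ?seg0 !seg1.
move=> t s /andP[t0 t1] /andP[s0 s1].
have [t2|t2] := leP t (1 / 2).
  rewrite pcat_l // /seg !clamp_id; [|lra..].
  have -> : (1 - s) *: ((1 - t) *: a + t *: b) + s *: ((1 - 2 * t) *: a + 2 * t *: q) =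
     ((1 - s) * (1 - t) + s * (1 - 2 * t)) *: a + ((1 - s) * t) *: b + (s * (2 * t)) *: q.
    by apply/rowP => k; rewrite !mxE; ring.
  by apply: tri; rewrite ?addr_ge0 ?mulr_ge0 //; [lra..|ring].
rewrite pcat_r ?seg0 ?seg1 //; last lra.
rewrite /seg !clamp_id; [|lra..].
have -> : (1 - s) *: ((1 - t) *: a + t *: b) + s *: ((1 - (2 * t - 1)) *: q + (2 * t - 1) *: b) =
   ((1 - s) * (1 - t)) *: a + ((1 - s) * t + s * (2 * t - 1)) *: b + (s * (1 - (2 * t - 1))) *: q.
  by apply/rowP => k; rewrite !mxE; ring.
by apply: tri; rewrite ?addr_ge0 ?mulr_ge0 //; [lra..|ring].
Qed.

(** A short piece of the path is straightened inside a ball and then replaced by two sides of a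
    triangle with apex [q]. When pieces are joined, the way from [q] to the common point and back
    cancels. The conditions on [q] are kept as a list of functionals, which stays finite along the
    induction. *)
Lemma htp_generic_cone ps (p : R -> 'rV[R]_4) : cpath (punctured ps) p ->
  exists2 fs : seq 'cV[R]_4, (forall f, f \in fs -> f != 0) & forall q, generic fs q ->
    [/\ cpath (punctured ps) (seg (p 0) q), cpath (punctured ps) (seg q (p 1)) &
     htp (punctured ps) p (pcat (seg (p 0) q) (seg q (p 1)))].
Proof.
move=> Xp.
pose Q (a b : R) := exists2 fs : seq 'cV[R]_4, (forall f, f \in fs -> f != 0) & forall q, generic fs q ->
    [/\ cpath (punctured ps) (seg (p a) q), cpath (punctured ps) (seg q (p b)) &
     htp (punctured ps) (subp p a b) (pcat (seg (p a) q) (seg q (p b)))].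
suff : Q 0 1 by rewrite /Q subp01.
apply: (@interval_induction _ Q) => [a b d ab bd [fs fs0 hf] [gs gs0 hg]|t t01].
  exists (fs ++ gs) => [f|q /generic_cat[/hf[aq qb h1] /hg[bq qd h2]]].
    by rewrite mem_cat => /orP[/fs0|/gs0].
  split=> //; apply: htp_trans (htp_sym (htp_subp a b d Xp)) _.
  apply: htp_trans (htp_cat_cancel aq qb qd _ _); rewrite ?seg0 ?seg1 // revp_seg.
  by apply: htp_cat; rewrite ?subp1 ?subp0.
have [e e0 he] := punctured_ball (Xp.2 t).
have [d d0 near] := continuous_at_dist (Xp.1 t) e0; exists d => // a b ab a0 b1 ad bd.
have cvxb (x y : 'rV[R]_4) (s : R) : `|p t - x| < e -> `|p t - y| < e -> 0 <= s <= 1 ->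
    `|p t - ((1 - s) *: x + s *: y)| < e.
  move=> xe ye /andP[s0 s1].
  have -> : p t - ((1 - s) *: x + s *: y) = (1 - s) *: (p t - x) + s *: (p t - y).
    rewrite !scalerBr addrACA -opprD; congr (_ - _).
    by rewrite -scalerDl subrK scale1r.
  apply: le_lt_trans (ler_normD _ _) _.
  rewrite !normrZ (ger0_norm s0) ger0_norm; last lra.
  have [->|s0'] := eqVneq s 0; first by rewrite mul0r subr0 mul1r addr0.
  have s0'' : 0 < s by rewrite lt0r s0' s0.
  have : s * `|p t - y| < s * e by rewrite ltr_pM2l.
  have : (1 - s) * `|p t - x| <= (1 - s) * e by apply: ler_wpM2l; [lra|exact: ltW].
  lra.
have [fs fs0 av] := avoiding_exists ps (p a) (p b).
exists fs => // q gq.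
have sab s : 0 <= s <= 1 -> punctured ps ((1 - s) *: p a + s *: p b).
  by move=> s01; apply: he; apply: (cvxb _ _ _) => //; exact: near.
have [h1 h2 h3] := htp_triangle av gq sab; split=> //.
apply: htp_trans h3; apply: htp_straight.
- exact: (cpath_subp _ _ Xp).1.
- exact: continuous_seg.
- by rewrite subp0 seg0.
- by rewrite subp1 seg1.
move=> u s /andP[u0 u1] s01; apply: he; apply: (cvxb _ _ _) => //; rewrite /seg ?clamp_id ?u0 //.
  apply: near; rewrite ltr_norml; move: ad bd; rewrite !ltr_norml => /andP[? ?] /andP[? ?].
  have : 0 <= u * (b - a) by rewrite mulr_ge0 // subr_ge0.
  have : u * (b - a) <= 1 * (b - a) by apply: ler_wpM2r => //; rewrite subr_ge0.
  by move=> ? ?; apply/andP; split; lra.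
have u01 : 0 <= u <= 1 by rewrite u0.
exact: (cvxb _ _ _ (near _ ad) (near _ bd) u01).
Qed.

(** Two paths admit a common generic apex, and with equal ends their cones are the same path. *)
Lemma punctured_simply_connected ps (p q : R -> 'rV[R]_4) :
  cpath (punctured ps) p -> cpath (punctured ps) q -> p 0 = q 0 -> p 1 = q 1 ->
  htp (punctured ps) p q.
Proof.
move=> Xp Xq e0 e1.
have [fs fs0 hf] := htp_generic_cone Xp; have [gs gs0 hg] := htp_generic_cone Xq.
have [f|v] := @generic_exists _ (fs ++ gs); first by rewrite mem_cat => /orP[/fs0|/gs0].
move=> /generic_cat[/hf[_ _ h1] /hg[_ _ h2]].
by apply: htp_trans h1 _; rewrite e0 e1; exact: htp_sym.
Qed.

Lemma punctured_connected ps x y : punctured ps x -> punctured ps y ->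
  exists p : R -> 'rV[R]_4, [/\ cpath (punctured ps) p, p 0 = x & p 1 = y].
Proof.
move=> Zx Zy.
have [fs fs0 hf] := htp_generic_cone (cpath_cst Zx).
have [gs gs0 hg] := htp_generic_cone (cpath_cst Zy).
have [f|v] := @generic_exists _ (fs ++ gs); first by rewrite mem_cat => /orP[/fs0|/gs0].
move=> /generic_cat[/hf[h1 _ _] /hg[_ h2 _]].
exists (pcat (seg x v) (seg v y)); split.
- by apply: cpath_cat => //; rewrite seg1 seg0.
- by rewrite pcat0 seg0.
- by rewrite pcat1 ?seg1 ?seg0.
Qed.

Lemma punctured_nonempty ps : exists x, punctured ps x.
Proof.
have [fs fs0 av] := avoiding_exists ps 0 0; have [q gq] := generic_exists fs0.
exists (0 *: 0 + 0 *: 0 + 1 *: q); exact: av.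
Qed.

End Punctured.

(** * Words of loops and the standard disk *)

Section TypedPaths.
Context {R : realType} {V : normedModType R} (X : set V).
Implicit Types (p q r : R -> V) (x y z : V).

Definition pth x y p := [/\ cpath X p, p 0 = x & p 1 = y].

Lemma pth_cat x y z p q : pth x y p -> pth y z q -> pth x z (pcat p q).
Proof.
move=> [Xp p0 p1] [Xq q0 q1]; have pq : p 1 = q 0 by rewrite p1 q0.
by split; [exact: cpath_cat|rewrite pcat0|rewrite pcat1].
Qed.

Lemma pth_rev x y p : pth x y p -> pth y x (revp p).
Proof. by move=> [Xp p0 p1]; split; [exact: cpath_revp|rewrite revp0|rewrite revp1]. Qed.

Lemma pth_cst x : X x -> pth x x (cst x).
Proof. by move=> Xx; split => //; exact: cpath_cst. Qed.

Lemma hcat x y z p p' q q' : pth x y p -> pth y z q -> htp X p p' -> htp X q q' ->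
  htp X (pcat p q) (pcat p' q').
Proof. by move=> [_ _ p1] [_ q0 _]; apply: htp_cat; rewrite p1 q0. Qed.

Lemma hrefl x y p : pth x y p -> htp X p p.
Proof. by move=> [Xp _ _]; exact: htp_refl. Qed.

Lemma hcatl x y z p p' q : pth x y p -> pth y z q -> htp X p p' -> htp X (pcat p q) (pcat p' q).
Proof. by move=> hp hq h; apply: (hcat hp hq) => //; exact: hrefl hq. Qed.

Lemma hcatr x y z p q q' : pth x y p -> pth y z q -> htp X q q' -> htp X (pcat p q) (pcat p q').
Proof. by move=> hp hq h; apply: (hcat hp hq) => //; exact: hrefl hp. Qed.

Lemma hassoc x y z t p q r : pth x y p -> pth y z q -> pth z t r ->
  htp X (pcat (pcat p q) r) (pcat p (pcat q r)).
Proof. by move=> [Xp p0 p1] [Xq q0 q1] [Xr r0 r1]; apply: htp_catA; rewrite ?p1 ?q0 ?q1 ?r0. Qed.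

Lemma hcatV x y z p q : pth x y p -> pth y z q -> htp X (pcat (revp p) (pcat p q)) q.
Proof.
move=> hp hq; have hr := pth_rev hp.
apply: htp_trans (htp_sym (hassoc hr hp hq)) _.
case: (hp) => [Xp p0 p1]; case: (hq) => [Xq q0 q1].
apply: htp_trans (htp_cat1l Xq); rewrite q0 -p1.
by apply: (hcatl (pth_cat hr hp) hq); exact: htp_catVl.
Qed.

Lemma hcat1l x y p : pth x y p -> htp X (pcat (cst x) p) p.
Proof. by move=> [Xp <- _]; exact: htp_cat1l. Qed.

End TypedPaths.

Section WordPaths.
Context {R : realType} {V : normedModType R} (X : set V) (o : V) {n : nat} (g : 'I_n -> R -> V).
Hypothesis Xo : X o.
Hypothesis gP : forall i, pth X o o (g i).

Definition letter_path (l : 'I_n * bool) := if l.2 then g l.1 else revp (g l.1).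
Definition word_path (w : seq ('I_n * bool)) : R -> V :=
  foldr (fun l p => pcat (letter_path l) p) (cst o) w.

Lemma letter_pathP l : pth X o o (letter_path l).
Proof. by rewrite /letter_path; case: l.2; [exact: gP|exact/pth_rev/gP]. Qed.

Lemma word_pathP w : pth X o o (word_path w).
Proof.
by elim: w => [|l w IHw] /=; [exact: pth_cst|exact: pth_cat (letter_pathP l) IHw].
Qed.

Lemma word_path_cat w w' : htp X (pcat (word_path w) (word_path w')) (word_path (w ++ w')).
Proof.
elim: w => [|l w IHw] /=; first exact: hcat1l (word_pathP w').
apply: htp_trans (hassoc (letter_pathP l) (word_pathP w) (word_pathP w')) _.
by apply: hcatr IHw; [exact: letter_pathP|exact: pth_cat (word_pathP w) (word_pathP w')].
Qed.

Lemma word_path_reduced w : exists2 w', reduced w' & htp X (word_path w) (word_path w').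
Proof.
elim: w => [|l w [w' rw' hw]] /=; first by exists [::] => //; exact: hrefl (word_pathP [::]).
have h1 : htp X (pcat (letter_path l) (word_path w)) (pcat (letter_path l) (word_path w')).
  by apply: hcatr hw; [exact: letter_pathP|exact: word_pathP].
case: w' rw' {hw} h1 => [|l' w'] rw' h1; first by exists [:: l].
have [c|nc] := boolP (cancels l l'); last first.
  by exists [:: l, l' & w'] => //; rewrite /reduced /= nc.
exists w'; first exact: path_sorted rw'.
apply: htp_trans h1 _ => /=.
have -> : letter_path l = revp (letter_path l').
  case/andP: c; rewrite /letter_path => /eqP ->; case: l.2; case: l'.2 => //= _.
  by rewrite revpK.
by apply: hcatV; [exact: letter_pathP|exact: word_pathP].
Qed.

Lemma Hol_rev (gT : finGroupType) (c : V -> V -> gT) x y p h : flat X c -> pth X x y p ->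
  Hol c p 0 1 h -> Hol c (revp p) 0 1 h^-1%g.
Proof.
move=> fc hp Hp; have [Xp p0 p1] := hp; have [k Hk] := Hol_exists fc (cpath_revp Xp).
suff -> : (h^-1)%g = k by [].
have Hc : Hol c (cst (p 0)) 0 1 (1 : gT)%g.
  by apply: Hol_trivial => t t'; rewrite (flat_refl fc) //; exact: Xp.2.
have := htp_Hol fc (htp_catVr Xp) (Hol_pcat _ Hp Hk) Hc.
by rewrite revp0 => /(_ erefl) e; apply: (mulgI h); rewrite e mulgV.
Qed.

Lemma Hol_word (gT : finGroupType) (c : V -> V -> gT) (s : 'I_n -> gT) w : flat X c ->
  (forall i, Hol c (g i) 0 1 (s i)) -> Hol c (word_path w) 0 1 (word_eval s w).
Proof.
move=> fc hs; elim: w => [|l w IHw] /=.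
  rewrite /word_eval big_nil; apply: Hol_trivial => t t'; exact: flat_refl fc Xo.
rewrite /word_eval big_cons; apply: Hol_pcat => //.
  by have [_ _ ->] := letter_pathP l; have [_ -> _] := word_pathP w.
rewrite /letter_path /letter_eval; case: l.2 => //.
exact: Hol_rev fc (gP _) (hs _).
Qed.

End WordPaths.

(** * Ellipsoids around the flat disk *)

Section Ellipsoid.
Context {R : realType}.
Implicit Types (e : R) (y : 'rV[R]_2 * R).

(** The set [gauge e y < 1] is the open ellipsoid with semi-axes 1 + e in the plane and e across it.
    It is convex, contains the flat disk and shrinks to it with e, and being quadratic it makes the
    radial push explicit. *)
Definition gauge e y : R := sqnorm y.1 / (1 + e) ^+ 2 + (y.2 / e) ^+ 2.

Lemma gauge_ge0 e y : 0 <= gauge e y.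
Proof. by rewrite addr_ge0 ?sqr_ge0 // divr_ge0 ?sqnorm_ge0 ?sqr_ge0. Qed.

Lemma gaugeZ e a y : gauge e (a *: y) = a ^+ 2 * gauge e y.
Proof. by rewrite /gauge /= sqnormZ -mulrA expr_div_n exprMn /= mulrDr mulrA expr_div_n -!mulrA. Qed.

Lemma gauge_continuous e : continuous (gauge e).
Proof.
by have cs := @sqnorm_continuous R 2; move=> y; rewrite /gauge; cont.
Qed.

Lemma gauge_eq0 e y : 0 < e -> (gauge e y == 0) = (y == 0).
Proof.
move=> e0; rewrite /gauge paddr_eq0 ?sqr_ge0 ?divr_ge0 ?sqnorm_ge0 ?sqr_ge0 //.
have e1 : (1 + e) ^+ 2 != 0 by rewrite expf_neq0 // gt_eqF ?addr_gt0.
rewrite mulf_eq0 invr_eq0 (negPf e1) orbF sqnorm_eq0.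
by rewrite sqrf_eq0 mulf_eq0 invr_eq0 (gt_eqF e0) orbF; case: y.
Qed.

Lemma gauge_lt e e' y : 0 < e -> e < e' -> y != 0 -> gauge e' y < gauge e y.
Proof.
move=> e0 ee' y0; rewrite /gauge !exprMn !exprVn.
have e'0 : 0 < e' by apply: lt_trans ee'.
have h1 : ((1 + e') ^+ 2)^-1 < ((1 + e) ^+ 2)^-1.
  by rewrite ltf_pV2 ?posrE ?exprn_gt0 ?addr_gt0 // !expr2; nra.
have h2 : (e' ^+ 2)^-1 < (e ^+ 2)^-1.
  by rewrite ltf_pV2 ?posrE ?exprn_gt0 // !expr2; nra.
have [x0|x0] := eqVneq y.1 0.
  have t0 : y.2 != 0 by apply: contra y0 => /eqP t0; case: y x0 t0 => x t /= -> ->.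
  by rewrite x0 sqnormE dot0l !mul0r !add0r ltr_pM2l // lt0r sqrf_eq0 t0 sqr_ge0.
by apply: ltr_leD; [rewrite ltr_pM2l ?sqnorm_gt0|rewrite ler_wpM2l ?sqr_ge0 // ltW].
Qed.

Lemma gauge_convex e y y' (s : R) : 0 <= s <= 1 ->
  gauge e ((1 - s) *: y + s *: y') <= (1 - s) * gauge e y + s * gauge e y'.
Proof.
move=> /andP[s0 s1]; rewrite -subr_ge0.
have -> : (1 - s) * gauge e y + s * gauge e y' - gauge e ((1 - s) *: y + s *: y') =
    (1 - s) * s * gauge e (y - y').
  rewrite /gauge /= !sqnormE !(dotDl, dotDr, dotZl, dotZr, dotNl, dotNr) (dotC y'.1 y.1) /=.
  by rewrite /GRing.scale /=; ring.
by rewrite mulr_ge0 ?gauge_ge0 // mulr_ge0 // subr_ge0.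
Qed.

Definition disk0 : set ('rV[R]_2 * R) := [set y | disk y.1 /\ y.2 = 0].

Lemma disk0_gauge e y : 0 < e -> disk0 y -> gauge e y < 1.
Proof.
move=> e0 [y1 y2]; rewrite /gauge y2 mul0r expr0n addr0.
rewrite ltr_pdivrMr ?mul1r; last by rewrite exprn_gt0 // addr_gt0.
apply: le_lt_trans y1 _; rewrite expr2; nra.
Qed.

(* Radial push out of the ellipsoid [gauge e < 1], the identity outside of it. *)
Definition push e y : 'rV[R]_2 * R := (Num.min 1 (Num.sqrt (gauge e y)))^-1 *: y.

Lemma push_id e y : 1 <= gauge e y -> push e y = y.
Proof.
move=> g1; rewrite /push min_l ?invr1 ?scale1r //.
by rewrite -sqrtr1 ler_sqrt // (le_trans ler01).
Qed.

Lemma gauge_push e y : 0 < e -> y != 0 -> gauge e y < 1 -> gauge e (push e y) = 1.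
Proof.
move=> e0 y0 g1; have g0 : 0 < gauge e y by rewrite lt0r gauge_ge0 andbT gauge_eq0.
rewrite /push min_r; last by rewrite -[leRHS]sqrtr1 ler_sqrt // ltW.
by rewrite gaugeZ exprVn sqr_sqrtr ?ltW // mulVf // gt_eqF.
Qed.

Lemma push_continuous e y : 0 < e -> y != 0 -> continuous_at y (push e).
Proof.
move=> e0 y0; have g0 : 0 < gauge e y by rewrite lt0r gauge_ge0 andbT gauge_eq0.
apply: forcZ; last exact: forc_id.
apply: forcV; first by rewrite gt_eqF // lt_min ltr01 sqrtr_gt0.
apply: (@continuous_min R _ (cst 1) (fun y => Num.sqrt (gauge e y))); first exact: cvg_cst.
apply: (@forc_comp _ _ _ (gauge e) (@Num.sqrt R)); first exact: gauge_continuous.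
exact: sqrt_continuous.
Qed.

Lemma push_notin e y : 0 < e -> y != 0 -> 1 <= gauge e (push e y).
Proof.
move=> e0 y0; have [g1|g1] := leP 1 (gauge e y); first by rewrite push_id.
by rewrite gauge_push.
Qed.

Lemma gauge_coord e y : 0 < e -> gauge e y <= 1 -> sqnorm y.1 <= (1 + e) ^+ 2 /\ `|y.2| <= e.
Proof.
move=> e0 g1; have e1 : 0 < (1 + e) ^+ 2 by rewrite exprn_gt0 // addr_gt0.
have h1 : sqnorm y.1 / (1 + e) ^+ 2 <= 1.
  by apply: le_trans g1; rewrite lerDl sqr_ge0.
have h2 : (y.2 / e) ^+ 2 <= 1.
  by apply: le_trans g1; rewrite lerDr divr_ge0 ?sqnorm_ge0 // ltW.
split; first by rewrite ler_pdivrMr // mul1r in h1.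
have : `|y.2 / e| <= 1 by rewrite -(@ler_sqr R) ?nnegrE // real_normK ?num_real // expr1n.
by rewrite normrM normfV (gtr0_norm e0) ler_pdivrMr // mul1r.
Qed.

Lemma gauge_near_disk0 e y : 0 < e -> gauge e y <= 1 -> exists2 y0, disk0 y0 & `|y0 - y| <= e.
Proof.
move=> e0 g1; have [h1 h2] := gauge_coord e0 g1; have e1 : 0 < 1 + e by rewrite addr_gt0.
have x1 : sqnorm ((1 + e)^-1 *: y.1) <= 1.
  by rewrite sqnormZ exprVn mulrC ler_pdivrMr ?mul1r // exprn_gt0.
exists ((1 + e)^-1 *: y.1, 0); first by split.
have -> : ((1 + e)^-1 *: y.1, 0) - y = (- (e *: ((1 + e)^-1 *: y.1)), - y.2).
  case: y {g1 h1 h2 x1} => x t; rewrite [LHS](_ : _ = ((1 + e)^-1 *: x - x, 0 - t)) // sub0r; congr pair.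
  apply/rowP => i; rewrite !mxE.
  have ? : 1 + e != 0 by rewrite gt_eqF.
  by field.
rewrite /Num.norm /= ge_max !normrN h2 andbT normrZ gtr0_norm //.
rewrite -[leRHS]mulr1; apply: ler_wpM2l; first exact: ltW.
have := le_trans (norm_le_sqnorm ((1 + e)^-1 *: y.1)) x1.
by rewrite -[leRHS](expr1n R 2) ler_sqr ?nnegrE.
Qed.

Lemma closed_ellipsoid_compact e : 0 < e -> compact [set y | gauge e y <= 1].
Proof.
move=> e0.
have K1 : compact [set x : 'rV[R]_2 | `|x| <= 1 + e].
  apply: bounded_closed_compact.
    exists (1 + e); split; first exact: num_real.
    by move=> M M1 x /= xe; apply: le_trans (ltW M1).
  by apply: (@closed_comp _ _ (@Num.norm R 'rV[R]_2) [set t | t <= 1 + e]); [move=> x _; exact: norm_continuous|exact: closed_le].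
have K2 : compact `[- e, e] by exact: segment_compact.
apply: (subclosed_compact _ (compact_setX K1 K2)).
  by apply: (@closed_comp _ _ (gauge e) [set t | t <= 1]); [move=> y _; exact: gauge_continuous|exact: closed_le].
move=> y g1; have [h1 h2] := gauge_coord e0 g1; split => /=.
  rewrite -(@ler_sqr R) ?nnegrE //; last by rewrite addr_ge0 // ltW.
  exact: le_trans (norm_le_sqnorm _) h1.
by rewrite in_itv /= -ler_norml.
Qed.

Lemma disk0_compact : compact disk0.
Proof.
apply: (subclosed_compact _ (closed_ellipsoid_compact ltr01)).
  have -> : disk0 = (@sqnorm R 2 \o fst) @^-1` [set t | t <= 1] `&` snd @^-1` [set 0].
    by [].
  apply: closedI; apply: closed_comp.
  - by have cs := @sqnorm_continuous R 2; move=> y _; rewrite /comp; cont.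
  - exact: closed_le.
  - by move=> y _; exact: cvg_snd.
  - exact: closed_eq.
by move=> y /(disk0_gauge ltr01)/ltW.
Qed.

Lemma compact_thickening (T : normedModType R) (K O : set T) : compact K ->
  (forall x, K x -> nbhs x O) -> exists2 d : R, 0 < d & forall x y : T, K x -> `|x - y| < d -> O y.
Proof.
move=> /compact_near_coveringP cK KO.
have [|d /= d0 hd] := cK R 0^'+ (fun d x => forall y : T, `|x - y| < d -> O y) _.
  move=> x /KO/nbhs_normP[e /= e0 he].
  exists (ball x (e / 2), [set d | d < e / 2]).
    split; first by apply: nbhsx_ballx; rewrite divr_gt0.
    by apply: nbhs_right_lt; rewrite divr_gt0.
  move=> [x' d] [/= xx' de] y x'y; apply: he => /=.
  have xx'' : `|x - x'| < e / 2 by move: xx'; rewrite -ball_normE.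
  have -> : x - y = (x - x') + (x' - y) by rewrite addrA subrK.
  by apply: le_lt_trans (ler_normD _ _) _; lra.
exists (d / 2); first by rewrite divr_gt0.
move=> x y Kx xy; have d2 : 0 < d / 2 by rewrite divr_gt0.
apply: (hd (d / 2) _ d2 x Kx y xy).
by rewrite /= sub0r normrN gtr0_norm // ltr_pdivrMr // ltr_pMr // ltr1n.
Qed.

End Ellipsoid.

(** * Generation of the fundamental groupoid *)

Section TubeSystem.
Context {R : realType} {n : nat}.
Local Notation E := ('rV[R]_2 * R)%type.
Implicit Types (y : E) (e : R) (p q : R -> 'rV[R]_4).

(* Phi i parametrizes a neighbourhood in the 3-sphere of the i-th disk, which is the image of
   disk0; its core curve is the image of circle0. *)
Definition tube_system e (Phi : 'I_n -> E -> 'rV[R]_4) := [/\ 0 < e,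
  (forall i y, gauge e y < 1 -> continuous_at y (Phi i) /\ sphere3 (Phi i y)),
  (forall i j y y', gauge e y < 1 -> gauge e y' < 1 -> Phi i y = Phi j y' -> i = j /\ y = y') &
  (forall i y (W : set E), gauge e y < 1 -> nbhs y W ->
     \forall z \near Phi i y, sphere3 z -> exists2 y', W y' & z = Phi i y')].

Definition circle0 : set E := [set y | circle y.1 /\ y.2 = 0].

Context {e : R} {Phi : 'I_n -> E -> 'rV[R]_4}.
Hypothesis TS : tube_system e Phi.

Let e_gt0 : 0 < e. Proof. by case: TS. Qed.
Let PhiC i y : gauge e y < 1 -> continuous_at y (Phi i).
Proof. by case: TS => _ h _ _ /(h i)[]. Qed.
Let PhiS i y : gauge e y < 1 -> sphere3 (Phi i y).
Proof. by case: TS => _ h _ _ /(h i)[]. Qed.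
Let PhiI i j y y' : gauge e y < 1 -> gauge e y' < 1 -> Phi i y = Phi j y' -> i = j /\ y = y'.
Proof. by case: TS => _ _ h _; exact: h. Qed.
Let PhiO i y (W : set E) : gauge e y < 1 -> nbhs y W ->
  \forall z \near Phi i y, sphere3 z -> exists2 y', (W y' /\ gauge e y' < 1) & z = Phi i y'.
Proof.
move=> gy Wy; case: TS => _ _ _ h.
have := h i y (W `&` [set y | gauge e y < 1]) gy; apply.
by apply: filterI => //; exact: (@gauge_continuous R e y [set t | t < 1] (lt_nbhsl gy)).
Qed.

Definition outside_disks : set 'rV[R]_4 := sphere3 `\` \bigcup_i (Phi i @` disk0).
Definition outside_circles : set 'rV[R]_4 := sphere3 `\` \bigcup_i (Phi i @` circle0).
Local Notation A := outside_disks.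
Local Notation X := outside_circles.

Lemma outside_disks_circles : A `<=` X.
Proof.
move=> x [Sx Dx]; split=> // -[i _ [y [y1 y2] yx]]; apply: Dx; exists i => //; exists y => //.
by split=> //; rewrite /disk /= y1.
Qed.

Let disk0_gauge_lt y : disk0 y -> gauge e y < 1.
Proof. exact: disk0_gauge. Qed.

Definition centers : seq 'rV[R]_4 := [seq Phi i 0 | i <- enum 'I_n].

Let gauge0 d : gauge d (0 : E) = 0.
Proof. by rewrite -(scale0r (0 : E)) gaugeZ expr0n mul0r. Qed.

Let rho_sphere (v : 'rV[R]_4) : v != 0 -> sphere3 (rho v).
Proof. exact: sqnorm_rho. Qed.

Section Push.
Context {d : R}.
Hypothesis (d0 : 0 < d) (de : d < e).

Let push_gauge_lt y : y != 0 -> gauge e y < 1 -> gauge e (push d y) < 1.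
Proof.
move=> y0 gy; have [g1|g1] := leP 1 (gauge d y); first by rewrite push_id.
have gp := gauge_push d0 y0 g1.
rewrite -gp; apply: gauge_lt => //.
by rewrite -(gauge_eq0 _ d0) gp oner_neq0.
Qed.

(** Maps the cone minus the rays through the centres into the complement of the disks, which thereby
    inherits connectedness and simple connectedness. The chosen tube coordinates are unique, since
    the tubes are embedded and disjoint. *)
Definition push_off (v : 'rV[R]_4) : 'rV[R]_4 :=
  if pselect (exists i y, gauge e y < 1 /\ rho v = Phi i y) is left h then
    let i := projT1 (cid h) in let y := projT1 (cid (projT2 (cid h))) in Phi i (push d y)
  else rho v.

Lemma push_off_in v i y : gauge e y < 1 -> rho v = Phi i y -> push_off v = Phi i (push d y).
Proof.
move=> gy vy; rewrite /push_off; case: pselect => [h|[]]; last by exists i, y.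
case: cid => j h' /=; case: cid => y' [gy' vy'] /=.
by move: vy'; rewrite vy => /(PhiI gy gy')[<- <-].
Qed.

Lemma push_off_out v : ~ (exists i y, gauge e y < 1 /\ rho v = Phi i y) -> push_off v = rho v.
Proof. by rewrite /push_off; case: pselect. Qed.

Lemma push_off_id v : sphere3 v -> (forall i y, gauge d y < 1 -> gauge e y < 1 -> v <> Phi i y) ->
  push_off v = v.
Proof.
move=> Sv vout; have rv := rho_id Sv.
have [[i [y [gy vy]]]|h] := pselect (exists i y, gauge e y < 1 /\ rho v = Phi i y).
  rewrite (push_off_in gy vy) push_id -?vy //.
  by rewrite leNgt; apply/negP => gd; case: (vout i y gd gy); rewrite -vy rv.
by rewrite push_off_out.
Qed.

Lemma push_off_outside v : punctured centers v -> A (push_off v).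
Proof.
move=> [v0 vc].
have [[i [y [gy vy]]]|h] := pselect (exists i y, gauge e y < 1 /\ rho v = Phi i y).
  have y0 : y != 0.
    apply/eqP => y0; have /vc : Phi i 0 \in centers by apply: map_f; rewrite mem_enum.
    by rewrite vy y0 eqxx.
  rewrite (push_off_in gy vy); have gp := push_gauge_lt y0 gy; split; first exact: PhiS.
  move=> [j _ [y' Dy' e']]; have := PhiI (disk0_gauge_lt Dy') gp e' => -[_ ey].
  have := push_notin d0 y0; rewrite -ey leNgt; apply/negP/negPn.
  exact: disk0_gauge.
rewrite push_off_out //; split; first exact: rho_sphere.
move=> [j _ [y' Dy' e']]; apply: h; exists j, y'; split => //; exact: disk0_gauge_lt.
Qed.

Lemma push_off_continuous v : punctured centers v -> continuous_at v push_off.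
Proof.
move=> [v0 vc] W; have cr := rho_continuous v0.
have [[i [y [gy vy]]]|h] := pselect (exists i y, gauge e y < 1 /\ rho v = Phi i y).
  have y0 : y != 0.
    apply/eqP => y0; have /vc : Phi i 0 \in centers by apply: map_f; rewrite mem_enum.
    by rewrite vy y0 eqxx.
  rewrite (push_off_in gy vy) => NW.
  have cp : continuous_at y (fun y => Phi i (push d y)).
    by apply: (forc_comp (push_continuous d0 y0)); apply: PhiC; exact: push_gauge_lt.
  have := PhiO i gy (cp _ NW); rewrite -vy => /cr.
  have := neq0_near v0; apply: filterS2 => w w0 /= hw.
  have [y' [Wy' gy'] wy'] := hw (rho_sphere w0).
  by rewrite (push_off_in gy' wy').
rewrite push_off_out // => NW.
(* Outside the open tubes one stays away from the smaller closed ellipsoids, which are compact as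
   [d < e]; beyond them [push d] is the identity and the two cases of the definition agree. *)
have NC : nbhs (rho v) (~` \bigcup_i (Phi i @` [set y | gauge d y <= 1])).
  apply: open_nbhs_nbhs; split.
    apply: closed_openC; apply: closed_bigcup => //.
      exact: finite_finset.
    move=> i _; apply: compact_closed; first exact: norm_hausdorff.
    apply: continuous_compact; last exact: closed_ellipsoid_compact.
    apply: continuous_in_subspaceT => y; rewrite inE /= => gy; apply: PhiC.
    have [->|y0] := eqVneq y 0; first by rewrite gauge0.
    by apply: lt_le_trans gy; exact: gauge_lt.
  move=> [i _ [y /= gy vy]]; apply: h; exists i, y; split => //.
  have [->|y0] := eqVneq y 0; first by rewrite gauge0.
  by apply: lt_le_trans gy; exact: gauge_lt.
have NCW0 : nbhs (rho v) ((~` (\bigcup_i (Phi i @` [set y | gauge d y <= 1]))) `&` W) by exact: filterI.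
have NCW := cr _ NCW0.
move: NCW; have := neq0_near v0; apply: filterS2 => w w0 /= [wC Ww].
suff -> : push_off w = rho w by [].
have [[i [y [gy wy]]]|h'] := pselect (exists i y, gauge e y < 1 /\ rho w = Phi i y); last first.
  by rewrite push_off_out.
rewrite (push_off_in gy wy) push_id -?wy // leNgt; apply/negP => gd.
by apply: wC; exists i => //; exists y => //=; exact: ltW.
Qed.

End Push.

(** A push with such a [d] fixes [K] pointwise, so given paths are not disturbed. *)
Lemma thin_tube (K : set 'rV[R]_4) : compact K -> K `<=` A ->
  exists d : R, [/\ 0 < d, d < e & forall i y, gauge d y < 1 -> ~ K (Phi i y)].
Proof.
move=> cK KA.
have cl : closed K by apply: compact_closed => //; exact: norm_hausdorff.
have D i : exists2 d : R, 0 < d & forall y0 y : E, disk0 y0 -> `|y0 - y| < d -> ~ K (Phi i y).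
  apply: (@compact_thickening _ E disk0 (fun y => ~ K (Phi i y))); first exact: disk0_compact.
  move=> y Dy; apply: (@PhiC i y (disk0_gauge_lt Dy) (~` K)); apply: open_nbhs_nbhs; split.
    exact: closed_openC.
  by move=> /KA[_]; apply; exists i => //; exists y.
pose dd i := projT1 (cid2 (D i)).
have ddP i : 0 < dd i /\ forall y0 y : E, disk0 y0 -> `|y0 - y| < dd i -> ~ K (Phi i y).
  by rewrite /dd; case: cid2.
pose m := \big[Num.min/e]_i dd i.
have m0 : 0 < m by apply: (big_ind (fun x => 0 < x)) => // [a b a0 b0|i _]; [rewrite lt_min a0|case: (ddP i)].
exists (m / 2); split; first by rewrite divr_gt0.
  have : m <= e by exact: bigmin_le_id.
  by lra.
move=> i y gy; have m20 : 0 < m / 2 by rewrite divr_gt0.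
have [y0 Dy0 yy0] := gauge_near_disk0 m20 (ltW gy).
apply: (ddP i).2 Dy0 _; apply: le_lt_trans yy0 _.
have : m <= dd i by exact: bigmin_le_cond.
by lra.
Qed.

Lemma path_image_compact p : continuous p -> compact (p @` `[0, 1]).
Proof.
move=> cp; apply: continuous_compact; last exact: segment_compact.
exact: continuous_subspaceT.
Qed.

Let outside_punctured x : A x -> punctured centers x.
Proof.
move=> [Sx Dx]; split.
  by rewrite -sqnorm_gt0 Sx ltr01.
move=> c /mapP[i _ ->]; rewrite (rho_id Sx); apply/eqP => xi; apply: Dx; exists i => //.
exists 0 => //; split=> //; by rewrite /disk /= /sqnorm big1 // => j _; rewrite mxE expr0n.
Qed.

Lemma outside_disks_nonempty : exists x, A x.
Proof.
have [v pv] := punctured_nonempty centers.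
exists (@push_off (e / 2) v); apply: push_off_outside => //; first by rewrite divr_gt0.
by have := e_gt0; lra.
Qed.

Lemma outside_disks_connected (x y : 'rV[R]_4) : A x -> A y -> exists p, pth A x y p.
Proof.
move=> Ax Ay.
have [d [d0 de dK]] : exists d : R, [/\ 0 < d, d < e & forall i y', gauge d y' < 1 -> ~ [set x; y] (Phi i y')].
  apply: thin_tube; last by move=> z [->|->].
  by apply: finite_compact.
have [p [Xp p0 p1]] := punctured_connected (outside_punctured Ax) (outside_punctured Ay).
have fix_ z : [set x; y] z -> A z -> @push_off d z = z.
  move=> xyz [Sz _]; apply: push_off_id => // i y' gy' _ e'; apply: (dK i y' gy').
  by rewrite -e'.
exists (@push_off d \o p); split.
- by apply: (cpath_map _ _ Xp) => v; [exact: push_off_continuous|exact: push_off_outside].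
- by rewrite /= p0 fix_ //; left.
- by rewrite /= p1 fix_ //; right.
Qed.

(** A homotopy in the punctured cone is pushed off the disks with a [d] so small that both paths
    remain where they are. *)
Lemma outside_disks_simply_connected (x y : 'rV[R]_4) p q : pth A x y p -> pth A x y q -> htp A p q.
Proof.
move=> [Ap p0 p1] [Aq q0 q1].
have [d [d0 de dK]] : exists d : R, [/\ 0 < d, d < e & forall i y',
    gauge d y' < 1 -> ~ (p @` `[0, 1] `|` q @` `[0, 1]) (Phi i y')].
  apply: thin_tube; last by move=> z [] [t _ <-]; [exact: Ap.2|exact: Aq.2].
  by apply: compactU; apply: path_image_compact; [case: Ap|case: Aq].
have fixp r : cpath A r -> (forall t : R, 0 <= t <= 1 -> (p @` `[0, 1] `|` q @` `[0, 1]) (r t)) ->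
    htp A r (@push_off d \o r).
  move=> Ar hr; apply: htp_eq => // t t01 /=; rewrite push_off_id //; first by case: (Ar.2 t).
  move=> i y' gy' _ e'; apply: (dK i y' gy'); rewrite -e'; apply: hr.
  done.
have Pp r : cpath A r -> cpath (punctured centers) r.
  by apply: cpath_sub => z; exact: outside_punctured.
apply: htp_trans (fixp p Ap _) _; first by move=> t t01; left; exists t => //=; rewrite in_itv.
apply: htp_trans (htp_sym (fixp q Aq _)); last by move=> t t01; right; exists t => //=; rewrite in_itv.
apply: (@htp_map _ _ _ (punctured centers)); first by move=> v; exact: push_off_continuous.
  by move=> v; exact: push_off_outside.
by apply: punctured_simply_connected; rewrite ?p0 ?p1 //; exact: Pp.
Qed.

Definition convex_cell (C : set E) := C `<=` [set y | gauge e y < 1] /\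
  forall y y' (s : R), 0 <= s <= 1 -> C y -> C y' -> C ((1 - s) *: y + s *: y').

(** Injectivity of the tube defines the lift, and its openness makes the lift continuous. Homotopies
    in a cell are then straight-line homotopies upstairs. *)
Lemma cell_lift (C : set E) i p : convex_cell C -> cpath (Phi i @` C) p ->
  exists2 a : R -> E, cpath C a & p = Phi i \o a.
Proof.
move=> [Cg _] [cp Cp]; pose a t := projT1 (cid2 (Cp t)).
have aP t : C (a t) /\ Phi i (a t) = p t by rewrite /a; case: cid2.
exists a; last by apply/funext => t /=; rewrite (aP t).2.
split=> [t W NW|t]; last by case: (aP t).
have [Cat at_] := aP t; have := PhiO i (Cg _ Cat) NW; rewrite at_ => /cp.
apply: (@filterS _ (nbhs t)) => u /= hu.
have [Cau au] := aP u; have Spu : sphere3 (p u) by rewrite -au; exact: PhiS (Cg _ Cau).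
have [y' [Wy' gy'] py'] := hu Spu.
by have := PhiI (Cg _ Cau) gy' (etrans au py') => -[_ ->].
Qed.

Lemma cell_htp (C : set E) i p q : convex_cell C -> cpath (Phi i @` C) p -> cpath (Phi i @` C) q ->
  p 0 = q 0 -> p 1 = q 1 -> htp (Phi i @` C) p q.
Proof.
move=> CC Cp Cq; have [a Ca ->] := cell_lift CC Cp; have [b Cb ->] := cell_lift CC Cq.
have [Cg Cc] := CC => /= e0 e1.
apply: (@htp_map _ _ _ C).
- by move=> y /Cg; exact: PhiC.
- by move=> y Cy; exists y.
apply: htp_straight; [by case: Ca|by case: Cb| | |].
- by have := PhiI (Cg _ (Ca.2 0)) (Cg _ (Cb.2 0)) e0 => -[].
- by have := PhiI (Cg _ (Ca.2 1)) (Cg _ (Cb.2 1)) e1 => -[].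
by move=> t s _ s01; apply: Cc => //; [exact: Ca.2|exact: Cb.2].
Qed.

Lemma cell_seg (C : set E) i y y' : convex_cell C -> C y -> C y' ->
  pth (Phi i @` C) (Phi i y) (Phi i y') (Phi i \o seg y y').
Proof.
move=> [Cg Cc] Cy Cy'; split; last 2 first.
- by rewrite /= seg0.
- by rewrite /= seg1.
apply: (@cpath_map _ _ _ C); [by move=> z /Cg; exact: PhiC|by move=> z Cz; exists z|].
by apply: cpath_seg => t t01; exact: Cc.
Qed.

(** The part of the tube above the open disk: it meets no core circle, and its two open halves
    [cellp] and [cellm] miss the disks. *)
Let cell : set E := [set y | gauge e y < 1 /\ sqnorm y.1 < 1].
Let cellp : set E := [set y | cell y /\ 0 < y.2].
Let cellm : set E := [set y | cell y /\ y.2 < 0].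

Let cell_convex : convex_cell cell.
Proof.
split=> [y []//|y y' s s01 [gy y1] [gy' y1']]; have /andP[s0 s1] := s01.
have mix (a b : R) : a < 1 -> b < 1 -> (1 - s) * a + s * b < 1.
  move=> a1 b1; have [->|s0'] := eqVneq s 0; first by rewrite subr0 mul1r mul0r addr0.
  have : s * b < s * 1 by rewrite ltr_pM2l // lt0r s0'.
  have : (1 - s) * a <= (1 - s) * 1 by rewrite ler_wpM2l ?(ltW a1) // subr_ge0.
  by lra.
split; first by apply: le_lt_trans (gauge_convex e y y' s01) _; exact: mix.
apply: le_lt_trans (mix _ _ y1 y1'); rewrite /= -subr_ge0.
have -> : (1 - s) * sqnorm y.1 + s * sqnorm y'.1 - sqnorm ((1 - s) *: y.1 + s *: y'.1) =
    (1 - s) * s * sqnorm (y.1 - y'.1).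
  by rewrite !sqnormE !(dotDl, dotDr, dotZl, dotZr, dotNl, dotNr) (dotC y'.1 y.1); ring.
by rewrite mulr_ge0 ?sqnorm_ge0 // mulr_ge0 // subr_ge0.
Qed.

Let cellp_convex : convex_cell cellp.
Proof.
split=> [y [[]]//|y y' s s01 [Cy y2] [Cy' y2']]; split; first exact: cell_convex.2.
by have /andP[s0 s1] := s01; rewrite /= /GRing.scale /=; nra.
Qed.

Let cellm_convex : convex_cell cellm.
Proof.
split=> [y [[]]//|y y' s s01 [Cy y2] [Cy' y2']]; split; first exact: cell_convex.2.
by have /andP[s0 s1] := s01; rewrite /= /GRing.scale /=; nra.
Qed.

Let Phi_outside_disks i y : gauge e y < 1 -> ~ disk0 y -> A (Phi i y).
Proof.
move=> gy Dy; split; first exact: PhiS.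
by move=> [j _ [y' Dy' /(PhiI (disk0_gauge_lt Dy') gy)[_ e']]]; apply: Dy; rewrite -e'.
Qed.

Let cell_outside_circles i : Phi i @` cell `<=` X.
Proof.
move=> _ [y [gy y1] <-]; split; first exact: PhiS.
move=> [j _ [y' [c1 c2] e']]; have gy' : gauge e y' < 1 by apply: disk0_gauge_lt; split; rewrite // /disk /= c1.
have [_ e''] := PhiI gy' gy e'; move: y1; rewrite -e'' c1 ltxx.
by [].
Qed.

Let cellp_outside_disks i : Phi i @` cellp `<=` A.
Proof.
by move=> _ [y [[gy _] y2] <-]; apply: Phi_outside_disks => // -[_ y20]; move: y2; rewrite y20 ltxx.
Qed.

Let cellm_outside_disks i : Phi i @` cellm `<=` A.
Proof.
by move=> _ [y [[gy _] y2] <-]; apply: Phi_outside_disks => // -[_ y20]; move: y2; rewrite y20 ltxx.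
Qed.

Let outside_circles_cases x : X x -> A x \/ exists i y, [/\ cell y, y.2 = 0 & x = Phi i y].
Proof.
move=> [Sx Kx]; have [Ax|nAx] := pselect (A x); [by left|right].
have [i _ [y Dy yx]] : (\bigcup_i (Phi i @` disk0)) x.
  by apply: contrapT => h; apply: nAx; split.
exists i, y; split => //; last by case: Dy.
split; first exact: disk0_gauge_lt.
have [y1 y2] := Dy; rewrite lt_neqAle; apply/andP; split => //.
by apply/eqP => c; apply: Kx; exists i => //; exists y.
Qed.

Let outside_disks_near x : A x -> \forall z \near x, sphere3 z -> A z.
Proof.
move=> [Sx Dx].
have : nbhs x (~` (\bigcup_i (Phi i @` disk0))).
  apply: open_nbhs_nbhs; split => //; apply: closed_openC; apply: closed_bigcup => //.
    exact: finite_finset.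
  move=> i _; apply: compact_closed; first exact: norm_hausdorff.
  apply: continuous_compact; last exact: disk0_compact.
  by apply: continuous_in_subspaceT => y; rewrite inE => /disk0_gauge_lt; exact: PhiC.
by apply: filterS => z Dz Sz.
Qed.

Let cell_near x i y : cell y -> x = Phi i y -> \forall z \near x, sphere3 z -> (Phi i @` cell) z.
Proof.
move=> [gy y1] ->; have : nbhs y [set y | sqnorm y.1 < 1].
  have cs : continuous_at y (fun y => sqnorm y.1).
    by have cs := @sqnorm_continuous R 2; cont.
  exact: (cs [set t | t < 1] (lt_nbhsl y1)).
move=> /(PhiO i gy); apply: filterS => z h /h[y' [s1 gy'] ->].
by exists y'.
Qed.

(** The space is covered by the complement of the disks, where homotopy classes are determined by
    end points, and by one convex cell around each open disk. The loop [g i] enters the i-th cell on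
    its upper half, passes through the disk, and returns from the lower half outside the disks. A
    short piece of a path lies in one member of the cover, so it contributes at most a few
    letters. *)
Lemma generation : exists b0 (eta : 'rV[R]_4 -> R -> 'rV[R]_4) (g : 'I_n -> R -> 'rV[R]_4),
  [/\ X b0, (forall i, pth X b0 b0 (g i)), (forall x, X x -> pth X b0 x (eta x)) &
    forall p, cpath X p -> exists w,
      htp X (pcat (eta (p 0)) p) (pcat (word_path b0 g w) (eta (p 1)))].
Proof.
have [b0 Ao] := outside_disks_nonempty; have Xo := outside_disks_circles Ao.
have AX x p q : pth A b0 x p -> pth A b0 x q -> htp X p q.
  by move=> hp hq; apply: htp_sub (outside_disks_simply_connected hp hq); exact: outside_disks_circles.
have pthS (Y : set 'rV[R]_4) (x y : 'rV[R]_4) p : Y `<=` X -> pth Y x y p -> pth X x y p.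
  by move=> YX [Yp p0 p1]; split=> //; exact: cpath_sub Yp.
have AXp (x y : 'rV[R]_4) p : pth A x y p -> pth X x y p by apply: pthS; exact: outside_disks_circles.
have ex x : exists p, A x -> pth A b0 x p.
  have [Ax|nAx] := pselect (A x); last by exists (cst b0).
  by have [p hp] := outside_disks_connected Ao Ax; exists p.
pose tail x := projT1 (cid (ex x)).
have tailP x : A x -> pth A b0 x (tail x) by rewrite /tail; case: cid.
(* Base points of the two halves, on the axis of the tube at half its thickness. *)
pose bp : E := (0, e / 2); pose bm : E := (0, - (e / 2)).
have e2 : 0 < e / 2 by rewrite divr_gt0.
have s0 : sqnorm (0 : 'rV[R]_2) = 0 by rewrite sqnormE dot0l.
have gb (t : R) : t ^+ 2 = 1 / 4 -> gauge e ((0 : 'rV[R]_2), t * e) < 1.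
  move=> t2; rewrite /gauge /= s0 mul0r add0r mulfK ?gt_eqF // t2; lra.
have Cbp : cellp bp.
  split=> //; split; last by rewrite /= s0.
  by rewrite /bp mulrC; apply: gb; rewrite expr2; lra.
have Cbm : cellm bm.
  split; last by rewrite /= oppr_lt0.
  split; last by rewrite /= s0.
  by rewrite /bm -mulrN mulrC; apply: gb; rewrite expr2; lra.
have [Cp _] := Cbp; have [Cm _] := Cbm.
have Abp i : A (Phi i bp) by apply: cellp_outside_disks; exists bp.
have Abm i : A (Phi i bm) by apply: cellm_outside_disks; exists bm.
pose beta i y := pcat (tail (Phi i bp)) (Phi i \o seg bp y).
have cellX i y y' : cell y -> cell y' -> pth X (Phi i y) (Phi i y') (Phi i \o seg y y').
  by move=> Cy Cy'; apply: pthS (cell_seg i cell_convex Cy Cy'); exact: cell_outside_circles.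
have betaP i y : cell y -> pth X b0 (Phi i y) (beta i y).
  by move=> Cy; apply: pth_cat (AXp _ _ _ (tailP _ (Abp i))) (cellX i _ _ Cp Cy).
(* A point of an open disk gets the tail that approaches it from the upper half. The two clauses are
   consistent, and the second one determines [i] and [y] by injectivity. *)
have ex' x : exists p, (A x -> p = tail x) /\
    forall i y, cell y -> y.2 = 0 -> x = Phi i y -> p = beta i y.
  have [Ax|nAx] := pselect (A x).
    exists (tail x); split => // i y [gy y1] y2 xy; exfalso.
    by case: Ax => _; apply; exists i => //; exists y => //; split => //; exact: ltW.
  have [[i [y [Cy y2 xy]]]|h] := pselect (exists i y, [/\ cell y, y.2 = 0 & x = Phi i y]); last first.
    by exists (cst b0); split=> // i y Cy y2 xy; exfalso; apply: h; exists i, y.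
  exists (beta i y); split => // j y' [gy' _] _; rewrite xy => /(PhiI (Cy.1) gy')[-> ->].
  by [].
pose eta x := projT1 (cid (ex' x)).
have etaA x : A x -> eta x = tail x by rewrite /eta; case: cid => p /= [h _] /h.
have etaD i y : cell y -> y.2 = 0 -> eta (Phi i y) = beta i y.
  by move=> Cy y2; rewrite /eta; case: cid => p /= [_ h]; exact: h.
pose g i := pcat (beta i bm) (revp (tail (Phi i bm))).
have tX x : A x -> pth X b0 x (tail x) by move=> Ax; exact/AXp/tailP.
have gP i : pth X b0 b0 (g i) by apply: pth_cat (betaP i _ Cm) (pth_rev (tX _ (Abm i))).
have etaP x : X x -> pth X b0 x (eta x).
  move=> /outside_circles_cases[Ax|[i [y [Cy y2 ->]]]]; first by rewrite etaA //; exact: tX.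
  by rewrite etaD //; exact: betaP.
have wpP w := word_pathP Xo gP w.
(* Approaching a point of the cell from above agrees with its own tail unless the point lies below
   the disk; there the two differ by one passage through the disk, which is [g i]. *)
have star i y : cell y -> (exists w, htp X (eta (Phi i y)) (pcat (word_path b0 g w) (beta i y))) /\
    (exists w, htp X (beta i y) (pcat (word_path b0 g w) (eta (Phi i y)))).
  move=> Cy; have bP := betaP i y Cy.
  have [y20|y2|y2] := ltgtP y.2 0.
  - have Cym : cellm y by split.
    have Ay : A (Phi i y) by apply: cellm_outside_disks; exists y.
    have sX := cellX i _ _ Cm Cy; have tm := tX _ (Abm i); have tp := tX _ (Abp i).
    have tB := betaP i _ Cm; have bb := cellX i _ _ Cp Cm.
    have h1 : htp X (pcat (tail (Phi i bm)) (Phi i \o seg bm y)) (eta (Phi i y)).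
      rewrite etaA //; apply: AX (tailP _ Ay).
      apply: pth_cat (tailP _ (Abm i)) _; have := cell_seg i cellm_convex Cbm Cym.
      by move=> [cs c0 c1]; split=> //; apply: cpath_sub cs; exact: cellm_outside_disks.
    have h2 : htp X (beta i y) (pcat (g i) (eta (Phi i y))).
      apply: htp_trans (hcatr (gP i) (pth_cat tm sX) h1).
      apply: htp_trans (htp_sym (hassoc tB (pth_rev tm) (pth_cat tm sX))).
      apply: htp_trans (htp_sym (hcatr tB (pth_cat (pth_rev tm) (pth_cat tm sX)) (hcatV tm sX))).
      apply: htp_trans (htp_sym (hassoc tp bb sX)).
      apply: (hcatr tp (cellX i _ _ Cp Cy)).
      apply: (@htp_sub _ _ (Phi i @` cell)); first exact: cell_outside_circles.
      have [c1 c10 c11] := cell_seg i cell_convex Cp Cy.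
      have [c2 c20 c21] := pth_cat (cell_seg i cell_convex Cp Cm) (cell_seg i cell_convex Cm Cy).
      by apply: cell_htp => //; rewrite ?c10 ?c11 ?c20 ?c21.
    split; last first.
      exists [:: (i, true)] => /=; apply: htp_trans h2 _.
      apply: (hcatl (gP i) (etaP _ (outside_disks_circles Ay))).
      apply: htp_sym; have [_ _ g1] := gP i.
      by have := htp_cat1r (let: And3 h _ _ := gP i in h); rewrite g1.
    exists [:: (i, false)] => /=; have rg := pth_rev (gP i).
    apply: htp_trans (htp_sym (hcatV (gP i) (etaP _ (outside_disks_circles Ay)))) _.
    apply: (hcat rg (pth_cat (gP i) (etaP _ (outside_disks_circles Ay)))); last exact: htp_sym.
    apply: htp_sym; have [_ _ g1] := rg.
    by have := htp_cat1r (let: And3 h _ _ := rg in h); rewrite g1.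
  - have Cyp : cellp y by split.
    have Ay : A (Phi i y) by apply: cellp_outside_disks; exists y.
    have h1 : htp X (beta i y) (eta (Phi i y)).
      rewrite etaA //; apply: AX (tailP _ Ay).
      apply: pth_cat (tailP _ (Abp i)) _; have := cell_seg i cellp_convex Cbp Cyp.
      by move=> [cs c0 c1]; split=> //; apply: cpath_sub cs; exact: cellp_outside_disks.
    split; exists [::] => /=.
      by apply: htp_trans (htp_sym h1) (htp_sym (hcat1l bP)).
    apply: htp_trans h1 (htp_sym (hcat1l (etaP _ _))); exact: outside_disks_circles.
  - by rewrite etaD //; split; exists [::] => /=; apply: htp_sym; exact: hcat1l bP.
exists b0, eta, g; split => // p Xp.
pose Q (a b : R) := exists w, htp X (pcat (eta (p a)) (subp p a b)) (pcat (word_path b0 g w) (eta (p b))).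
suff : Q 0 1 by rewrite /Q subp01.
have sP a b : pth X (p a) (p b) (subp p a b).
  by split; [exact: cpath_subp|rewrite subp0|rewrite subp1].
have eP a := etaP _ (Xp.2 a).
apply: (@interval_induction _ Q) => [a b c ab bc [w hw] [w' hw']|t t01].
  exists (w ++ w').
  apply: htp_trans (hcatr (eP a) (sP a c) (htp_sym (htp_subp a b c Xp))) _.
  apply: htp_trans (htp_sym (hassoc (eP a) (sP a b) (sP b c))) _.
  apply: htp_trans (hcatl (pth_cat (eP a) (sP a b)) (sP b c) hw) _.
  apply: htp_trans (hassoc (wpP w) (eP b) (sP b c)) _.
  apply: htp_trans (hcatr (wpP w) (pth_cat (eP b) (sP b c)) hw') _.
  apply: htp_trans (htp_sym (hassoc (wpP w) (wpP w') (eP c))) _.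
  exact: hcatl (pth_cat (wpP w) (wpP w')) (eP c) (word_path_cat Xo gP w w').
have genA (x y : 'rV[R]_4) q : pth A x y q -> exists w, htp X (pcat (eta x) q) (pcat (word_path b0 g w) (eta y)).
  move=> hq; have [[_ Aq] q0 q1] := hq; have Ax : A x by rewrite -q0.
  have Ay : A y by rewrite -q1.
  exists [::] => /=; apply: htp_trans (htp_sym (hcat1l (etaP _ (outside_disks_circles Ay)))).
  rewrite !etaA //; apply: AX (tailP _ Ay); exact: pth_cat (tailP _ Ax) hq.
have genB i (x y : 'rV[R]_4) q : pth (Phi i @` cell) x y q ->
    exists w, htp X (pcat (eta x) q) (pcat (word_path b0 g w) (eta y)).
  move=> hq; have [cq q0 q1] := hq.
  have [yx Cx ex0] : (Phi i @` cell) x by rewrite -q0; exact: cq.2.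
  have [yy Cy ey0] : (Phi i @` cell) y by rewrite -q1; exact: cq.2.
  have hqX : pth X x y q by apply: pthS hq; exact: cell_outside_circles.
  rewrite -{x}ex0 -{y}ey0 in q0 q1 hq hqX *.
  have eX := etaP _ (@cell_outside_circles i _ (ex_intro2 _ _ yx Cx erefl)).
  have eY := etaP _ (@cell_outside_circles i _ (ex_intro2 _ _ yy Cy erefl)).
  have [[w1 h1] _] := star i _ Cx; have [_ [w2 h2]] := star i _ Cy.
  have bX := betaP i _ Cx; have tp := tX _ (Abp i).
  exists (w1 ++ w2).
  apply: htp_trans (hcatl eX hqX h1) _.
  apply: htp_trans (hassoc (wpP w1) bX hqX) _.
  have h3 : htp X (pcat (beta i yx) q) (beta i yy).
    apply: htp_trans (hassoc tp (cellX i _ _ Cp Cx) hqX) _.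
    apply: (hcatr tp (pth_cat (cellX i _ _ Cp Cx) hqX)).
    apply: (@htp_sub _ _ (Phi i @` cell)); first exact: cell_outside_circles.
    have [c1 c10 c11] := cell_seg i cell_convex Cp Cy.
    have [c2 c20 c21] := pth_cat (cell_seg i cell_convex Cp Cx) hq.
    by apply: cell_htp => //; rewrite ?c10 ?c11 ?c20 ?c21.
  apply: htp_trans (hcatr (wpP w1) (pth_cat bX hqX) (htp_trans h3 h2)) _.
  apply: htp_trans (htp_sym (hassoc (wpP w1) (wpP w2) eY)) _.
  exact: hcatl (pth_cat (wpP w1) (wpP w2)) eY (word_path_cat Xo gP w1 w2).
(* The clamp is there because [cpath] asks a path to stay in [Y] for all real parameters, while the
   subpath does so on [0, 1] only. *)
have loc (Y : set 'rV[R]_4) : (\forall z \near p t, sphere3 z -> Y z) ->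
    exists2 d : R, 0 < d & forall a b : R, a <= b -> `|a - t| < d -> `|b - t| < d ->
      pth Y (p a) (p b) (subp p a b \o clamp).
  move=> /(Xp.1 t)/nbhs_ballP[d d0 hd]; exists d => // a b ab ad bd.
  split; last 2 first.
  - by rewrite /= clamp_le0 // subp0.
  - by rewrite /= clamp_ge1 // subp1.
  split=> [u|u].
    by have cs := (cpath_subp a b Xp).1; have cc := @clamp_continuous R; rewrite /comp; cont.
  have /andP[u0 u1] := clamp01 u; rewrite /= /subp; have /hd : ball t d (a + clamp u * (b - a)).
    rewrite -ball_normE /= ltr_norml; move: ad bd; rewrite !ltr_norml => /andP[? ?] /andP[? ?].
    have : 0 <= clamp u * (b - a) by rewrite mulr_ge0 // subr_ge0.
    have : clamp u * (b - a) <= 1 * (b - a) by apply: ler_wpM2r => //; rewrite subr_ge0.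
    by move=> ? ?; apply/andP; split; lra.
  by move=> /= h; apply: h; case: (Xp.2 (a + clamp u * (b - a))).
have fin a b w : htp X (pcat (eta (p a)) (subp p a b \o clamp)) (pcat (word_path b0 g w) (eta (p b))) ->
    htp X (pcat (eta (p a)) (subp p a b)) (pcat (word_path b0 g w) (eta (p b))).
  apply: htp_trans; apply: (hcatr (eP a) (sP a b)).
  by apply: htp_eq; [exact: cpath_subp|move=> u u01; rewrite /= clamp_id].
have [At|[i [y [Cy _ ty]]]] := outside_circles_cases (Xp.2 t).
  have [d d0 hd] := loc A (outside_disks_near At); exists d => // a b ab _ _ ad bd.
  by have [w hw] := genA _ _ _ (hd a b ab ad bd); exists w; exact: fin.
have [d d0 hd] := loc _ (cell_near Cy ty); exists d => // a b ab _ _ ad bd.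
by have [w hw] := genB i _ _ _ (hd a b ab ad bd); exists w; exact: fin.
Qed.

End TubeSystem.

(** * Tubular neighbourhoods of disks *)

Section StrictDifferentiability.
Context {R : realType}.
Implicit Types (f : 'rV[R]_2 -> 'rV[R]_4) (x y : 'rV[R]_2) (J : 'M[R]_(2, 4)).

(** Strict differentiability compares two variable points near [x0]; this is the form in which the
    inverse function argument uses a derivative. *)
Definition strict_diff f x0 J := forall e : R, 0 < e -> exists2 d : R, 0 < d &
  forall x y, `|x0 - x| < d -> `|x0 - y| < d -> `|f x - f y - (x - y) *m J| <= e * `|x - y|.

Lemma ord2_cases (i : 'I_2) : i = ord0 \/ i = ord_max.
Proof. by case: i => [[|[|m]]] // h; [left|right]; exact/val_inj. Qed.

Lemma norm_mulmx m n (v : 'rV[R]_m) (A : 'M[R]_(m, n)) : `|v *m A| <= m%:R * `|A| * `|v|.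
Proof.
apply: norm_le_coord => [|j]; first by rewrite !mulr_ge0.
rewrite mxE; apply: le_trans (ler_norm_sum _ _ _) _.
rewrite -mulrA mulr_natl -[X in _ *+ X](card_ord m) -sumr_const.
apply: ler_sum => i _; rewrite normrM mulrC ler_pM ?coord_le_norm //.
by rewrite [leRHS]mx_normrE; apply: (le_bigmax _ _ (i, j)).
Qed.

Lemma row_free_bound m n (A : 'M[R]_(m, n)) : row_free A ->
  exists2 c : R, 0 < c & forall v : 'rV[R]_m, c * `|v| <= `|v *m A|.
Proof.
move=> fA; pose C : R := n%:R * `|pinvmx A| + 1.
have C0 : 0 < C by rewrite ltr_wpDl ?mulr_ge0.
exists C^-1; first by rewrite invr_gt0.
move=> v; rewrite -ler_pdivlMl ?invr_gt0 // invrK.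
have e : v = v *m A *m pinvmx A by rewrite -mulmxA mulmxVp // mulmx1.
rewrite {1}e; apply: le_trans (norm_mulmx _ _) _.
by apply: ler_wpM2r => //; rewrite /C lerDl.
Qed.

Lemma near_dist (E W : normedModType R) (g : E -> W) (x : E) (e : R) : continuous_at x g -> 0 < e ->
  \forall y \near x, `|g x - g y| < e.
Proof.
move=> cg e0; have := cg _ (nbhsx_ballx _ _ e0); apply: (@filterS _ (nbhs x)) => y /=.
by rewrite -ball_normE.
Qed.

Lemma smooth_derive (D : set 'rV[R]_2) f v : smooth_on D f -> smooth_on D ('D_v f).
Proof. by move=> sf k; have [_ /(_ v)] := sf k.+1. Qed.

Lemma smooth_differentiable (D : set 'rV[R]_2) f x : smooth_on D f -> D x -> differentiable f x.
Proof. by move=> sf Dx; have [/(_ x Dx)] := sf 1%N. Qed.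

Lemma is_derive_line f x (v : 'rV[R]_2) (s : R) j : differentiable f (x + s *: v) ->
  is_derive s 1 (fun s : R => f (x + s *: v) 0 j) ('D_v f (x + s *: v) 0 j).
Proof.
move=> df; have dv := @diff_derivable _ _ _ f _ v df.
have dg : is_derive s (1 : R) (fun s : R => f (x + s *: v)) ('D_v f (x + s *: v)).
  have E : (fun h : R => h^-1 *: (((fun s : R => f (x + s *: v)) \o shift s) (h *: (1 : R)) - f (x + s *: v))) =
      (fun h : R => h^-1 *: ((f \o shift (x + s *: v)) (h *: v) - f (x + s *: v))).
    apply/funext => h /=; congr (_ *: (f _ - _)).
    by rewrite [h *: 1]mulr1 scalerDl addrCA.
  by split; rewrite /derivable /derive E.
have [h1 h2] := dg; split; first by have /derivable_mxP := h1; apply.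
by rewrite -h2 derive_mx // mxE.
Qed.

Lemma derive_coord f x v : differentiable f x ->
  'D_v f x = \sum_i v 0 i *: 'D_(delta_mx 0 i) f x.
Proof.
move=> df; rewrite deriveEjacobian // {1}[v]row_sum_delta mulmx_suml.
by apply: eq_bigr => i _; rewrite -scalemxAl deriveEjacobian.
Qed.

Lemma coord_bound (a b c d : 'rV[R]_4) (A B : 'I_2 -> 'rV[R]_4) (v : 'rV[R]_2) e j :
  (forall i, `|B i - A i| < e / 2) ->
  a 0 j - b 0 j = c 0 j -> c = \sum_i v 0 i *: A i -> d = \sum_i v 0 i *: B i ->
  `|(a - b - d) 0 j| <= e * `|v|.
Proof.
move=> AB ab ec ->.
have -> : (a - b - \sum_i v 0 i *: B i) 0 j = \sum_i v 0 i * (A i - B i) 0 j.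
  have -> : (a - b - \sum_i v 0 i *: B i) 0 j = a 0 j - b 0 j - (\sum_i v 0 i *: B i) 0 j.
    by rewrite !mxE.
  rewrite ab ec !summxE -sumrB; apply: eq_bigr => i _; by rewrite !mxE mulrBr.
apply: le_trans (ler_norm_sum _ _ _) _; rewrite !big_ord_recl big_ord0 addr0 /=.
have bd i : `|v 0 i * (A i - B i) 0 j| <= `|v| * (e / 2).
  rewrite normrM; apply: ler_pM => //; first exact: coord_le_norm.
  apply: le_trans (coord_le_norm _ _) _; rewrite distrC; exact/ltW/AB.
by have := lerD (bd ord0) (bd (lift ord0 ord0)); move: (`|v|) => t; lra.
Qed.

(** The mean value theorem on the segment from [y] to [x], one coordinate of the target at a time;
    each of the two partial derivatives may vary by e / 2. *)
Lemma smooth_strict_diff (D : set 'rV[R]_2) f x0 : open D -> smooth_on D f -> D x0 ->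
  strict_diff f x0 ('J f x0).
Proof.
move=> oD sf Dx0 e e0.
have cD i : continuous_at x0 ('D_(delta_mx 0 i) f).
  apply: differentiable_continuous; apply: smooth_differentiable Dx0; exact: smooth_derive.
have : nbhs x0 (D `&` [set x | forall i, `|'D_(delta_mx 0 i) f x0 - 'D_(delta_mx 0 i) f x| < e / 2]).
  apply: filterI; first exact: open_nbhs_nbhs.
  have key i : nbhs x0 [set x | `|'D_(delta_mx 0 i) f x0 - 'D_(delta_mx 0 i) f x| < e / 2].
  have e2 : 0 < e / 2 by rewrite divr_gt0.
    exact: near_dist (cD i) e2.
  apply: filterS (filterI (key ord0) (key ord_max)) => x [h0 h1] i.
  by have [e'|e'] := ord2_cases i; rewrite e'; [exact: h0|exact: h1].
move=> /nbhs_normP[d /= d0 hd]; exists d => // x y xd yd.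
have in_ball (s : R) : 0 <= s <= 1 -> `|x0 - (y + s *: (x - y))| < d.
  move=> /andP[s0 s1].
  have -> : x0 - (y + s *: (x - y)) = (1 - s) *: (x0 - y) + s *: (x0 - x).
    by apply/rowP => k; rewrite !mxE; ring.
  apply: le_lt_trans (ler_normD _ _) _; rewrite !normrZ (ger0_norm s0) ger0_norm; last lra.
  have [->|s0'] := eqVneq s 0; first by rewrite mul0r subr0 mul1r addr0.
  have : s * `|x0 - x| < s * d by rewrite ltr_pM2l // lt0r s0'.
  have : (1 - s) * `|x0 - y| <= (1 - s) * d by apply: ler_wpM2l; [lra|exact: ltW].
  lra.
have Df (s : R) : 0 <= s <= 1 -> differentiable f (y + s *: (x - y)).
  by move=> /in_ball/hd[Ds _]; exact: smooth_differentiable Ds.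
apply: norm_le_coord => [|j]; first by rewrite mulr_ge0 // ltW.
have [||s s01] := @MVT R (fun s => f (y + s *: (x - y)) 0 j)
    (fun s => 'D_(x - y) f (y + s *: (x - y)) 0 j) 0 1 ltr01.
- move=> s; rewrite in_itv /= => /andP[s0 s1]; apply: is_derive_line; apply: Df.
  by rewrite !ltW.
- apply: derivable_within_continuous => s; rewrite in_itv /= => s01.
  by have [] := is_derive_line j (Df s s01).
rewrite scale1r scale0r addr0 subr0 mulr1 (addrC y) subrK => fs.
have s01' : 0 <= s <= 1 by move: s01; rewrite in_itv /= => /andP[? ?]; rewrite !ltW.
have [_ hs] := hd _ (in_ball s s01').
rewrite -deriveEjacobian; last exact: smooth_differentiable Dx0.
exact: coord_bound hs fs (derive_coord _ (Df s s01')) (derive_coord _ (smooth_differentiable sf Dx0)).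
Qed.

End StrictDifferentiability.

(** * Local injectivity and openness of strictly differentiable maps *)

Section InverseFunction.
Context {R : realType} {E W : normedModType R} {f L : E -> W} {Li : W -> E} {a : E} {c d : R}.
Hypothesis (c0 : 0 < c).
Hypothesis closed_ball_compact : forall (x : E) (r : R), compact [set y | `|x - y| <= r].
Hypothesis LZ : forall (s : R) h, L (s *: h) = s *: L h.
Hypothesis Lc : forall h, c * `|h| <= `|L h|.
Hypothesis LiK : forall w, L (Li w) = w.
Hypothesis fL : forall x y, `|a - x| < d -> `|a - y| < d -> `|f x - f y - L (x - y)| <= c / 2 * `|x - y|.
Hypothesis fC : forall x, `|a - x| < d -> continuous_at x f.

Lemma local_injective x y : `|a - x| < d -> `|a - y| < d -> f x = f y -> x = y.
Proof.
move=> xd yd e; have := fL xd yd; rewrite e subrr sub0r normrN => h1.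
have h2 := Lc (x - y); apply/eqP; rewrite -subr_eq0 -normr_le0.
have : c / 2 * `|x - y| <= 0 by lra.
by rewrite pmulr_rle0 // divr_gt0.
Qed.

(* A point y of a small ball minimizing |f y - w| satisfies f y = w: otherwise moving y along
   Li (w - f y) would decrease the distance. *)
Lemma local_open x (U : set E) : `|a - x| < d -> nbhs x U ->
  \forall w \near f x, exists2 y, U y & f y = w.
Proof.
move=> xd NU.
have /nbhs_normP[r /= r0 hr] : nbhs x (U `&` [set y | `|a - y| < d]).
  apply: filterI => //; apply/nbhs_normP; exists (d - `|a - x|); first by rewrite /= subr_gt0.
  move=> y /= xy; have -> : a - y = (a - x) + (x - y) by rewrite addrA subrK.
  by apply: le_lt_trans (ler_normD _ _) _; lra.
pose q := r / 2; have q0 : 0 < q by rewrite divr_gt0.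
have inr y : `|x - y| <= q -> U y /\ `|a - y| < d by move=> xy; apply: hr; rewrite /= /q in xy *; lra.
have cq : 0 < c * q / 4 by rewrite divr_gt0 // mulr_gt0.
apply/nbhs_normP; exists (c * q / 4) => // w /= fw.
have [y xy ymin] : exists2 y, `|x - y| <= q & forall z, `|x - z| <= q -> `|f y - w| <= `|f z - w|.
  have A0 : [set y | `|x - y| <= q] !=set0 by exists x; rewrite /= subrr normr0 ltW.
  have [|y] := compact_EVT_min A0 (closed_ball_compact (x := x) (r := q)) (f := fun y => `|f y - w|).
    apply: continuous_in_subspaceT => y; rewrite inE /= => /inr[_ yd].
    have cy := fC yd; apply: (@forc_comp _ _ _ (fun y => f y - w) (@Num.norm R W)); first by cont.
    exact: norm_continuous.
  by rewrite inE => xy h; exists y => // z xz; apply: h; rewrite inE.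
have [Uy yd] := inr y xy; exists y => //; apply/eqP; rewrite -subr_eq0 -normr_le0 leNgt; apply/negP => yw.
have fyx : `|f y - w| < c * q / 4.
  by apply: le_lt_trans fw; apply: ymin; rewrite subrr normr0 ltW.
(* The minimizer is interior: [f x] and [f y] are both within c * q / 4 of [w], whereas [f] shrinks
   distances at most by the factor c / 2. *)
have xyq : `|x - y| < q.
  have h1 := fL xd yd; have h2 := Lc (x - y).
  have h3 : `|f x - f y| <= `|f x - w| + `|f y - w|.
    by rewrite [`|f y - w|]distrC; have := ler_normD (f x - w) (w - f y); rewrite addrA subrK.
  have h4 : `|L (x - y)| <= `|f x - f y| + `|f x - f y - L (x - y)|.
    have := ler_normB (f x - f y) (f x - f y - L (x - y)).
    by rewrite opprB addrC subrK.
  have : c / 2 * `|x - y| < c / 2 * q by lra.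
  by rewrite ltr_pM2l // divr_gt0.
pose h := Li (w - f y); have Lh : L h = w - f y by exact: LiK.
have hc : c * `|h| <= `|f y - w| by rewrite distrC -Lh; exact: Lc.
have h0 : 0 <= `|h| by [].
(* The step keeps [y + s *: h] inside the closed ball on which [y] is a minimizer. *)
pose s := Num.min 1 ((q - `|x - y|) / (`|h| + 1)).
have s0 : 0 < s by rewrite lt_min ltr01 divr_gt0 // ?subr_gt0 // ltr_wpDl.
have s1 : s <= 1 by rewrite ge_min lexx.
have xz : `|x - (y + s *: h)| <= q.
  rewrite opprD addrA; apply: le_trans (ler_normB _ _) _; rewrite normrZ gtr0_norm //.
  have : s * (`|h| + 1) <= q - `|x - y|.
    by rewrite -ler_pdivlMr ?ltr_wpDl // ge_min lexx orbT.
  by rewrite mulrDr mulr1; lra.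
have [_ zd] := inr _ xz; have := ymin _ xz; apply/negP; rewrite -ltNge.
have := fL zd yd; have -> : y + s *: h - y = s *: h by rewrite addrC addKr.
rewrite LZ Lh normrZ gtr0_norm // => h5.
have -> : f (y + s *: h) - w = (f (y + s *: h) - f y - s *: (w - f y)) + (1 - s) *: (f y - w).
  rewrite -[w - f y]opprB scalerN opprK scalerBl scale1r -addrA [s *: _ + _]addrC subrK.
  by rewrite addrA subrK.
apply: le_lt_trans (ler_normD _ _) _; rewrite normrZ [X in X * `|f y - w|]ger0_norm ?subr_ge0 //.
have : s * (c * `|h|) <= s * `|f y - w| by rewrite ler_wpM2l // ltW.
have : 0 < s * `|f y - w| by rewrite mulr_gt0.
move: h5; move: (`|f y - w|) (`|h|) => A B; lra.
Qed.

End InverseFunction.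

(** * The triple vector product of R^4 *)

Section Normal.
Context {R : realType}.
Implicit Types a b v : 'rV[R]_4.

Definition frame a (J : 'M[R]_(2, 4)) v : 'M[R]_4 :=
  \matrix_(i < 4) nth 0 [:: a; row ord0 J; row ord_max J; v] i.

(** The generalized cross product of [a] and the two rows of [J]. The cofactors of the last row do
    not depend on that row, so 0 is a placeholder. *)
Definition conormal a (J : 'M[R]_(2, 4)) : 'rV[R]_4 := \row_j cofactor (frame a J 0) ord_max j.

Lemma row_frame a J v i : row i (frame a J v) = nth 0 [:: a; row ord0 J; row ord_max J; v] i.
Proof. by rewrite rowK. Qed.

Lemma det_frame a J v : \det (frame a J v) = dot v (conormal a J).
Proof.
rewrite (expand_det_row _ ord_max); apply: eq_bigr => j _; rewrite !mxE; congr (_ * _).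
by rewrite !expand_cofactor; apply: eq_bigr => s _; congr (_ * _); apply: eq_bigr => k;
  case: k => [[|[|[|[|k]]]] hk] // ; rewrite !mxE.
Qed.

Lemma dot_normal a J : dot a (conormal a J) = 0.
Proof.
rewrite -det_frame; apply: (@determinant_alternate _ _ _ ord0 ord_max) => // j.
by rewrite !mxE.
Qed.

Lemma dot_row_normal a J i : dot (row i J) (conormal a J) = 0.
Proof.
rewrite -det_frame; have [->|->] := ord2_cases i.
  by apply: (@determinant_alternate _ _ _ (@Ordinal 4 1 isT) ord_max) => // j; rewrite !mxE.
by apply: (@determinant_alternate _ _ _ (@Ordinal 4 2 isT) ord_max) => // j; rewrite !mxE.
Qed.

Lemma mulmx_frame a J v (w : 'rV[R]_4) : w *m frame a J v =
  w 0 0 *: a + (\row_(j < 2) w 0 (inord j.+1)) *m J + w 0 ord_max *: v.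
Proof.
rewrite mulmx_sum_row !big_ord_recl big_ord0 addr0 !row_frame /=.
rewrite mulmx_sum_row !big_ord_recl big_ord0 addr0 !mxE -!addrA.
congr (_ + _); congr (_ *: _ + (_ *: _ + _ *: _)).
- by congr (w 0 _); apply/val_inj; rewrite /= inordK.
- by congr (w 0 _); apply/val_inj; rewrite /= inordK.
- by congr (row _ J); apply/val_inj.
- by congr (w 0 _); apply/val_inj.
Qed.

Lemma dot_mulmx (x : 'rV[R]_2) (J : 'M[R]_(2, 4)) v :
  (forall i, dot (row i J) v = 0) -> dot (x *m J) v = 0.
Proof.
move=> h; rewrite mulmx_sum_row !big_ord_recl big_ord0 addr0 dotDl !dotZl !h.
by rewrite !mulr0 addr0.
Qed.

Lemma dot_mulmxl a (x : 'rV[R]_2) (J : 'M[R]_(2, 4)) :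
  (forall i, dot (row i J) a = 0) -> dot a (x *m J) = 0.
Proof. by move=> h; rewrite dotC dot_mulmx. Qed.

Lemma frame_unit a J v : a != 0 -> row_free J -> (forall i, dot (row i J) a = 0) ->
  v != 0 -> dot a v = 0 -> (forall i, dot (row i J) v = 0) -> row_free (frame a J v).
Proof.
move=> a0 fJ Ja v0 av Jv; rewrite row_free_unit unitmxE unitfE; apply/det0P => -[w w0].
rewrite mulmx_frame => e.
have w3 : w 0 ord_max = 0.
  have := congr1 (dot v) e; rewrite !dotDr !dotZr (dotC v a) av (dot_mulmxl _ Jv) (dotC v 0) dot0l.
  rewrite mulr0 !add0r -sqnormE => /eqP.
  by rewrite mulf_eq0 sqnorm_eq0 (negPf v0) orbF => /eqP.
have w1 : w 0 0 = 0.
  have := congr1 (dot a) e; rewrite !dotDr !dotZr av (dot_mulmxl _ Ja) (dotC a 0) dot0l.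
  rewrite mulr0 !addr0 -sqnormE => /eqP.
  by rewrite mulf_eq0 sqnorm_eq0 (negPf a0) orbF => /eqP.
move: e; rewrite w1 w3 !scale0r addr0 add0r => /eqP; rewrite mulmx_free_eq0 // => /eqP/rowP w2.
move/eqP: w0; apply; apply/rowP => -[[|[|[|[|k]]]] hk] //; rewrite !mxE.
- by rewrite -w1; congr (w 0 _); exact/val_inj.
- by have := w2 ord0; rewrite !mxE => <-; congr (w 0 _); apply/val_inj; rewrite /= inordK.
- by have := w2 ord_max; rewrite !mxE => <-; congr (w 0 _); apply/val_inj; rewrite /= inordK.
- by rewrite -w3; congr (w 0 _); exact/val_inj.
Qed.

(** Some nonzero vector is orthogonal to [a] and to the rows of [J]. It completes them to a basis,
    and the nonzero determinant is its product with the conormal. *)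
Lemma normal_neq0 a J : a != 0 -> row_free J -> (forall i, dot (row i J) a = 0) -> conormal a J != 0.
Proof.
move=> a0 fJ Ja.
have [f f0 [fa f1 f2]] := annihilator a (row ord0 J) (row ord_max J).
have dotf (x : 'rV[R]_4) : dot x f^T = (x *m f) 0 0.
  by rewrite mxE; apply: eq_bigr => k _; rewrite mxE.
have fT0 : f^T != 0 by rewrite -trmx0 (inj_eq trmx_inj).
have : row_free (frame a J f^T).
  apply: frame_unit => //; first by rewrite dotf fa mxE.
  by move=> i; rewrite dotf; have [->|->] := ord2_cases i; rewrite ?f1 ?f2 mxE.
rewrite row_free_unit unitmxE unitfE det_frame; apply: contraNneq => ->.
by rewrite dotC dot0l.
Qed.

End Normal.

Section LocallyLipschitz.
Context {R : realType}.
Implicit Types (x y : 'rV[R]_2).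

(** The normal field enters the tube multiplied by the small coordinate t, so a Lipschitz bound on
    it is enough for strict differentiability and its derivative never appears. *)
Definition lip {W : normedModType R} (g : 'rV[R]_2 -> W) x0 := exists C d : R,
  [/\ 0 <= C, 0 < d & forall x y, `|x0 - x| < d -> `|x0 - y| < d -> `|g x - g y| <= C * `|x - y|].

Lemma lip_cst (W : normedModType R) (a : W) x0 : lip (fun=> a) x0.
Proof. by exists 0, 1; split => // x y _ _; rewrite subrr normr0 mul0r. Qed.

Lemma lipD (f g : 'rV[R]_2 -> R) x0 : lip f x0 -> lip g x0 -> lip (fun x => f x + g x) x0.
Proof.
move=> [C [d [C0 d0 hf]]] [C' [d' [C0' d0' hg]]]; exists (C + C'), (Num.min d d'); split.
- exact: addr_ge0.
- by rewrite lt_min d0.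
move=> x y; rewrite !lt_min => /andP[xd xd'] /andP[yd yd'].
rewrite opprD addrACA mulrDl; apply: le_trans (ler_normD _ _) _.
by apply: lerD; [exact: hf|exact: hg].
Qed.

Lemma lipM (f g : 'rV[R]_2 -> R) x0 : lip f x0 -> lip g x0 -> lip (fun x => f x * g x) x0.
Proof.
move=> [C [d [C0 d0 hf]]] [C' [d' [C0' d0' hg]]].
pose A := `|f x0| + C * d; pose B := `|g x0| + C' * d'.
have A0 : 0 <= A by rewrite addr_ge0 // mulr_ge0 // ltW.
have B0 : 0 <= B by rewrite addr_ge0 // mulr_ge0 // ltW.
exists (A * C' + C * B), (Num.min d d'); split.
- by rewrite addr_ge0 // mulr_ge0.
- by rewrite lt_min d0.
move=> x y; rewrite !lt_min => /andP[xd xd'] /andP[yd yd'].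
have fx : `|f x| <= A.
  have := hf x x0 xd; rewrite subrr normr0 => /(_ d0) h.
  have : C * `|x - x0| <= C * d by rewrite ler_wpM2l // distrC ltW.
  have := ler_normD (f x - f x0) (f x0); rewrite subrK /A; lra.
have gy : `|g y| <= B.
  have := hg y x0 yd'; rewrite subrr normr0 => /(_ d0') h.
  have : C' * `|y - x0| <= C' * d' by rewrite ler_wpM2l // distrC ltW.
  have := ler_normD (g y - g x0) (g x0); rewrite subrK /B; lra.
have -> : f x * g x - f y * g y = f x * (g x - g y) + (f x - f y) * g y by ring.
apply: le_trans (ler_normD _ _) _; rewrite !normrM mulrDl; apply: lerD.
  by rewrite -mulrA; apply: ler_pM => //; exact: hg.
by rewrite mulrAC; apply: ler_pM => //; exact: hf.
Qed.

Lemma lip_sum (I : Type) (r : seq I) (P : pred I) (f : I -> 'rV[R]_2 -> R) x0 :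
  (forall i, lip (f i) x0) -> lip (fun x => \sum_(i <- r | P i) f i x) x0.
Proof.
move=> hf; elim: r => [|i r IHr].
  by under [X in lip X _]eq_fun do rewrite big_nil; exact: lip_cst.
under [X in lip X _]eq_fun do rewrite big_cons; case: (P i) => //.
exact: lipD.
Qed.

Lemma lip_prod (I : Type) (r : seq I) (P : pred I) (f : I -> 'rV[R]_2 -> R) x0 :
  (forall i, lip (f i) x0) -> lip (fun x => \prod_(i <- r | P i) f i x) x0.
Proof.
move=> hf; elim: r => [|i r IHr].
  by under [X in lip X _]eq_fun do rewrite big_nil; exact: lip_cst.
under [X in lip X _]eq_fun do rewrite big_cons; case: (P i) => //.
exact: lipM.
Qed.

Lemma lip_coord (g : 'rV[R]_2 -> 'rV[R]_4) x0 j : lip g x0 -> lip (fun x => g x 0 j) x0.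
Proof.
move=> [C [d [C0 d0 h]]]; exists C, d; split => // x y xd yd.
have := coord_le_norm (g x - g y) j; rewrite !mxE => /le_trans; apply; exact: h.
Qed.

Lemma lip_row (g : 'rV[R]_2 -> 'rV[R]_4) x0 : (forall j, lip (fun x => g x 0 j) x0) -> lip g x0.
Proof.
move=> h; pose C j := projT1 (cid (h j)).
have hC j : exists d : R, [/\ 0 <= C j, 0 < d & forall x y, `|x0 - x| < d -> `|x0 - y| < d ->
    `|g x 0 j - g y 0 j| <= C j * `|x - y|] by rewrite /C; case: cid.
pose d j := projT1 (cid (hC j)).
have hd j : [/\ 0 <= C j, 0 < d j & forall x y, `|x0 - x| < d j -> `|x0 - y| < d j ->
    `|g x 0 j - g y 0 j| <= C j * `|x - y|] by rewrite /d; case: cid.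
exists (\sum_j C j), (\big[Num.min/1]_j d j); split.
- by apply: sumr_ge0 => j _; case: (hd j).
- apply: (big_ind (fun x : R => 0 < x)); [exact: ltr01| |by move=> j _; case: (hd j)].
  by move=> a b a0 b0; rewrite lt_min a0.
move=> x y xd yd; have S0 : 0 <= \sum_j C j by apply: sumr_ge0 => j _; case: (hd j).
apply: norm_le_coord => [|j]; first by rewrite mulr_ge0.
have [C0 d0 hj] := hd j; have dj : \big[Num.min/1]_j d j <= d j by exact: bigmin_le_cond.
rewrite !mxE; apply: le_trans (hj _ _ (lt_le_trans xd dj) (lt_le_trans yd dj)) _.
rewrite ler_wpM2r // (bigD1 j) //= lerDl.
by apply: sumr_ge0 => k _; case: (hd k).
Qed.

Lemma strict_diff_lip (f : 'rV[R]_2 -> 'rV[R]_4) x0 J : strict_diff f x0 J -> lip f x0.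
Proof.
move=> sf; have [d d0 hd] := sf 1 ltr01; exists (1 + 2 * `|J|), d; split => //.
move=> x y xd yd; have h := hd x y xd yd.
have := ler_normD (f x - f y - (x - y) *m J) ((x - y) *m J); rewrite subrK.
have := norm_mulmx (x - y) J; lra.
Qed.

(** Agrees with the Jacobian where [f] is differentiable; its rows are directional derivatives, to
    which [smooth_derive] applies. *)
Definition partials (f : 'rV[R]_2 -> 'rV[R]_4) x : 'M[R]_(2, 4) :=
  \matrix_(i < 2) 'D_(delta_mx 0 i) f x.

Lemma partialsE f x : differentiable f x -> partials f x = 'J f x.
Proof.
by move=> df; apply/row_matrixP => i; rewrite rowK deriveEjacobian // -rowE.
Qed.

Lemma lip_normal (D : set 'rV[R]_2) (f : 'rV[R]_2 -> 'rV[R]_4) x0 :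
  open D -> smooth_on D f -> D x0 -> lip (fun x => conormal (f x) (partials f x)) x0.
Proof.
move=> oD sf Dx0; have sd (g : 'rV[R]_2 -> 'rV[R]_4) : smooth_on D g -> lip g x0.
  by move=> sg; apply: strict_diff_lip; exact: (smooth_strict_diff oD sg Dx0).
have lipF (i j : 'I_4) : lip (fun x => frame (f x) (partials f x) 0 i j) x0.
  case: i => [[|[|[|[|k]]]] hk] //.
  - under [X in lip X _]eq_fun do rewrite mxE /=; exact/lip_coord/sd.
  - under [X in lip X _]eq_fun do rewrite mxE /= rowK; exact/lip_coord/sd/smooth_derive.
  - under [X in lip X _]eq_fun do rewrite mxE /= rowK; exact/lip_coord/sd/smooth_derive.
  - under [X in lip X _]eq_fun do rewrite mxE /= mxE; exact: lip_cst.
apply: lip_row => j; under [X in lip X _]eq_fun do rewrite mxE expand_cofactor.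
by apply: lip_sum => s; apply: lipM; [exact: lip_cst|apply: lip_prod => i].
Qed.

End LocallyLipschitz.

Section NormalTube.
Context {R : realType}.
Local Notation E := ('rV[R]_2 * R * R)%type.

(** The last coordinate is a radial factor. It turns the three-dimensional tube in the sphere into a
    map between four-dimensional spaces, whose derivative at l = 1, t = 0 is given by the frame. *)
Definition psi (f nu : 'rV[R]_2 -> 'rV[R]_4) (z : E) : 'rV[R]_4 :=
  z.2 *: (f z.1.1 + z.1.2 *: nu z.1.1).

Definition dpsi (J : 'M[R]_(2, 4)) (v a : 'rV[R]_4) (z : E) : 'rV[R]_4 :=
  z.1.1 *m J + z.1.2 *: v + z.2 *: a.

Definition pack (z : E) : 'rV[R]_4 := \row_j nth 0 [:: z.2; z.1.1 0 ord0; z.1.1 0 ord_max; z.1.2] j.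
Definition unpack (w : 'rV[R]_4) : E := (\row_(j < 2) w 0 (inord j.+1), w 0 ord_max, w 0 0).

Lemma dpsi_unpack J v a w : dpsi J v a (unpack w) = w *m frame a J v.
Proof. by rewrite mulmx_frame /dpsi /= addrC addrA. Qed.

Lemma packK z : unpack (pack z) = z.
Proof.
case: z => [[x t] l]; rewrite /unpack /pack /= !mxE /=; congr (_, _, _).
by apply/rowP => j; rewrite !mxE; have [->|->] := ord2_cases j; rewrite inordK.
Qed.

Lemma norm_unpack w : `|unpack w| <= `|w|.
Proof.
rewrite /unpack /Num.norm /= !ge_max coord_le_norm coord_le_norm !andbT.
by apply: norm_le_coord => [|j]; [exact: (normr_ge0 w)|rewrite mxE coord_le_norm].
Qed.

Lemma norm3 (z : E) : [/\ `|z.1.1| <= `|z|, `|z.1.2| <= `|z| & `|z.2| <= `|z|].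
Proof. by rewrite /(`|z|) /= !le_max !lexx !orbT. Qed.

Lemma psi_strict (f nu : 'rV[R]_2 -> 'rV[R]_4) x0 J e : strict_diff f x0 J -> lip nu x0 -> 0 < e ->
  exists2 d : R, 0 < d & forall z z' : E, `|(x0, 0, 1) - z| < d -> `|(x0, 0, 1) - z'| < d ->
    `|psi f nu z - psi f nu z' - dpsi J (nu x0) (f x0) (z - z')| <= e * `|z - z'|.
Proof.
move=> sf [C [d1 [C0 d10 hn]]] e0.
have e20 : 0 < e / 2 by rewrite divr_gt0.
have [d2 d20 hf] := sf _ e20; have [B [d3 [B0 d30 hB]]] := strict_diff_lip sf.
(* [K] sums the constants of the five error terms that carry a factor [d]; they cost e / 2, and the
   remainder of [f] costs the other half. *)
pose N := `|nu x0| + C; pose K := B + B + 2 * C + (N + C) + N + 1.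
have N0 : 0 <= N by rewrite addr_ge0.
have K0 : 0 < K by rewrite /K; lra.
pose d := Num.min (Num.min d1 (Num.min d2 d3)) (Num.min 1 (e / (2 * K))).
have eK : 0 < e / (2 * K) by rewrite divr_gt0 // mulr_gt0.
have d0 : 0 < d by rewrite !lt_min d10 d20 d30 ltr01 eK.
exists d => // -[[x t] l] [[x' t'] l'].
set m := `|(x, t, l) - (x', t', l')|.
have [] := norm3 ((x, t, l) - (x', t', l')); rewrite /= -/m => mx mt ml.
move=> zd z'd; have [/= xz tz lz] := norm3 ((x0, 0, 1) - (x, t, l)).
have [/= xz' tz' lz'] := norm3 ((x0, 0, 1) - (x', t', l')).
have {}xz := le_lt_trans xz zd; have {}xz' := le_lt_trans xz' z'd.
have {}tz := le_lt_trans tz zd; have {}tz' := le_lt_trans tz' z'd.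
have {}lz := le_lt_trans lz zd; have {}lz' := le_lt_trans lz' z'd.
have td : `|t| < d by move: tz; rewrite sub0r normrN.
have td' : `|t'| < d by move: tz'; rewrite sub0r normrN.
have ld : `|l - 1| < d by rewrite distrC.
have [dd1 dd2 dd3 [dd4 dd5]] : [/\ d <= d1, d <= d2, d <= d3 & d <= 1 /\ d <= e / (2 * K)].
  by rewrite /d !ge_min !lexx !orbT.
have T1 := hf x x' (lt_le_trans xz dd2) (lt_le_trans xz' dd2).
have T2 := hB x x' (lt_le_trans xz dd3) (lt_le_trans xz' dd3).
have := hB x' x0 (lt_le_trans xz' dd3); rewrite subrr normr0 => /(_ d30) T3.
have T4 := hn x x' (lt_le_trans xz dd1) (lt_le_trans xz' dd1).
have := hn x' x0 (lt_le_trans xz' dd1); rewrite subrr normr0 => /(_ d10) T5.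
have xd' : `|x' - x0| <= d by rewrite distrC ltW.
have -> : psi f nu (x, t, l) - psi f nu (x', t', l') -
    dpsi J (nu x0) (f x0) ((x, t, l) - (x', t', l')) =
    (f x - f x' - (x - x') *m J) + (l - 1) *: (f x - f x') + (l - l') *: (f x' - f x0) +
    (l * t) *: (nu x - nu x') + (t - t') *: ((l - 1) *: nu x' + (nu x' - nu x0)) +
    ((l - l') * t') *: nu x'.
  by rewrite /psi /dpsi /=; move: ((x - x') *m J) => X; apply/rowP => k; rewrite !mxE; ring.
have m0 : 0 <= m by exact: normr_ge0.
have N' : `|nu x'| <= N.
  have := ler_normD (nu x' - nu x0) (nu x0); rewrite subrK /N.
  have : C * `|x' - x0| <= C * 1 by rewrite ler_wpM2l //; lra.
  lra.
have b2 : `|(l - 1) *: (f x - f x')| <= d * (B * m).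
  by rewrite normrZ; apply: ler_pM => //; [exact: ltW|apply: le_trans T2 _; exact: ler_wpM2l].
have b3 : `|(l - l') *: (f x' - f x0)| <= m * (B * d).
  by rewrite normrZ; apply: ler_pM => //; apply: le_trans T3 _; exact: ler_wpM2l.
have b4 : `|(l * t) *: (nu x - nu x')| <= 2 * d * (C * m).
  rewrite normrZ normrM; apply: ler_pM => //.
    apply: ler_pM => //; last exact: ltW.
    by have := ler_normD (l - 1) 1; rewrite subrK normr1; move: (ltW ld) dd4; clear; move=> *; lra.
  by apply: le_trans T4 _; exact: ler_wpM2l.
have b5 : `|(t - t') *: ((l - 1) *: nu x' + (nu x' - nu x0))| <= m * (d * N + C * d).
  rewrite normrZ; apply: ler_pM => //; apply: le_trans (ler_normD _ _) _; apply: lerD.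
    by rewrite normrZ; apply: ler_pM => //; exact: ltW.
  by apply: le_trans T5 _; exact: ler_wpM2l.
have b6 : `|((l - l') * t') *: nu x'| <= m * d * N.
  by rewrite normrZ normrM; apply: ler_pM => //; apply: ler_pM => //; exact: ltW.
have b1 : `|f x - f x' - (x - x') *m J| <= e / 2 * m.
  by apply: le_trans T1 _; apply: ler_wpM2l => //; exact: ltW.
have dK : d * K <= e / 2.
  have := ler_wpM2r (ltW K0) dd5; rewrite invfM mulrA mulfVK ?gt_eqF //.
have mdK : m * (d * K) <= m * (e / 2) by exact: ler_wpM2l.
have md : 0 <= m * d by rewrite mulr_ge0 // ltW.
do 5 (apply: le_trans (ler_normD _ _) _; rewrite -lerBrDr).
move: b1 b2 b3 b4 b5 b6 mdK md; rewrite /K.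
by clear; move: (`|_ *: _|) (`|(l - 1) *: _|) => *; lra.
Qed.

Lemma nbhs_dist_lt (V : normedModType R) (x : V) (P : set V) (d : R) : 0 < d ->
  (forall y, `|x - y| < d -> P y) -> nbhs x P.
Proof. by move=> d0 h; apply/nbhs_normP; exists d. Qed.

Lemma lip_continuous (W : normedModType R) (g : 'rV[R]_2 -> W) x0 : lip g x0 ->
  exists2 d : R, 0 < d & forall x : 'rV[R]_2, `|x0 - x| < d -> continuous_at x g.
Proof.
move=> [C [d [C0 d0 h]]]; exists d => // x xd; move=> O /nbhs_normP[e /= e0 eO].
have r0 : 0 < Num.min (d - `|x0 - x|) (e / (C + 1)).
  by rewrite lt_min subr_gt0 xd divr_gt0 // ltr_wpDl.
apply: (nbhs_dist_lt r0) => y.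
rewrite lt_min => /andP[xy1 xy2]; apply: eO => /=.
have yd : `|x0 - y| < d.
  by have := ler_normD (x0 - x) (x - y); rewrite addrA subrK; lra.
apply: le_lt_trans (h x y xd yd) _.
have : `|x - y| * (C + 1) < e by rewrite -ltr_pdivlMr // ltr_wpDl.
have : 0 <= `|x - y| by []; move: (`|x - y|) => t; lra.
Qed.

Lemma closed_ball_compact (z : E) (r : R) : compact [set z' : E | `|z - z'| <= r].
Proof.
have ball_compact m (x : 'rV[R]_m) : compact [set y : 'rV[R]_m | `|x - y| <= r].
  apply: bounded_closed_compact.
    exists (`|x| + r); split; first exact: num_real.
    move=> M M1 y /= xy; apply: le_trans (ltW M1).
    by have := ler_normB x (x - y); rewrite opprB addrC subrK; lra.
  have cN : closed [set v : 'rV[R]_m | `|v| <= r].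
    by apply: (@closed_comp _ _ (@Num.norm R 'rV[R]_m) [set t | t <= r]); [move=> v _; exact: norm_continuous|exact: closed_le].
  apply: (@closed_comp _ _ (fun y : 'rV[R]_m => x - y) [set v | `|v| <= r]) => //.
  have cx (y : 'rV[R]_m) : continuous_at y (fun y => x - y) by cont.
  by move=> y _; exact: cx.
have seg_compact (t : R) : compact [set s | `|t - s| <= r].
  have -> : [set s | `|t - s| <= r] = `[t - r, t + r]%classic.
    by apply/seteqP; split => s; rewrite /= in_itv /= ler_norml => /andP[? ?]; apply/andP; split; lra.
  exact: segment_compact.
have -> : [set z' : E | `|z - z'| <= r] = ([set y | `|z.1.1 - y| <= r] `*` [set s | `|z.1.2 - s| <= r])
    `*` [set s | `|z.2 - s| <= r].
  apply/seteqP; split => [z'|z' [[]]] /=.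
    rewrite {1}/Num.norm /= ge_max => /andP[]; rewrite {1}/Num.norm /= ge_max => /andP[? ?] ?.
    by repeat split.
  by move=> h1 h2 h3; rewrite {1}/Num.norm /= ge_max h3 andbT {1}/Num.norm /= ge_max h1.
by apply: compact_setX => //; apply: compact_setX.
Qed.

Definition open_at (X : set 'rV[R]_4) (T : topologicalType) (f : T -> 'rV[R]_4) (x : T) :=
  forall U, nbhs x U -> \forall w \near f x, X w -> exists2 y, U y & w = f y.

Lemma psi_chart (f nu : 'rV[R]_2 -> 'rV[R]_4) x0 J :
  strict_diff f x0 J -> lip nu x0 -> row_free (frame (f x0) J (nu x0)) ->
  exists2 d : R, 0 < d & forall z : E, `|(x0, 0, 1) - z| < d ->
    [/\ continuous_at z (psi f nu),
        (forall z', `|(x0, 0, 1) - z'| < d -> psi f nu z = psi f nu z' -> z = z') &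
        open_at setT (psi f nu) z].
Proof.
move=> sf ln fr; have [c c0 hc] := row_free_bound fr.
have [d1 d10 fL] := psi_strict sf ln (divr_gt0 c0 (ltr0n R 2)).
have [d2 d20 fc] := lip_continuous (strict_diff_lip sf).
have [d3 d30 nc] := lip_continuous ln.
pose d := Num.min d1 (Num.min d2 d3).
have [dd1 dd2 dd3] : [/\ d <= d1, d <= d2 & d <= d3] by rewrite /d !ge_min !lexx !orbT.
have d0 : 0 < d by rewrite !lt_min d10 d20.
have Lc (z : E) : c * `|z| <= `|dpsi J (nu x0) (f x0) z|.
  rewrite -[z in dpsi _ _ _ z]packK dpsi_unpack; apply: le_trans (hc _).
  by apply: ler_wpM2l; [exact: ltW|by have := norm_unpack (pack z); rewrite packK].
have fC z : `|(x0, 0, 1) - z| < d -> continuous_at z (psi f nu).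
  move=> zd; have [/= xz _ _] := norm3 ((x0, 0, 1) - z).
  have cz : continuous_at z (fun z : E => z.1.1) by cont.
  have cf : continuous_at z (fun z : E => f z.1.1).
    by apply: (forc_comp cz); apply/fc/(lt_le_trans (le_lt_trans xz zd)).
  have cn : continuous_at z (fun z : E => nu z.1.1).
    by apply: (forc_comp cz); apply/nc/(lt_le_trans (le_lt_trans xz zd)).
  by rewrite /psi; cont.
have fL' x y : `|(x0, 0, 1) - x| < d -> `|(x0, 0, 1) - y| < d ->
    `|psi f nu x - psi f nu y - dpsi J (nu x0) (f x0) (x - y)| <= c / 2 * `|x - y|.
  by move=> xd yd; apply: fL; apply: lt_le_trans dd1.
have LZ (s : R) h : dpsi J (nu x0) (f x0) (s *: h) = s *: dpsi J (nu x0) (f x0) h.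
  by rewrite /dpsi /= !scalerDr !scalerA scalemxAl.
pose Li (w : 'rV[R]_4) := unpack (w *m pinvmx (frame (f x0) J (nu x0))).
have LiK w : dpsi J (nu x0) (f x0) (Li w) = w.
  by rewrite /Li dpsi_unpack mulmxKpV // submx_full // row_full_unit -row_free_unit.
exists d => // z zd; split; first exact: fC.
  by move=> z' z'd; apply: (local_injective c0 Lc fL').
move=> U Uz.
have := local_open c0 closed_ball_compact LZ Lc LiK fL' fC zd Uz.
by apply: filterS => w [y Uy <-] _; exists y.
Qed.

Definition tube (f nu : 'rV[R]_2 -> 'rV[R]_4) (y : 'rV[R]_2 * R) : 'rV[R]_4 :=
  rho (f y.1 + y.2 *: nu y.1).

Lemma tube0 f nu x : sphere3 (f x) -> tube f nu (x, 0) = f x.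
Proof. by move=> fx; rewrite /tube /= scale0r addr0 rho_id. Qed.

(** Both claims come from [psi]. Injectivity: [tube f nu y] is [psi f nu (y, s y)] with [s y] the
    normalizing factor. Openness: a point of the sphere is scaled to the radius of [g y] and lifted
    through [psi], and [rho] forgets the radial coordinate of the lift. *)
Lemma tube_local (f nu : 'rV[R]_2 -> 'rV[R]_4) x0 J :
  strict_diff f x0 J -> lip nu x0 -> sphere3 (f x0) -> row_free (frame (f x0) J (nu x0)) ->
  (\forall y \near (x0, 0 : R), [/\ continuous_at y (tube f nu), sphere3 (tube f nu y) &
    open_at sphere3 (tube f nu) y]) /\
  exists2 O, nbhs (x0, 0 : R) O &
    forall y y', O y -> O y' -> tube f nu y = tube f nu y' -> y = y'.
Proof.
move=> sf ln fS fr; have [d d0 hd] := psi_chart sf ln fr.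
pose g (y : 'rV[R]_2 * R) := f y.1 + y.2 *: nu y.1.
pose s y := (Num.sqrt (sqnorm (g y)))^-1.
have f0 : f x0 != 0 by rewrite -sqnorm_gt0 fS ltr01.
have gE y : g y = psi f nu (y, 1) by rewrite /psi scale1r.
have cg y : `|(x0, 0, 1) - (y, 1)| < d -> continuous_at y g.
  move=> /hd[cp _ _].
  have -> : g = (fun y => psi f nu (y, 1)) by apply/funext => ?; rewrite gE.
  by apply: (@forc_comp _ _ _ (fun y : 'rV[R]_2 * R => (y, 1 : R)) (psi f nu)) => //; cont.
have x0d : `|(x0, 0, 1) - ((x0, 0), 1) : E| < d by rewrite subrr normr0.
have gx0 : g (x0, 0) = f x0 by rewrite /g /= scale0r addr0.
have near_d : \forall y \near (x0, 0 : R), `|(x0, 0, 1) - (y, 1)| < d.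
  have c1 : continuous_at (x0, 0 : R) (fun y : 'rV[R]_2 * R => (y, 1 : R)) by cont.
  have := near_dist c1 d0; apply: filterS => y; exact.
have near_g : \forall y \near (x0, 0 : R), g y != 0.
  have := cg _ x0d; rewrite /continuous_at gx0 => c1.
  exact: (c1 [set v | v != 0] (neq0_near f0)).
have cs : continuous_at (x0, 0 : R) s.
  have c1 := cg _ x0d; have cq := @sqnorm_continuous R 4.
  have c2 : continuous_at (x0, 0 : R) (fun y => Num.sqrt (sqnorm (g y))).
    apply: (@forc_comp _ _ _ (fun y => sqnorm (g y)) (@Num.sqrt R)); first by cont.
    exact: sqrt_continuous.
  by apply: forcV => //; rewrite gx0 fS sqrtr1 oner_neq0.
have near_s : \forall y \near (x0, 0 : R), `|(x0, 0, 1) - (y, s y)| < d.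
  have c1 : continuous_at (x0, 0 : R) (fun y : 'rV[R]_2 * R => (y, s y)) by cont.
  have := near_dist c1 d0; rewrite /s gx0 fS sqrtr1 invr1; apply: filterS => y; exact.
have tE y : tube f nu y = psi f nu (y, s y) by [].
split; last first.
  exists [set y | `|(x0, 0, 1) - (y, s y)| < d] => // y y' /hd[_ inj _] /inj h; rewrite !tE => /h.
  by case.
near=> y; have gy0 : g y != 0 by near: y.
have yd : `|(x0, 0, 1) - (y, 1)| < d by near: y.
have cgy := cg _ yd.
split.
- by apply: (@forc_comp _ _ _ g (@rho R 4)) => //; exact: rho_continuous.
- exact: sqnorm_rho.
- move=> W Wy; have [_ _ op] := hd _ yd.
  have a0 := sqrt_sqnorm_gt0 gy0; set a := Num.sqrt _ in a0.
  have NU : nbhs (y, 1 : R) [set z : E | W z.1 /\ 0 < z.2].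
    exists (W, [set t : R | 0 < t]); first by split => //; exact: (lt_nbhsr ltr01).
    by move=> [z1 z2] [].
  have op1 := op _ NU; rewrite -gE -(rhoK (g y)) -/a in op1.
  have ca : continuous_at (rho (g y)) (fun v : 'rV[R]_4 => a *: v) by cont.
  apply: (@filterS _ (nbhs (rho (g y))) _ _ _ _ (ca _ op1)) => v /= /(_ I)[[z t] [/= Wz t0] e] vS.
  exists z => //; rewrite -(rho_id vS) -(rhoZ v a0) e /psi /= rhoZ //.
Unshelve. all: by end_near.
Qed.

Lemma small_multiples_le0 (k C : R) : (forall e, 0 < e <= 1 -> k <= e * C) -> k <= 0.
Proof.
move=> h; rewrite leNgt; apply/negP => k0; pose D := `|C| + k.
have CD : C <= `|C| by exact: ler_norm.
have D0 : 0 < 2 * D by rewrite mulr_gt0 // ltr_wpDl.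
have e0 : 0 < k / (2 * D) <= 1.
  rewrite divr_gt0 //= ler_pdivrMr // mul1r /D; have : 0 <= `|C| by [].
  by move: (`|C|) => t; lra.
have := h _ e0; have : k / (2 * D) * C <= k / (2 * D) * D.
  by apply: ler_wpM2l; [case/andP: e0 => /ltW|rewrite /D; lra].
have -> : k / (2 * D) * D = k / 2 by field; rewrite gt_eqF // -(pmulr_rgt0 _ (ltr0n R 2)).
lra.
Qed.

Lemma dot_le4 (a b : 'rV[R]_4) : `|dot a b| <= 4 * (`|a| * `|b|).
Proof. exact: dot_le_norm. Qed.

Lemma line_expansion f u J v : strict_diff f u J -> forall e : R, 0 < e -> exists2 d : R, 0 < d &
  forall h, 0 < h < d -> `|f (u + h *: v) - f u - h *: (v *m J)| <= h * (e * `|v|).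
Proof.
move=> sf e e0; have [d d0 hd] := sf e e0.
have v1 : 0 < `|v| + 1 by rewrite ltr_wpDl.
exists (d / (`|v| + 1)); first by rewrite divr_gt0.
move=> h /andP[h0]; rewrite ltr_pdivlMr // => hd1.
have uh : `|u - (u + h *: v)| < d.
  by rewrite opprD addNKr normrN normrZ gtr0_norm //; lra.
have := hd (u + h *: v) u uh; rewrite subrr normr0 => /(_ d0).
rewrite (_ : u + h *: v - u = h *: v); last by rewrite addrC addKr.
by rewrite normrZ gtr0_norm // -scalemxAl mulrCA.
Qed.

Lemma small_step (a b c : R) : 0 < a -> 0 < b -> 0 < c -> exists2 h : R, 0 < h & [/\ h < a, h < b & h < c].
Proof.
move=> a0 b0 c0; pose m := Num.min a (Num.min b c).
have m0 : 0 < m by rewrite !lt_min a0 b0.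
have [ma mb mc] : [/\ m <= a, m <= b & m <= c] by rewrite /m !ge_min !lexx !orbT.
by exists (m / 2); [rewrite divr_gt0|split; lra].
Qed.

(** Expansion of the squared distance to first order. The step [h] is positive because at the rim of
    a disk or the edge of a chart only inward motion is possible. *)
Lemma sqnorm_line f u J (v : 'rV[R]_2) z : strict_diff f u J -> exists C : R,
  forall e, 0 < e <= 1 -> exists2 d : R, 0 < d & forall h, 0 < h < d ->
    `|sqnorm (z - f (u + h *: v)) - sqnorm (z - f u) + 2 * (h * dot (z - f u) (v *m J))| <= h * (e * C).
Proof.
move=> sf; pose m := `|v *m J| + `|v|; have m0 : 0 <= m by rewrite addr_ge0.
exists (8 * (`|z - f u| * `|v|) + 4 * m ^+ 2) => e /andP[e0 e1].
have [d d0 hd] := line_expansion v sf e0; have [k k0 [kd ke _]] := small_step d0 e0 e0.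
exists k => // h /andP[h0 hk].
have : `|f (u + h *: v) - f u - h *: (v *m J)| <= h * (e * `|v|).
  by apply: hd; rewrite h0; apply: lt_trans kd.
pose D := f (u + h *: v) - f u; rewrite -/D; set w := D - _ => hw.
have De : D = h *: (v *m J) + w by rewrite /w addrC subrK.
have wn : `|w| <= h * `|v|.
  apply: le_trans hw _; rewrite ler_pM2l //; have : 0 <= `|v| by [].
  by move: (`|v|) => t t0; rewrite -[leRHS]mul1r ler_wpM2r.
have Dn : `|D| <= h * m.
  rewrite De; apply: le_trans (ler_normD _ _) _; rewrite normrZ gtr0_norm //.
  by rewrite mulrDr lerD2l.
have sD : sqnorm D <= h * (e * (4 * m ^+ 2)).
  apply: le_trans (sqnorm_le_norm _) _; apply: (@le_trans _ _ (4 * (h * m) ^+ 2)).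
    by rewrite ler_pM2l // ler_sqr ?nnegrE // mulr_ge0 // ltW.
  rewrite exprMn expr2 -mulrA mulrCA ler_pM2l // [leRHS]mulrCA ler_pM2l //.
  by rewrite ler_wpM2r ?exprn_ge0 // ltW // (lt_trans hk).
have zw : `|dot (z - f u) w| <= h * (e * (4 * (`|z - f u| * `|v|))).
  apply: le_trans (dot_le4 _ _) _; have := ler_wpM2l (normr_ge0 (z - f u)) hw.
  by move: (`|z - f u|) (`|w|) (`|v|) => ? ? ?; lra.
have -> : z - f (u + h *: v) = z - f u - D by rewrite /D opprB addrA subrK.
rewrite (sqnormB (z - f u) D) {1}De dotDr dotZr; have := sqnorm_ge0 D.
move: sD zw; rewrite ler_norml => sD /andP[z1 z2] sD0.
by rewrite ler_norml; apply/andP; split; move: sD sD0 z1 z2; rewrite !mulrDr; lra.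
Qed.

Lemma critical_point f u J (v : 'rV[R]_2) z : strict_diff f u J ->
  (exists2 d : R, 0 < d & forall h, 0 < h < d -> sqnorm (z - f u) <= sqnorm (z - f (u + h *: v))) ->
  dot (z - f u) (v *m J) <= 0.
Proof.
move=> sf [d1 d10 hv]; have [C hC] := sqnorm_line v z sf.
apply: (@small_multiples_le0 _ (C / 2)) => e e01; have [d d0 hd] := hC e e01.
have [h h0 [h1 h2 _]] := small_step d10 d0 d0.
have := hv h; rewrite h0 => /(_ h1) q; have := hd h; rewrite h0 => /(_ h2).
by rewrite ler_norml => /andP[_ q2]; rewrite -(ler_pM2l h0); lra.
Qed.

Lemma tangent_sphere f x0 J (v : 'rV[R]_2) : strict_diff f x0 J -> sqnorm (f x0) = 1 ->
  (exists2 d : R, 0 < d & forall h, 0 < h < d -> sqnorm (f (x0 + h *: v)) = 1) ->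
  dot (v *m J) (f x0) = 0.
Proof.
move=> sf f1 [d1 d10 hv]; have [C hC] := sqnorm_line v 0 sf.
apply/eqP; rewrite -normr_le0; apply: (@small_multiples_le0 _ C) => e e01.
have [d d0 hd] := hC e e01; have [h h0 [h1 h2 _]] := small_step d10 d0 d0.
have := hd h; rewrite h0 => /(_ h2); rewrite !sub0r !sqnormN f1 hv ?h0 // subrr add0r.
rewrite dotNl mulrN mulrN normrN dotC !normrM (gtr0_norm h0) normr_nat mulrCA ler_pM2l //.
by have := normr_ge0 (dot (v *m J) (f x0)); lra.
Qed.

(** By convexity one may move from [x] towards 0 and towards each basis vector; the differences of
    these directions are the basis vectors themselves. *)
Lemma disk_tangent (f : 'rV[R]_2 -> 'rV[R]_4) x J : disk x -> strict_diff f x J ->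
  f @` disk `<=` sphere3 -> forall i, dot (row i J) (f x) = 0.
Proof.
move=> Dx sf fS; have S y : disk y -> sqnorm (f y) = 1 by move=> Dy; apply: fS; exists y.
have conv y h : disk y -> 0 < h < 1 -> disk (x + h *: (y - x)).
  move=> Dy /andP[h0 h1]; have -> : x + h *: (y - x) = (1 - h) *: x + h *: y.
    by apply/rowP => k; rewrite !mxE; ring.
  rewrite /disk /= sqnormD !sqnormZ dotZl dotZr.
  have : 0 <= (1 - h) * h * sqnorm (x - y).
    by rewrite mulr_ge0 ?sqnorm_ge0 // mulr_ge0; lra.
  rewrite sqnormB; have : (1 - h) * sqnorm x <= (1 - h) * 1 by rewrite ler_wpM2l //; lra.
  have : h * sqnorm y <= h * 1 by rewrite ler_wpM2l //; lra.
  move: (sqnorm x) (sqnorm y) (dot x y) => a b c; nra.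
have T y : disk y -> dot ((y - x) *m J) (f x) = 0.
  move=> Dy; apply: tangent_sphere => //; first exact: S.
  by exists 1 => // h h01; apply: S; exact: conv.
have D0 : disk (0 : 'rV[R]_2) by rewrite /disk /= sqnormE dot0l.
have Di i : disk (delta_mx 0 i : 'rV[R]_2).
  rewrite /disk /= /sqnorm (bigD1 i) //= big1 ?mxE ?eqxx ?expr1n ?addr0 //.
  by move=> j ji; rewrite mxE (negPf ji) andbF expr0n.
move=> i; have := T _ D0; have := T _ (Di i).
rewrite rowE sub0r mulNmx dotNl mulmxBl dotBl; lra.
Qed.

Lemma frame_normal a (J : 'M[R]_(2, 4)) : sphere3 a -> row_free J -> (forall i, dot (row i J) a = 0) ->
  row_free (frame a J (conormal a J)).
Proof.
move=> aS fJ Ja; have a0 : a != 0 by rewrite -sqnorm_gt0 aS ltr01.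
apply: frame_unit => //; [exact: normal_neq0|exact: dot_normal|exact: dot_row_normal].
Qed.

Lemma separation (S T W : normedModType R) (f : S -> W) (g : T -> W) a b :
  continuous_at a f -> continuous_at b g -> f a != g b ->
  nbhs (a, b) [set z | f z.1 <> g z.2].
Proof.
move=> fc gc ab; have r0 : 0 < `|f a - g b| / 2 by rewrite divr_gt0 // normr_gt0 subr_eq0.
have N1 := near_dist fc r0; have N2 := near_dist gc r0.
exists ([set x | `|f a - f x| < `|f a - g b| / 2], [set x | `|g b - g x| < `|f a - g b| / 2]) => //.
move=> [x y] /= [h1 h2] e.
have := ler_normD (f a - f x) (g y - g b); rewrite e addrA subrK (distrC (g y)) => h; move: h1 h2; rewrite e; move: h.
by move: (`|f a - g b|) (`|f a - g y|) (`|g b - g y|) => p q t; lra.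
Qed.

(** The local properties hold near each point of the compact flat disk, hence in a thin ellipsoid.
    Global injectivity is the same argument on pairs of points: local injectivity near the diagonal,
    embeddedness and disjointness of the disks away from it. *)
Lemma trivial_link_tube n (L : 'I_n -> R -> 'rV[R]_4) : trivial_link L ->
  exists e Phi, tube_system e Phi /\ forall i, Phi i @` circle0 = range (L i).
Proof.
case=> d [dE dL dT].
have dS i x : disk x -> sphere3 (d i x) by move=> Dx; have [_ _ _ h] := dE i; apply: h; exists x.
pose nu i x := conormal (d i x) (partials (d i) x).
pose Phi i := tube (d i) (nu i).
have loc i y : disk0 y -> (\forall z \near y, [/\ continuous_at z (Phi i), sphere3 (Phi i z) &
    open_at sphere3 (Phi i) z]) /\
    exists2 O, nbhs y O & forall z z', O z -> O z' -> Phi i z = Phi i z' -> z = z'.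
  case: y => x t [/= Dx ->]; have [[U [oU DU] sU] fJ _ dSi] := dE i.
  have sd := smooth_strict_diff oU sU (DU _ Dx).
  have ln := lip_normal oU sU (DU _ Dx).
  apply: (tube_local sd ln (dS i x Dx)).
  rewrite partialsE; last exact: smooth_differentiable (DU _ Dx).
  apply: frame_normal; [exact: dS|exact: fJ|exact: (disk_tangent Dx sd dSi)].
have good i : exists2 r : R, 0 < r & forall x y, disk0 x -> `|x - y| < r ->
    [/\ continuous_at y (Phi i), sphere3 (Phi i y) & open_at sphere3 (Phi i) y].
  have [|r r0 hr] := @compact_thickening R _ disk0
      [set y | [/\ continuous_at y (Phi i), sphere3 (Phi i y) & open_at sphere3 (Phi i) y]] disk0_compact.
    by move=> x /(loc i)[].
  by exists r => // x y; exact: hr.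
have inj i j : exists2 r : R, 0 < r & forall z z', disk0 z.1 /\ disk0 z.2 -> `|z - z'| < r ->
    Phi i z'.1 = Phi j z'.2 -> i = j /\ z'.1 = z'.2.
  have cK := compact_setX (@disk0_compact R) (@disk0_compact R).
  have [|r r0 hr] := @compact_thickening R _ (disk0 `*` disk0)
      [set z' | Phi i z'.1 = Phi j z'.2 -> i = j /\ z'.1 = z'.2] cK; last first.
    by exists r => // z z'; exact: hr.
  move=> [a b] [/= Da Db].
  have [[ij ab]|ne] := pselect (i = j /\ a = b).
    move: Db; rewrite -ij -ab => _.
    have [_ [Q Qa hQ]] := loc i a Da.
    exists (Q, Q); first by split.
    by move=> [z z'] /= [Qz Qz'] e; split; [reflexivity|exact: hQ e].
  have Dab : Phi i a != Phi j b.
    case: a b Da Db ne => [x t] [x' t'] [/= Dx ->] [/= Dx' ->] ne.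
    rewrite /Phi !tube0; [|exact: dS|exact: dS]; apply/eqP => e.
    have ij : i = j.
      by apply: (dT i j I I); exists (d i x); split; [exists x|rewrite e; exists x'].
    move: e; rewrite -ij => e; apply: ne; split => //; congr (_, _).
    by have [_ _ h _] := dE i; apply: h; rewrite ?inE // -?ij.
  have [ca _ _] := nbhs_singleton (loc i a Da).1; have [cb _ _] := nbhs_singleton (loc j b Db).1.
  by apply: filterS (separation ca cb Dab) => z' /= h /h.
pose r1 i := projT1 (cid2 (good i)).
have r1P i : 0 < r1 i /\ forall x y, disk0 x -> `|x - y| < r1 i ->
    [/\ continuous_at y (Phi i), sphere3 (Phi i y) & open_at sphere3 (Phi i) y].
  by rewrite /r1; case: cid2.
pose r2 (k : 'I_n * 'I_n) := projT1 (cid2 (inj k.1 k.2)).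
have r2P k : 0 < r2 k /\ forall z z', disk0 z.1 /\ disk0 z.2 -> `|z - z'| < r2 k ->
    Phi k.1 z'.1 = Phi k.2 z'.2 -> k.1 = k.2 /\ z'.1 = z'.2.
  by rewrite /r2; case: cid2.
pose r := Num.min (\big[Num.min/1]_i r1 i) (\big[Num.min/1]_k r2 k).
have r0 : 0 < r.
  rewrite lt_min; apply/andP; split; apply: (big_ind (fun x : R => 0 < x)) => //.
  - by move=> a b a0 b0; rewrite lt_min a0.
  - by move=> i _; case: (r1P i).
  - by move=> a b a0 b0; rewrite lt_min a0.
  - by move=> k _; case: (r2P k).
have rr1 i : r <= r1 i by rewrite /r ge_min; apply/orP; left; exact: bigmin_le_cond.
have rr2 k : r <= r2 k by rewrite /r ge_min; apply/orP; right; exact: bigmin_le_cond.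
have e0 : 0 < r / 2 by rewrite divr_gt0.
have G y : gauge (r / 2) y < 1 -> exists2 y0, disk0 y0 & `|y0 - y| < r.
  by move=> /ltW/(gauge_near_disk0 e0)[y0 Dy0 yy0]; exists y0 => //; lra.
exists (r / 2), Phi; split; last first.
  move=> i; rewrite -dL; apply/seteqP; split => x [y Cy <-].
    by case: y Cy => y t [/= Cy ->]; exists y => //; rewrite /Phi tube0 //; apply: dS; rewrite /disk /= Cy.
  by exists (y, 0) => //; rewrite /Phi tube0 //; apply: dS; rewrite /disk /= Cy.
split; first exact: e0.
- move=> i y /G[y0 Dy0 yy0]; have [_ /(_ _ _ Dy0 (lt_le_trans yy0 (rr1 i)))[]] := r1P i.
  by [].
- move=> i j y y' /G[y0 Dy0 yy0] /G[y1 Dy1 yy1].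
  have [_ /(_ (y0, y1) (y, y') (conj Dy0 Dy1))] := r2P (i, j); apply.
  apply: lt_le_trans (rr2 (i, j)); rewrite /Num.norm /= gt_max; exact/andP.
- move=> i y W /G[y0 Dy0 yy0] Wy; have [_ /(_ _ _ Dy0 (lt_le_trans yy0 (rr1 i)))[_ _ op]] := r1P i.
  exact: op.
Qed.

End NormalTube.

(** * Charts of a surface *)

Local Notation pmap := Defs.pmap.
Local Notation dom := Defs.dom.
Local Notation pjac p u := ('J (pmap p) u).
Local Notation pnormal p u := (conormal (pmap p u) (pjac p u)).

Section FirstOrder.
Context {R : realType}.
Implicit Types (f : 'rV[R]_2 -> 'rV[R]_4) (u v : 'rV[R]_2) (J : 'M[R]_(2, 4)) (z nu : 'rV[R]_4).

Lemma flat_tangent (F : set 'rV[R]_4) f u J v nu : strict_diff f u J ->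
  (exists2 d : R, 0 < d & forall h, 0 < h < d -> F (f (u + h *: v))) ->
  (forall e : R, 0 < e -> exists2 d : R, 0 < d & forall y, F y -> `|f u - y| < d ->
     `|dot (y - f u) nu| <= e * `|y - f u|) ->
  dot (v *m J) nu = 0.
Proof.
move=> sf [d1 d10 hF] fl; apply/eqP; rewrite -normr_le0.
pose m := `|v *m J| + `|v|; have m0 : 0 <= m by rewrite addr_ge0.
apply: (@small_multiples_le0 R _ (m + 4 * (`|v| * `|nu|))) => e /andP[e0 e1].
have [d2 d20 hd] := line_expansion v sf e0; have [d3 d30 hfl] := fl e e0.
have m1 : 0 < m + 1 by rewrite ltr_wpDl.
have [h h0 [h3 h1 h2]] := small_step (divr_gt0 d30 m1) d10 d20.
have {}hd : `|f (u + h *: v) - f u - h *: (v *m J)| <= h * (e * `|v|) by apply: hd; rewrite h0.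
have {}hF : F (f (u + h *: v)) by apply: hF; rewrite h0.
pose D := f (u + h *: v) - f u; pose w := D - h *: (v *m J).
have De : D = h *: (v *m J) + w by rewrite /w addrC subrK.
have wn : `|w| <= h * `|v|.
  apply: le_trans hd _; rewrite ler_pM2l //; have : 0 <= `|v| by [].
  by move: (`|v|) => t t0; rewrite -[leRHS]mul1r ler_wpM2r.
have Dn : `|D| <= h * m.
  rewrite De; apply: le_trans (ler_normD _ _) _; rewrite normrZ gtr0_norm //.
  by rewrite mulrDr lerD2l.
have Dd : `|f u - f (u + h *: v)| < d3.
  rewrite distrC; apply: le_lt_trans Dn _; move: h3; rewrite ltr_pdivlMr //.
  by rewrite mulrDr; lra.
have q1 := hfl _ hF Dd; rewrite -/D in q1.
have q2 : `|dot w nu| <= 4 * ((h * (e * `|v|)) * `|nu|).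
  by apply: le_trans (dot_le4 _ _) _; rewrite ler_pM2l //; apply: ler_wpM2r.
have q3 : e * `|D| <= e * (h * m) by rewrite ler_pM2l.
have q4 : h * `|dot (v *m J) nu| <= `|dot D nu| + `|dot w nu|.
  rewrite -{1}(gtr0_norm h0) -normrM -dotZl (_ : h *: (v *m J) = D - w); last by rewrite De addrK.
  by rewrite dotBl ler_normB.
rewrite -(ler_pM2l h0).
have -> : h * (e * (m + 4 * (`|v| * `|nu|))) = e * (h * m) + 4 * ((h * (e * `|v|)) * `|nu|) by ring.
by move: q1 q2 q3 q4; clear; move: (`|dot D nu|) (`|dot w nu|) (e * `|D|) (h * `|_|) => *; lra.
Qed.

End FirstOrder.

Section Charts.
Context {R : realType} {F : set 'rV[R]_4} {p : @param R}.
Hypothesis (FS : F `<=` sphere3) (Fp : is_param F p).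
Local Notation f := (pmap p).
Local Notation J u := ('J f u).
Local Notation nu u := (conormal (f u) (J u)).
Implicit Types u v : 'rV[R]_2.

Lemma param_strict_diff u : chart_dom p u -> strict_diff f u (J u).
Proof. by have [[od sf] _ _ _] := Fp => -[du _]; exact: smooth_strict_diff od sf du. Qed.

Lemma param_in u : chart_dom p u -> F (f u).
Proof.
have [_ _ _ h] := Fp; have [V oV e] := h setT openT => cu.
by have [] : (F `&` V) (f u) by rewrite -e; exists u.
Qed.

Lemma param_near u N : chart_dom p u -> nbhs u N ->
  \forall y \near f u, F y -> exists2 u', N u' /\ chart_dom p u' & f u' = y.
Proof.
move=> cu; rewrite nbhsE => -[B [oB Bu] BN].
have [_ _ _ h] := Fp; have [V oV e] := h B oB.
have [_ Vx] : (F `&` V) (f u) by rewrite -e; exists u.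
have : nbhs (f u) V by apply: open_nbhs_nbhs.
apply: filterS => y Vy Fy; have : (F `&` V) y by [].
by rewrite -e => -[u' [Bu' cu'] <-]; exists u' => //; split => //; exact: BN.
Qed.

Lemma chart_line u v : chart_dom p u -> 0 < u 0 ord_max \/ 0 <= v 0 ord_max ->
  exists2 d : R, 0 < d & forall h, 0 < h < d -> chart_dom p (u + h *: v).
Proof.
have [[od _] _ _ _] := Fp; move=> [du hu] uv.
have [d1 d10 hd] : exists2 d : R, 0 < d & forall h, 0 < h < d -> dom p (u + h *: v).
  have /nbhs_normP[d /= d0 hd] : nbhs u (dom p) by exact: open_nbhs_nbhs.
  have v1 : 0 < `|v| + 1 by rewrite ltr_wpDl.
  exists (d / (`|v| + 1)); first by rewrite divr_gt0.
  move=> h /andP[h0]; rewrite ltr_pdivlMr // => hd1; apply: hd.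
  by rewrite /= opprD addNKr normrN normrZ gtr0_norm //; lra.
have hu' : 0 <= u 0 ord_max by exact: hu.
case: uv => [u0|v0]; last first.
  exists d1 => // h /andP[h0 h1]; split; first by apply: hd; rewrite h0.
  by rewrite /half_plane /= !mxE addr_ge0 // mulr_ge0 // ltW.
have v1 : 0 < `|v 0 ord_max| + 1 by rewrite ltr_wpDl.
exists (Num.min d1 (u 0 ord_max / (`|v 0 ord_max| + 1))); first by rewrite lt_min d10 divr_gt0.
move=> h; rewrite lt_min => /and3P[h0 h1 h2]; split; first by apply: hd; rewrite h0.
rewrite /half_plane /= !mxE; move: h2; rewrite ltr_pdivlMr // => h2.
have := ler_norm (- v 0 ord_max); rewrite normrN => h3.
have : h * (- v 0 ord_max) <= h * `|v 0 ord_max| by rewrite ler_pM2l.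
lra.
Qed.

Lemma param_tangent u i : chart_dom p u -> dot (row i (J u)) (f u) = 0.
Proof.
move=> cu; rewrite rowE; apply: tangent_sphere (param_strict_diff cu) _ _.
  exact/FS/param_in.
have [|d d0 hd] := chart_line (v := delta_mx 0 i) cu; last first.
  by exists d => // h /hd/param_in/FS.
by right; rewrite mxE ler0n.
Qed.

Lemma param_frame u : chart_dom p u -> row_free (frame (f u) (J u) (nu u)).
Proof.
move=> cu; have [_ fJ _ _] := Fp.
by apply: frame_normal; [exact/FS/param_in|exact: fJ|move=> i; exact: param_tangent].
Qed.

(** All points of [F] near [f u] come from the chart, so [F] itself is flat to first order. Two
    variable points are allowed because nearest points of different points will be compared. *)
Lemma param_flat u : chart_dom p u -> forall e : R, 0 < e -> exists2 d : R, 0 < d &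
  forall y y', F y -> F y' -> `|f u - y| < d -> `|f u - y'| < d ->
    `|dot (y - y') (nu u)| <= e * `|y - y'|.
Proof.
move=> cu e e0; have [_ fJ _ _] := Fp; have [c c0 hc] := row_free_bound (fJ u cu).
(* The first bound makes [f] expand by at least c / 2; the second one pays for the factor 4 of
   [dot_le4] and for this expansion constant. *)
pose e1 := Num.min (c / 2) (e * c / (8 * (`|nu u| + 1))).
have n1 : 0 < `|nu u| + 1 by rewrite ltr_wpDl.
have e10 : 0 < e1 by rewrite lt_min !divr_gt0 // ?mulr_gt0.
have [e1c e1e] : e1 <= c / 2 /\ e1 <= e * c / (8 * (`|nu u| + 1)).
  by rewrite /e1 !ge_min !lexx orbT.
have [d1 d10 hd] := param_strict_diff cu e10.
have : nbhs u [set u' | `|u - u'| < d1] by exact: nbhs_dist_lt d10 (fun _ h => h).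
move=> /(param_near cu)/nbhs_normP[d /= d0 h]; exists d => // y y' Fy Fy' yd y'd.
have [a [ad ca] <-] := h y yd Fy; have [b [bd cb] <-] := h y' y'd Fy'.
have := hd a b ad bd; set w := f a - f b - _ => wn.
have fab : f a - f b = (a - b) *m J u + w by rewrite /w [RHS]addrC subrK.
have -> : dot (f a - f b) (nu u) = dot w (nu u).
  by rewrite fab dotDl dot_mulmx ?add0r // => i; exact: dot_row_normal.
have ab : c / 2 * `|a - b| <= `|f a - f b|.
  have := hc (a - b); rewrite (_ : (a - b) *m J u = (f a - f b) - w); last by rewrite fab addrK.
  have := ler_normB (f a - f b) w; have : e1 * `|a - b| <= c / 2 * `|a - b| by rewrite ler_wpM2r.
  lra.
apply: le_trans (dot_le4 _ _) _.
have h1 : `|w| * `|nu u| <= (e1 * `|a - b|) * (`|nu u| + 1).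
  by apply: ler_pM => //; rewrite lerDl.
have h2 : (e1 * (`|nu u| + 1)) * `|a - b| <= e * c / 8 * `|a - b|.
  by apply: ler_wpM2r => //; move: e1e; rewrite ler_pdivlMr ?mulr_gt0 //; lra.
have h3 : e * (c / 2 * `|a - b|) <= e * `|f a - f b| by rewrite ler_pM2l.
lra.
Qed.

(** The velocity of a curve in [F] is orthogonal to the conormal, by flatness, and to the position
    vector, by the sphere; expanded in the frame it has only the two tangential terms left. *)
Lemma tangent_coincide (g : 'rV[R]_2 -> 'rV[R]_4) u u' (J' : 'M[R]_(2, 4)) v :
  chart_dom p u -> strict_diff g u' J' -> g u' = f u ->
  (exists2 d : R, 0 < d & forall h, 0 < h < d -> F (g (u' + h *: v))) ->
  dot (v *m J') (nu u) = 0 /\ exists v', v *m J' = v' *m J u.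
Proof.
move=> cu sg gu gF.
have T : dot (v *m J') (nu u) = 0.
  apply: (flat_tangent sg gF) => e e0; have [d d0 hd] := param_flat cu e0.
  exists d => // y Fy; rewrite gu => yd; apply: hd => //; first exact: param_in.
  by rewrite subrr normr0.
have T2 : dot (v *m J') (f u) = 0.
  rewrite -gu; apply: (tangent_sphere sg).
    by rewrite gu; exact/FS/param_in.
  by case: gF => d d0 hd; exists d => // h /hd/FS.
split => //; have fr := param_frame cu.
have : (v *m J' <= frame (f u) (J u) (nu u))%MS by rewrite submx_full // row_full_unit -row_free_unit.
case/submxP => w; rewrite mulmx_frame => e; exists (\row_(j < 2) w 0 (inord j.+1)).
have x0 : sqnorm (f u) = 1 by exact/FS/param_in.
have Jx : dot ((\row_(j < 2) w 0 (inord j.+1)) *m J u) (f u) = 0.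
  by apply: dot_mulmx => i; exact: param_tangent.
have Jn : dot ((\row_(j < 2) w 0 (inord j.+1)) *m J u) (nu u) = 0.
  by apply: dot_mulmx => i; exact: dot_row_normal.
have w1 : w 0 0 = 0.
  move: T2; rewrite e !dotDl !dotZl Jx -sqnormE x0 (dotC (nu u)) dot_normal.
  by rewrite mulr0 mulr1 !addr0.
have n0 : nu u != 0.
  apply: normal_neq0; [by rewrite -sqnorm_gt0 x0 ltr01|by have [_ h _ _] := Fp; exact: h|].
  by move=> i; exact: param_tangent.
have w3 : w 0 ord_max = 0.
  move: T; rewrite e !dotDl !dotZl Jn -sqnormE dot_normal mulr0 !add0r => /eqP.
  by rewrite mulf_eq0 sqnorm_eq0 (negPf n0) orbF => /eqP.
by rewrite e w1 w3 !scale0r addr0 add0r.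
Qed.

End Charts.

Section Interior.
Context {R : realType} {F : set 'rV[R]_4}.
Hypothesis FS : F `<=` sphere3.
Implicit Types (p : @param R) (u v w : 'rV[R]_2) (J : 'M[R]_(2, 4)).

(* w is the inward direction at the boundary point u', and v is the same tangent vector in the
   interior chart f. *)
Lemma edge_no_exit (f g : 'rV[R]_2 -> 'rV[R]_4) u u' J J' v w :
  strict_diff f u J -> strict_diff g u' J' -> row_free J' -> f u = g u' ->
  w 0 ord_max = 1 -> `|w| <= 1 -> w *m J' = v *m J ->
  (exists2 d : R, 0 < d & forall h, 0 < h < d -> F (f (u + h *: - v))) ->
  (forall d : R, 0 < d -> \forall y \near g u', F y ->
    exists2 t, `|u' - t| < d & u' 0 ord_max <= t 0 ord_max /\ g t = y) -> False.
Proof.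
move=> sf sg fJ' fu w1 nw ev [d1 d10 h1] cov.
have [c c0 hc] := row_free_bound fJ'.
pose m := `|v| + 2; have m0 : 0 < m by rewrite ltr_wpDl.
pose e := c / (2 * m); have e0 : 0 < e := divr_gt0 c0 (mulr_gt0 (ltr0n R 2) m0).
have [d2 d20 h2] := line_expansion (- v) sf e0.
have [d3 d30 h3] := sg e e0.
have /nbhs_normP[d4 /= d40 h4] := cov d3 d30.
pose k := `|v *m J| + e * `|v| + 1.
have k0 : 0 < k by rewrite ltr_wpDl // addr_ge0 // mulr_ge0 // ltW.
have [h h0 [hd4 hd1 hd2]] := small_step (divr_gt0 d40 k0) d10 d20.
have {}h1 : F (f (u + h *: - v)) by apply: h1; rewrite h0.
set y := f (u + h *: - v) in h1.
have {}h2 : `|y - f u + h *: (v *m J)| <= h * (e * `|v|).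
  have := h2 h; rewrite h0 => /(_ hd2); rewrite (normrN v) mulNmx (scalerN h (v *m J)) opprK; exact.
have yd : `|g u' - y| < d4.
  have : `|y - f u| <= h * k.
    have := ler_normB (y - f u + h *: (v *m J)) (h *: (v *m J)).
    rewrite addrK normrZ gtr0_norm //; move: h2; rewrite /k !mulrDr mulr1; lra.
  by move: hd4; rewrite ltr_pdivlMr // -fu distrC => h5 /le_lt_trans; apply.
have [t td [t0 ty]] := h4 y yd h1.
have := h3 t u' td; rewrite subrr normr0 => /(_ d30); rewrite ty -fu => {}h3.
(* To first order [t] should be [u' - h *: w], but it cannot lie below [u'] while [w] has height 1.
   So [N] is at least [h], against a defect that is small compared with [h]. *)
pose N := `|t - u' + h *: w|.
have hN : h <= N.
  have := coord_le_norm (t - u' + h *: w) ord_max; rewrite -/N; apply: le_trans.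
  by rewrite !mxE w1 mulr1; apply: le_trans (ler_norm _); rewrite lerDr subr_ge0.
have tN : `|t - u'| <= 2 * N.
  have := ler_normB (t - u' + h *: w) (h *: w); rewrite addrK normrZ gtr0_norm // -/N.
  have : h * `|w| <= h * 1 by rewrite ler_pM2l.
  lra.
have := hc (t - u' + h *: w); rewrite -/N mulmxDl -scalemxAl ev.
have -> : (t - u') *m J' + h *: (v *m J) =
    (y - f u + h *: (v *m J)) - (y - f u - (t - u') *m J').
  by apply/rowP => k'; move: (_ *m _) (v *m _) => A B; rewrite !mxE; ring.
move=> /le_trans/(_ (ler_normB _ _)) cN.
have : e * `|t - u'| <= e * (2 * N) by rewrite ler_pM2l.
have : h * (e * `|v|) <= N * (e * `|v|) by rewrite ler_wpM2r // mulr_ge0 // ltW.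
have em : e * m = c / 2 by rewrite /e; field; rewrite gt_eqF.
have : N * (e * m) = N * (e * `|v|) + 2 * (e * N) by rewrite /m; ring.
have : 0 < c * N by rewrite mulr_gt0 //; lra.
by rewrite em; lra.
Qed.

(** A first-order substitute for invariance of domain: from an interior point one can move in [F]
    against the inward direction of the other chart, which has no points there. *)
Lemma edge_invariance p p' u u' : is_param F p -> is_param F p' ->
  chart_dom p u -> 0 < u 0 ord_max -> chart_dom p' u' -> pmap p u = pmap p' u' ->
  0 < u' 0 ord_max.
Proof.
move=> Fp Fp' cu u0 cu' fu; rewrite lt0r [X in _ && X](cu'.2) andbT; apply/eqP => u'0.
have sg := param_strict_diff Fp' cu'; have sf := param_strict_diff Fp cu.
have [w w1 nw] : exists2 w : 'rV[R]_2, w 0 ord_max = 1 & `|w| <= 1.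
  exists (delta_mx 0 ord_max); first by rewrite mxE !eqxx.
  by apply: norm_le_coord => // j; rewrite mxE; case: (_ && _); rewrite ?normr1 ?normr0.
have line_u v := chart_line (v := v) Fp cu (or_introl u0); clear u0.
have [v ev] : exists v, w *m pjac p' u' = v *m pjac p u.
  apply: (tangent_coincide FS Fp cu sg (esym fu) _).2.
  have [|d d0 hd] := chart_line (v := w) Fp' cu'; first by right; rewrite w1 ler01.
  by exists d => // h /hd/(param_in Fp').
have [_ fJ' _ _] := Fp'.
apply: (edge_no_exit sf sg (fJ' u' cu') fu w1 nw ev).
  by have [d d0 hd] := line_u (- v); exists d; [exact: d0|move=> h hh; have := param_in Fp (hd h hh)].
move=> d d0; have : nbhs u' [set t | `|u' - t| < d] by exact: nbhs_dist_lt d0 (fun _ h => h).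
move=> /(param_near Fp' cu'); apply: filterS => y h /h[t [td ct] ty].
by exists t; [exact: td|split; [rewrite u'0; exact: ct.2|exact: ty]].
Qed.

End Interior.

(** * The sides of a surface *)

Section Nearest.
Context {R : realType}.
Implicit Types (F : set 'rV[R]_4) (z y a v w n : 'rV[R]_4) (J : 'M[R]_(2, 4)).

Lemma frame_col a v J : frame a J v = col_mx a (col_mx J v) :> 'M[R]_(1 + (2 + 1), 4).
Proof.
apply/matrixP => i j; case: (@split_ordP 1 (2 + 1) i) => k ->.
  by rewrite col_mxEu mxE ord1.
rewrite col_mxEd; case: (@split_ordP 2 1 k) => l ->.
  by rewrite col_mxEu mxE; have [->|->] := ord2_cases l; rewrite /= mxE.
by rewrite col_mxEd mxE ord1.
Qed.

Lemma det_frame_mul a v (A : 'M[R]_2) J : \det (frame a (A *m J) v) = \det A * \det (frame a J v).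
Proof.
pose B : 'M[R]_(1 + (2 + 1)) := block_mx 1%:M 0 0 (block_mx A 0 0 1%:M).
have dB : \det B = \det A by rewrite !det_ublock !det1 mul1r mulr1.
have e : frame a (A *m J) v = B *m (frame a J v : 'M[R]_(1 + (2 + 1), 4)).
  by rewrite !frame_col !mul_block_col !mul0mx !mul1mx !addr0 !add0r.
by rewrite e -dB; exact: (@det_mulmx _ 4 B (frame a J v)).
Qed.

Lemma row_jacobian (f : 'rV[R]_2 -> 'rV[R]_4) u i : differentiable f u ->
  row i ('J f u) = 'D_(delta_mx 0 i) f u.
Proof. by move=> df; rewrite rowE -deriveEjacobian. Qed.

Lemma le_norm_sub (a b a' b' : 'rV[R]_4) (c : R) : a = a' -> b = b' -> `|a' - b'| < c -> `|a - b| <= c.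
Proof. by move=> -> -> /ltW. Qed.

Lemma conormal_sign (B : 'M[R]_2) J J' a z n (c : R) : 0 < \det B -> J' = B *m J -> 0 < c -> z != a ->
  c * `|z - a| <= `|dot (z - a) n| -> `|dot (z - a) (conormal a J) - dot (z - a) n| <= c / 2 * `|z - a| ->
  (0 < dot z (conormal a J')) = (0 < dot (z - a) n).
Proof.
move=> B0 -> c0 za; rewrite -(det_frame a (B *m J) z) det_frame_mul pmulr_rgt0 // det_frame.
have -> : dot z (conormal a J) = dot (z - a) (conormal a J) by rewrite dotBl dot_normal subr0.
have D' : 0 < `|z - a| by rewrite normr_gt0 subr_eq0.
have : 0 < c * `|z - a| by rewrite mulr_gt0.
move: (dot _ n) (dot _ (conormal _ _)) (`|_ - _|) => s t D1.
move=> h2 h1; rewrite ler_norml => /andP[h3 h4].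
case: (ltrgt0P s) h1 => hs h1.
- by lra.
- by apply/negbTE; rewrite -leNgt; lra.
- by lra.
Qed.

Definition nearest F z y := F y /\ forall y', F y' -> sqnorm (z - y) <= sqnorm (z - y').

Lemma nearest_exists F z : compact F -> F !=set0 -> exists y, nearest F z y.
Proof.
move=> cF F0; have [|y] := compact_EVT_min F0 cF (f := fun y => sqnorm (z - y)).
  apply: continuous_subspaceT => y; have cs := @sqnorm_continuous R 4.
  have c1 : continuous_at y (fun y => sqnorm (z - y)) by cont.
  exact: c1.
by rewrite inE => Fy h; exists y; split => // y' Fy'; apply: h; rewrite inE.
Qed.

(** Nearest refers to the Euclidean norm; in R^4 it exceeds the sup norm by a factor of at most
    2. *)
Lemma nearest_le F z y y' : nearest F z y -> F y' -> `|z - y| <= 2 * `|z - y'|.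
Proof.
move=> [_ h] /h zy; rewrite -(@ler_sqr R) ?nnegrE ?mulr_ge0 //.
apply: le_trans (norm_le_sqnorm _) (le_trans zy _).
by apply: le_trans (sqnorm_le_norm _) _; rewrite exprMn -natrX.
Qed.

Lemma nearest_orthogonal F p u z i : is_param F p -> chart_dom p u -> 0 < u 0 ord_max ->
  nearest F z (pmap p u) -> dot (z - pmap p u) (row i (pjac p u)) = 0.
Proof.
move=> Fp cu u0 [_ h]; have sf := param_strict_diff Fp cu.
have crit (v : 'rV[R]_2) : dot (z - pmap p u) (v *m pjac p u) <= 0.
  apply: (critical_point sf); have [d d0 hd] := chart_line (v := v) Fp cu (or_introl u0).
  by exists d => // k kd; apply: h; have := param_in Fp (hd k kd).
rewrite rowE; apply/eqP; rewrite eq_le crit /=.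
by have := crit (- delta_mx 0 i); rewrite mulNmx dotNr oppr_le0.
Qed.

Lemma dot_perturb w n0 n (c : R) : `|n0 - n| <= c / 8 -> `|dot w n - dot w n0| <= c / 2 * `|w|.
Proof.
move=> h; rewrite -dotBr; apply: le_trans (dot_le4 _ _) _.
have : `|w| * `|n - n0| <= `|w| * (c / 8) by rewrite distrC ler_wpM2l.
lra.
Qed.

(** Of the four products of [w] with the frame, three are at most c / 2 times its norm, so the lower
    bound is carried by the product with [n]. *)
Lemma transverse_bound a J0 J n w (c : R) : 0 < c ->
  (forall v, c * `|v| <= `|v *m (frame a J0 n)^T|) -> `|dot w a| <= c / 2 * `|w| ->
  (forall i, dot w (row i J) = 0) -> (forall i, `|row i J0 - row i J| <= c / 8) ->
  c * `|w| <= `|dot w n|.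
Proof.
move=> c0 hc wa orth JJ; have w0 : 0 <= `|w| by [].
have bJ i : `|dot w (row i J0)| <= c / 2 * `|w|.
  have -> : dot w (row i J0) = dot w (row i J0 - row i J) by rewrite dotBr orth subr0.
  apply: le_trans (dot_le4 _ _) _; have h : `|w| * `|row i J0 - row i J| <= `|w| * (c / 8).
    by apply: ler_wpM2l => //; exact: JJ.
  lra.
rewrite leNgt; apply/negP => lt1; have := hc w; apply/negP; rewrite -ltNge.
have wp : 0 < `|w| by rewrite lt0r w0 andbT; apply/eqP => e0; move: lt1; rewrite e0 mulr0 ltNge normr_ge0.
apply: (@le_lt_trans _ _ (Num.max `|dot w n| (c / 2 * `|w|))).
  apply: norm_le_coord => [|k]; first by rewrite le_max normr_ge0.
  have -> : (w *m (frame a J0 n)^T) 0 k = dot w (row k (frame a J0 n)).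
    by rewrite mxE; apply: eq_bigr => j _; rewrite !mxE.
  rewrite row_frame le_max; case: k => [[|[|[|[|k]]]] hk] //=; rewrite ?wa ?bJ ?orbT //.
  by rewrite lexx.
rewrite gt_max lt1 /=; have : 0 < c * `|w| by rewrite mulr_gt0.
lra.
Qed.

(* z - y is orthogonal to the surface at y, and almost orthogonal to y because both points lie on
   the unit sphere; hence it is almost parallel to the normal. *)
Lemma nearest_transverse F p u0 : F `<=` sphere3 -> is_param F p -> chart_dom p u0 ->
  0 < u0 0 ord_max ->
  exists c r : R, [/\ 0 < c, 0 < r & forall z y, `|pmap p u0 - z| < r -> sphere3 z -> nearest F z y ->
    c * `|z - y| <= `|dot (z - y) (pnormal p u0)| /\
    exists u, [/\ chart_dom p u, pmap p u = y &
      `|dot (z - y) (pnormal p u) -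
        dot (z - y) (pnormal p u0)| <= c / 2 * `|z - y|]].
Proof.
move=> FS Fp cu up; have [[od sf] _ _ _] := Fp.
have fr := param_frame FS Fp cu; have xin := param_in Fp cu.
have df u : dom p u -> differentiable (pmap p) u by exact: smooth_differentiable.
set x := pmap p u0 in fr xin *; set J0 := pjac p u0 in fr *.
set n0 := conormal x J0 in fr *.
have frT : row_free (frame x J0 n0)^T by rewrite row_free_unit unitmx_tr -row_free_unit.
have [c c0 hc] := row_free_bound frT.
have c8 : 0 < c / 8 by rewrite divr_gt0.
pose N u := [/\ chart_dom p u -> 0 < u 0 ord_max,
  chart_dom p u -> forall i, `|row i J0 - row i (pjac p u)| <= c / 8 &
  chart_dom p u -> `|n0 - pnormal p u| <= c / 8].
have NN : nbhs u0 N.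
  have N1 : nbhs u0 [set u | 0 < u 0 ord_max].
    exact: (@coord_cont R 2 ord_max u0 [set t | 0 < t] (lt_nbhsr up)).
  have N2 i : nbhs u0 [set u | `|'D_(delta_mx 0 i) (pmap p) u0 - 'D_(delta_mx 0 i) (pmap p) u| < c / 8].
    have ci : continuous_at u0 ('D_(delta_mx 0 i) (pmap p)).
      apply: differentiable_continuous; apply: smooth_differentiable cu.1; exact: smooth_derive.
    exact: near_dist ci c8.
  have N3 : nbhs u0 [set u | `|conormal (pmap p u0) (partials (pmap p) u0) -
      conormal (pmap p u) (partials (pmap p) u)| < c / 8].
    have [d d0 hd] := lip_continuous (lip_normal od sf cu.1).
    have /hd cn : `|u0 - u0| < d by rewrite subrr normr0.
    exact: near_dist cn c8.
  apply: filterS (filterI N1 (filterI (filterI (N2 ord0) (N2 ord_max)) N3)) => u [h1 [[h2 h3] h4]].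
  split => // -[du _]; last by move: h4; rewrite /= !partialsE; [move/ltW|exact: df|exact/df/cu.1].
  move=> i; apply: (le_norm_sub (row_jacobian i (df _ cu.1)) (row_jacobian i (df _ du))).
  by have [e'|e'] := ord2_cases i; rewrite e'; [exact: h2|exact: h3].
have /nbhs_normP[r1 /= r10 hr1] := param_near Fp cu NN.
(* A nearest point of [z] is within 3 r of [x]. The two errors in [dot w x] are at most 4 r and 12 r
   times the norm of [w], and 16 r is at most c / 2. *)
pose r := Num.min (r1 / 3) (c / 32).
have r0 : 0 < r by rewrite lt_min !divr_gt0.
have [rr1 rc] : r <= r1 / 3 /\ r <= c / 32 by rewrite /r !ge_min !lexx orbT.
exists c, r; split => // z y xz zS zy; have [Fy _] := zy.
have zyx := nearest_le zy xin; rewrite [`|z - x|]distrC in zyx.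
have xy : `|x - y| <= `|x - z| + `|z - y| by have := ler_normD (x - z) (z - y); rewrite addrA subrK.
have xy1 : `|x - y| < r1 by lra.
have [u [[Nu0 NuJ Nun] cu'] uy] := hr1 y xy1 Fy.
have {}Nu0 := Nu0 cu'; have {}NuJ := NuJ cu'; have {}Nun := Nun cu'.
have orth i : dot (z - y) (row i (pjac p u)) = 0.
  by have := nearest_orthogonal i Fp cu' Nu0; rewrite uy; apply.
set w := z - y; have w0 : 0 <= `|w| by [].
have bx : `|dot w x| <= c / 2 * `|w|.
  have e1 : dot w y = - (sqnorm w / 2).
    have := sqnormD w y; rewrite /w subrK zS (FS y Fy); lra.
  have e2 : dot w x = dot w y + dot w (x - y) by rewrite -dotDr addrC subrK.
  have h1 := dot_le4 w (x - y); have h2 := sqnorm_le_norm w; have h3 := sqnorm_ge0 w.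
  have h4 : `|w| * `|x - y| <= `|w| * (3 * r) by rewrite ler_wpM2l //; lra.
  have h5 : `|w| ^+ 2 <= `|w| * (2 * r) by rewrite expr2 ler_wpM2l // /w; lra.
  have h6 : `|w| * r <= `|w| * (c / 32) by rewrite ler_wpM2l.
  apply: le_trans (_ : sqnorm w / 2 + `|dot w (x - y)| <= _).
    by rewrite e2 e1; apply: le_trans (ler_normD _ _) _; rewrite normrN ger0_norm // divr_ge0.
  lra.
split; first exact: transverse_bound c0 hc bx orth NuJ.
by exists u; split; [exact: cu'|exact: uy|exact: dot_perturb Nun].
Qed.

End Nearest.

Section Side.
Context {R : realType} {F : set 'rV[R]_4} {A : set (@param R)}.
Hypotheses (FS : F `<=` sphere3) (Fc : compact F) (FA : is_atlas F A).
Hypothesis compat : forall p q, A p -> A q -> positively_compatible p q.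
Implicit Types z y : 'rV[R]_4.

(** The conormal at [y] is orthogonal to [y], so its product with [z] is the product with the
    displacement [z - y]. Nearest points need not be unique, and the choice matters in general; it
    ceases to matter close to an interior point. *)
Definition side z := exists y p u,
  [/\ nearest F z y, A p, chart_dom p u, pmap p u = y &
      0 < dot z (pnormal p u)].

(** Near an interior point the side is decided by one fixed normal, for every nearest point and
    every chart of the atlas. Moving [z] by a small multiple of its distance to [F] preserves it,
    which makes the side locally constant off [F]. *)
Lemma side_local p u0 : A p -> chart_dom p u0 -> 0 < u0 0 ord_max ->
  exists2 r : R, 0 < r & forall z y z', `|pmap p u0 - z| < r -> `|pmap p u0 - z'| < r ->
    sphere3 z -> sphere3 z' -> nearest F z y -> z != y -> `|z - z'| < r * `|z - y| ->
    side z' <-> 0 < dot (z - y) (pnormal p u0).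
Proof.
move=> Ap cu up; have Fp := FA.1 _ Ap.
have [c [r1 [c0 r10 hr1]]] := nearest_transverse FS Fp cu up.
have [d d0 hd] := param_flat Fp cu (divr_gt0 c0 (ltr0n R 24)).
have xin := param_in Fp cu.
set x := pmap p u0 in hr1 hd xin *; set n0 := conormal _ _ in hr1 hd *.
have n1 : 0 < `|n0| + 1 by rewrite ltr_wpDl.
(* As r is at most 1, nearest points of [z] and [z'] differ by at most six times the norm of
   [z - y]. The two error terms below are then each at most c / 4 times that norm, less than the
   product with the normal, which is at least c times it. *)
pose r := Num.min (Num.min r1 (d / 3)) (Num.min 1 (c / (16 * (`|n0| + 1)))).
have r0 : 0 < r by rewrite !lt_min r10 ltr01 !divr_gt0 // mulr_gt0.
have [rr1 rd r_1 rc] : [/\ r <= r1, r <= d / 3, r <= 1 & r <= c / (16 * (`|n0| + 1))].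
  by rewrite /r !ge_min !lexx !orbT.
have close z y : `|x - z| < r -> nearest F z y -> `|x - y| < d.
  move=> xz zy; have := nearest_le zy xin; rewrite [`|z - x|]distrC.
  by have := ler_normD (x - z) (z - y); rewrite addrA subrK; lra.
exists r => // z y z' xz xz' zS zS' zy zny zz'.
have D0 : 0 < `|z - y| by rewrite normr_gt0 subr_eq0.
have [lb _] := hr1 z y (lt_le_trans xz rr1) zS zy.
have key y' : nearest F z' y' -> (0 < dot (z' - y') n0) = (0 < dot (z - y) n0) /\ z' != y'.
  move=> zy'.
  have h1 : `|z' - y'| <= 2 * `|z' - y| by apply: nearest_le zy' _; case: zy.
  have h2 : `|z' - y| <= `|z - z'| + `|z - y|.
    by have := ler_normD (z' - z) (z - y); rewrite addrA subrK [`|z' - z|]distrC.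
  have h3 : `|y - y'| <= `|z - y| + `|z - z'| + `|z' - y'|.
    have -> : y - y' = - (z - y) + (z - z') + (z' - y') by apply/rowP => k; rewrite !mxE; ring.
    have := ler_normD (- (z - y) + (z - z')) (z' - y').
    by have := ler_normD (- (z - y)) (z - z'); rewrite normrN; lra.
  have h4 : r * `|z - y| <= 1 * `|z - y| by rewrite ler_pM2r.
  have h5 := hd y y' zy.1 zy'.1 (close z y xz zy) (close z' y' xz' zy').
  have h6 : c / 24 * `|y - y'| <= c / 24 * (6 * `|z - y|).
    by rewrite ler_pM2l ?divr_gt0 //; lra.
  have h7 := dot_le4 (z' - z) n0; rewrite [`|z' - z|]distrC in h7.
  have h8 : `|z - z'| * `|n0| <= (r * `|z - y|) * (`|n0| + 1).
    by apply: ler_pM => //; [exact: ltW|rewrite lerDl].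
  have h9 : (r * (`|n0| + 1)) * `|z - y| <= c / 16 * `|z - y|.
    by rewrite ler_pM2r //; move: rc; rewrite ler_pdivlMr ?mulr_gt0 //; lra.
  have e : dot (z' - y') n0 = dot (z - y) n0 + dot (z' - z) n0 + dot (y - y') n0.
    by rewrite -!dotDl; congr (dot _ _); apply/rowP => k; rewrite !mxE; ring.
  have small : `|dot (z' - z) n0 + dot (y - y') n0| < `|dot (z - y) n0|.
    have := ler_normD (dot (z' - z) n0) (dot (y - y') n0).
    have : 0 < c * `|z - y| by rewrite mulr_gt0.
    by lra.
  rewrite e -addrA; split.
    move: small; move: (dot (z - y) n0) (dot _ n0 + _) => s t.
    case: (ltrgt0P s) => hs; rewrite ?normr0; last by rewrite ltNge normr_ge0.
    - by rewrite ltr_norml => /andP[? ?]; lra.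
    - by rewrite ltr_norml => /andP[? ?]; apply/negbTE; rewrite -leNgt; lra.
  apply: contraTneq small => ezy; move: e; rewrite ezy subrr dot0l -addrA => /eqP.
  by rewrite eq_sym addr_eq0 => /eqP ->; rewrite normrN ltxx.
have chart y' : nearest F z' y' -> forall p' u', A p' -> chart_dom p' u' -> pmap p' u' = y' ->
    (0 < dot z' (pnormal p' u')) = (0 < dot (z - y) n0).
  move=> zy' p' u' Ap' cu' uy'; have [e1 zny'] := key y' zy'; apply: etrans e1.
  have [lb' [u [cu1 uy ub]]] := hr1 z' y' (lt_le_trans xz' rr1) zS' zy'.
  have [B B0 eB] := compat Ap' Ap cu' cu1 (etrans uy' (esym uy)).
  rewrite uy'; move: ub; rewrite uy; exact: conormal_sign B0 eB c0 zny' lb'.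
split.
  by move=> [y' [p' [u' [zy' Ap' cu' uy' h]]]]; rewrite -(chart y' zy' p' u' Ap' cu' uy').
move=> pos; have [y' zy'] := nearest_exists z' Fc (ex_intro _ _ xin).
have [p' Ap' [u' cu' uy']] : (\bigcup_(q in A) (pmap q @` chart_dom q)) y' by rewrite -FA.2; case: zy'.
exists y', p', u'; split; [exact: zy'|exact: Ap'|exact: cu'|exact: uy'|].
by rewrite (chart y' zy' p' u' Ap' cu' uy').
Qed.

End Side.

(** * Crossing a surface *)

Section Radial.
Context {R : realType}.
Implicit Types (x n : 'rV[R]_4) (t : R).

(** Since [x] is orthogonal to [n1], projecting back to the sphere only divides the product with
    [n1] by the radius; so it keeps the sign of [t] and grows linearly. *)
Lemma radial_crossing x n0 n1 : sphere3 x -> dot x n1 = 0 -> 0 < dot n0 n1 ->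
  exists k d : R, [/\ 0 < k, 0 < d & forall t, 0 < `|t| < d -> let z := rho (x + t *: n0) in
    [/\ sphere3 z, k * `|z - x| < `|dot (z - x) n1|, (0 < dot (z - x) n1) = (0 < t) & `|z - x| < d^-1 * `|t|]].
Proof.
move=> xS xn n01; set b := dot n0 n1 in n01 *.
(* [C - 1] bounds the speed of the curve, and d = 1 / (2 C) keeps the squared radius within 1 / 2 of
   1. *)
pose C := `|n0| + 2 * `|dot x n0| + sqnorm n0 + 1.
have C1 : 1 <= C by rewrite /C lerDr addr_ge0 ?sqnorm_ge0 // addr_ge0 // mulr_ge0.
have C0 : 0 < C by lra.
pose d := (2 * C)^-1; have d0 : 0 < d by rewrite invr_gt0 mulr_gt0.
have dC : d * C = 1 / 2 by rewrite /d; field; rewrite gt_eqF.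
exists (b / (4 * C)), d; split => //; first by rewrite divr_gt0 // mulr_gt0.
move=> t /andP[t0 td] z; pose g := x + t *: n0; pose l := Num.sqrt (sqnorm g).
have t1 : `|t| <= 1 by nra.
have s1 : sqnorm g = 1 + 2 * (t * dot x n0) + t ^+ 2 * sqnorm n0.
  by rewrite /g sqnormD dotZr sqnormZ xS.
have h0 : 0 <= sqnorm n0 := sqnorm_ge0 n0.
have s2 : `|sqnorm g - 1| <= `|t| * (2 * `|dot x n0| + sqnorm n0).
  have -> : sqnorm g - 1 = 2 * (t * dot x n0) + t ^+ 2 * sqnorm n0 by rewrite s1; ring.
  apply: le_trans (ler_normD _ _) _; rewrite !normrM normr_nat mulrDr; apply: lerD.
    by rewrite mulrCA.
  rewrite (ger0_norm h0) ler_wpM2r // -[leRHS]mulr1.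
  by rewrite ler_wpM2l.
have s3 : `|sqnorm g - 1| <= `|t| * C.
  apply: le_trans s2 _; rewrite ler_wpM2l // /C; have : 0 <= `|n0| by []; lra.
have s4 : `|t| * C < 1 / 2 by rewrite -dC ltr_pM2r.
have g0 : g != 0.
  rewrite -sqnorm_gt0; move: (le_lt_trans s3 s4); rewrite ltr_norml => /andP[? ?]; lra.
have l0 : 0 < l := sqrt_sqnorm_gt0 g0.
have ll : l ^+ 2 = sqnorm g by rewrite sqr_sqrtr // sqnorm_ge0.
have lz : g = l *: z by rewrite /z /l rhoK.
have l1 : `|l - 1| <= `|t| * (2 * `|dot x n0| + sqnorm n0).
  apply: le_trans s2; rewrite -ll.
  have -> : l ^+ 2 - 1 = (l - 1) * (l + 1) by ring.
  rewrite normrM [`|l + 1|]gtr0_norm; last by lra.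
  have : 0 <= `|l - 1| by []; move: (`|l - 1|) => s; nra.
have zS : sphere3 z by exact: sqnorm_rho.
have z1 : `|z| <= 1.
  rewrite -(@ler_sqr R) ?nnegrE // expr1n; apply: le_trans (norm_le_sqnorm z) _.
  by rewrite zS.
have zx : `|z - x| <= `|t| * (C - 1).
  have -> : z - x = (1 - l) *: z + t *: n0.
    by rewrite scalerBl scale1r -lz /g; apply/rowP => k; rewrite !mxE; ring.
  apply: le_trans (ler_normD _ _) _; rewrite (normrZ (1 - l) z) (normrZ t n0) distrC; move: z zS z1 lz => z _ z1 _.
  have : `|l - 1| * `|z| <= `|l - 1| * 1 by rewrite ler_wpM2l.
  rewrite /C; lra.
have e : l * dot (z - x) n1 = t * b by rewrite dotBl xn subr0 -dotZl -lz /g dotDl xn add0r dotZl.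
have l2 : l < 2.
  have : l ^+ 2 < 2 ^+ 2.
    by rewrite ll; move: (le_lt_trans s3 s4); rewrite ltr_norml => /andP[? ?]; lra.
  by rewrite ltr_sqr ?nnegrE // ltW.
split => //.
- have e' : l * `|dot (z - x) n1| = `|t| * b.
    by rewrite -{1}(gtr0_norm l0) -normrM e normrM (gtr0_norm n01).
  have h1 : `|t| * b < 2 * `|dot (z - x) n1|.
    rewrite -e' ltr_pM2r // normr_gt0; apply/eqP => e0.
    by move: e'; rewrite e0 normr0 mulr0 => /esym/eqP; rewrite mulf_eq0 (gt_eqF n01) (gt_eqF t0).
  have h2 : b / (4 * C) * `|z - x| <= b / (4 * C) * (`|t| * C).
    by rewrite ler_pM2l ?divr_gt0 ?mulr_gt0 //; apply: le_trans zx _; rewrite ler_wpM2l //; lra.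
  have h3 : b / (4 * C) * (`|t| * C) = `|t| * b / 4 by field; rewrite gt_eqF.
  have : 0 < `|t| * b by rewrite mulr_gt0.
  lra.
- by rewrite -(pmulr_rgt0 _ l0) e pmulr_lgt0.
- rewrite /d invrK; apply: le_lt_trans zx _; rewrite mulrC ltr_pM2r //; lra.
Qed.

End Radial.

Section Meridian.
Context {R : realType} {F : set 'rV[R]_4} {A : set (@param R)}.
Hypotheses (FS : F `<=` sphere3) (Fc : compact F) (FA : is_atlas F A).
Hypothesis compat : forall p q, A p -> A q -> positively_compatible p q.
Implicit Types (z y n : 'rV[R]_4) (p : @param R).

Lemma boundary_sub : surface_boundary F `<=` F.
Proof. by move=> y [p Fp [u [cu _] <-]]; exact (param_in Fp cu). Qed.

Lemma interior_chart x : F x -> ~ surface_boundary F x -> exists p u,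
  [/\ A p, chart_dom p u, 0 < u 0 ord_max & pmap p u = x].
Proof.
move=> Fx bx; have [p Ap [u cu ux]] : (\bigcup_(q in A) (pmap q @` chart_dom q)) x by rewrite -FA.2.
exists p, u; split => //; rewrite lt0r [X in _ && X](cu.2) andbT; apply/eqP => u0; apply: bx.
by exists p; [exact: FA.1|exists u].
Qed.

Lemma normals_parallel a J n n1 : row_free (frame a J n) ->
  dot a n = 0 -> (forall i, dot (row i J) n = 0) -> dot a n1 = 0 -> (forall i, dot (row i J) n1 = 0) ->
  n1 != 0 -> exists2 k : R, k != 0 & n1 = k *: n.
Proof.
move=> fr an Jn an1 Jn1 n10.
have : (n1 <= frame a J n)%MS by rewrite submx_full // row_full_unit -row_free_unit.
case/submxP => w; rewrite mulmx_frame; set v := \row_j _ => e; exists (w 0 ord_max).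
  apply: contraNneq n10 => w0; rewrite -sqnorm_eq0 sqnormE {1}e w0 scale0r addr0.
  by rewrite dotDl dotZl an1 (dot_mulmx _ Jn1) mulr0 addr0.
apply/eqP; rewrite -subr_eq0 -sqnorm_eq0 sqnormE.
have {1}-> : n1 - w 0 ord_max *: n = w 0 0 *: a + v *m J by rewrite {1}e addrK.
rewrite dotDl dotZl !dotBr !dotZr an an1 (dot_mulmx _ Jn) (dot_mulmx _ Jn1).
by rewrite !mulr0 subr0 mulr0 addr0.
Qed.

(* s tells whether n0 points to the positive side of F. *)
Lemma side_crossing p u n0 : is_param F p -> chart_dom p u -> 0 < u 0 ord_max ->
  0 < dot n0 (pnormal p u) ->
  exists (s : bool) (d : R), 0 < d /\ forall t, 0 < `|t| < d -> ~ F (rho (pmap p u + t *: n0)) ->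
    side (F := F) (A := A) (rho (pmap p u + t *: n0)) <-> (0 < t) = s.
Proof.
move=> Fp cu up n01; have xF := param_in Fp cu.
have xb : ~ surface_boundary F (pmap p u).
  by move=> [p' Fp' [u' [cu' u'0] e]]; have := edge_invariance FS Fp Fp' cu up cu' (esym e); rewrite u'0 ltxx.
have [q [v [Aq cv vp vx]]] := interior_chart xF xb; have Fq := FA.1 _ Aq.
have [r r0 hr] := side_local FS Fc FA compat Aq cv vp.
have orth i : dot (row i (pjac q v)) (pnormal p u) = 0.
  rewrite rowE; have [d d0 hd] := chart_line (v := delta_mx 0 i) Fq cv (or_introl vp).
  apply: (tangent_coincide FS Fp cu (param_strict_diff Fq cv) vx _).1.
  by exists d; [exact: d0|move=> h hh; have := param_in Fq (hd h hh)].
have flatp := param_flat Fp cu.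
have xn := dot_normal (pmap p u) (pjac p u).
have fr := param_frame FS Fq cv; rewrite vx in fr hr.
have qa : dot (pmap p u) (conormal (pmap p u) (pjac q v)) = 0 by exact: dot_normal.
have qJ i : dot (row i (pjac q v)) (conormal (pmap p u) (pjac q v)) = 0 by exact: dot_row_normal.
move: (pnormal p u) n01 orth flatp xn => n1 n01 orth flatp xn.
move: (conormal (pmap p u) (pjac q v)) hr fr qa qJ => n2 hr fr qa qJ.
have xS := FS xF.
have nF : F !=set0 by exists (pmap p u).
clear vx cu; move: (pmap p u) => x in xF xb hr fr qa xn flatp xS *.
move: ('J _ v) => J in fr qJ orth *.
have n10 : n1 != 0 by apply: contraTneq n01 => ->; rewrite dotC dot0l ltxx.
(* The chart [p] need not belong to the oriented atlas, so its normal may point to the negative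
   side; the sign of [k] is the required boolean. *)
have [k k0 n1E] := normals_parallel fr qa qJ xn orth n10.
have [a [d1 [a0 d10 hd1]]] := radial_crossing xS xn n01.
have [d2 d20 hd2] := flatp (a / 4) (divr_gt0 a0 (ltr0n R 4)).
pose d := Num.min d1 (d1 * Num.min r (d2 / 3)).
have d0 : 0 < d by rewrite lt_min d10 mulr_gt0 // lt_min r0 divr_gt0.
exists (0 < k), d; split => // t /andP[t0]; rewrite lt_min => /andP[td1 td2].
have [|zS za zt zx] := hd1 t; first by rewrite t0.
move: (rho _) zS za zt zx => z zS za zt zx zF.
have zx' : `|x - z| < Num.min r (d2 / 3).
  rewrite distrC; apply: lt_trans zx _; rewrite mulrC ltr_pdivrMr // mulrC; exact: td2.
have [xzr xzd] : `|x - z| < r /\ `|x - z| < d2 / 3 by move: zx'; rewrite lt_min => /andP.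
have [y zy] := nearest_exists z Fc nF.
have zny : z != y by apply: contra_notN zF => /eqP ->; case: zy.
have zy2 := nearest_le zy xF; rewrite (distrC z x) in zy2.
have xy : `|x - y| <= 3 * `|x - z|.
  by have := ler_normD (x - z) (z - y); rewrite addrA subrK; lra.
have fl := hd2 x y xF (proj1 zy); rewrite subrr normr0 in fl; have {fl} := fl d20.
have xyd : `|x - y| < d2 by lra.
move=> /(_ xyd) fl.
have D0 : 0 < `|z - y| by rewrite normr_gt0 subr_eq0.
have Dr : `|z - z| < r * `|z - y| by rewrite subrr normr0 mulr_gt0.
have -> : side (F := F) (A := A) z <-> 0 < dot (z - y) n2 by exact (hr z y z xzr xzr zS zS zy zny Dr).
have e1 : k * dot (z - y) n2 = dot (z - x) n1 + dot (x - y) n1.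
  by rewrite -dotDl addrA subrK n1E dotZr.
(* The foot [y] is at most three times as far from [x] as [z] is, and flatness was taken with a / 4:
   the tangential error costs 3 a / 4, less than the transverse part. *)
have fl2 : `|dot (x - y) n1| < `|dot (z - x) n1|.
  apply: le_lt_trans fl _; apply: le_lt_trans za; rewrite (distrC z x).
  have : a * `|x - y| <= a * (3 * `|x - z|) by rewrite ler_pM2l.
  have : 0 <= a * `|x - z| by rewrite mulr_ge0 // ltW.
  lra.
have sg : (0 < k * dot (z - y) n2) = (0 < t) /\ k * dot (z - y) n2 != 0.
  rewrite e1 -zt; move: fl2; move: (dot (z - x) n1) (dot _ n1) => s s'.
  rewrite ltr_norml; case: (ltrgt0P s) => hs /andP[h1 h2]; clear - hs h1 h2.
  - by split; [lra|rewrite gt_eqF //; lra].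
  - by split; [apply/negbTE; rewrite -leNgt; lra|rewrite lt_eqF //; lra].
  - by lra.
have [<- nz] := sg; case: (ltrgt0P k) k0 nz => // hk _ nz.
- by rewrite pmulr_rgt0 //; split => [->|].
- rewrite nmulr_rgt0 //; split => [h|]; first by apply/negbTE; rewrite -leNgt ltW.
  move=> /negbT; rewrite -leNgt le_eqVlt => /orP[/eqP h|//].
  by move: nz; rewrite -h mulr0 eqxx.
Qed.

End Meridian.

Lemma nbhs_dist_ex {R : realType} (V : normedModType R) (x : V) (P : set V) : nbhs x P ->
  exists2 d : R, 0 < d & forall y, `|x - y| < d -> P y.
Proof. by move=> /nbhs_normP[d /= d0 h]; exists d. Qed.

Section Crossing.
Context {R : realType} {n : nat} {F : 'I_n -> set 'rV[R]_4} {A : 'I_n -> set (@param R)}.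
Hypotheses (FS : forall i, F i `<=` sphere3) (Fc : forall i, compact (F i)).
Hypothesis FA : forall i, is_atlas (F i) (A i).
Hypothesis compat : forall i p q, A i p -> A i q -> positively_compatible p q.
Hypothesis Fdisj : trivIset setT F.
Implicit Types x y z : 'rV[R]_4.

Local Notation sideF i := (side (F := F i) (A := A i)).
Definition off_boundary : set 'rV[R]_4 := sphere3 `\` \bigcup_i surface_boundary (F i).
Local Notation X := off_boundary.

(* Leaving F i towards its positive side multiplies the transport by s i. *)
Definition crossing (gT : finGroupType) (s : 'I_n -> gT) x z : gT :=
  if [pick i | `[< F i x /\ ~ F i z /\ sideF i z >]] is Some i then s i else 1%g.

Let same i j x : F i x -> F j x -> i = j.
Proof. by move=> Fi Fj; apply: Fdisj => //; exists x. Qed.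

Lemma crossing_in (gT : finGroupType) (s : 'I_n -> gT) i x z : F i x ->
  crossing s x z = if `[< ~ F i z /\ sideF i z >] then s i else 1%g.
Proof.
move=> Fx; rewrite /crossing; case: pickP => [j /asboolP[Fj [h1 h2]]|h].
  by rewrite -(same Fx Fj) in h1 h2 *; rewrite asboolT.
by case: asboolP => // h1; have /asboolP[] := h i.
Qed.

Lemma crossing_out (gT : finGroupType) (s : 'I_n -> gT) x z : (forall i, ~ F i x) -> crossing s x z = 1%g.
Proof. by move=> Fx; rewrite /crossing; case: pickP => // i /asboolP[/Fx]. Qed.

Lemma surface_off_near i x : ~ F i x -> \forall y \near x, ~ F i y.
Proof.
move=> Fx; have := compact_closed (@norm_hausdorff _ _) (Fc (i := i)).
by rewrite -openC => oF; exact: (open_nbhs_nbhs (conj oF Fx)).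
Qed.

Lemma surfaces_off_near x : \forall y \near x, forall i, ~ F i x -> ~ F i y.
Proof.
apply: (@filter_forall _ _ _ (nbhs x)) => i; have [Fx|Fx] := pselect (F i x); first exact: (@filterE _ (nbhs x)).
by have := surface_off_near Fx; apply: filterS => y h _.
Qed.

(** Near an interior point of a surface there are two cases. If the nearby point [y] is on the
    surface, the transports from both points obey the same rule; if it is off, transports from it
    are trivial and the side is constant around it. *)
Lemma flat_crossing (gT : finGroupType) (s : 'I_n -> gT) : flat X (crossing s).
Proof.
move=> x [xS xb]; have [[i Fx]|nF] := pselect (exists i, F i x); last first.
  have : \forall y \near x, forall i, ~ F i y.
    by have := surfaces_off_near x; apply: filterS => y h i; apply: h => Fx; apply: nF; exists i.
  apply: filterS => y Fy Xy; apply: (@filterE _ (nbhs y)) => z Xz.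
  rewrite !(crossing_out _ _ Fy) !crossing_out ?invg1 ?mulg1 //.
  - by move=> i Fx; apply: nF; exists i.
  - by move=> i Fx; apply: nF; exists i.
have xb' : ~ surface_boundary (F i) x by move=> bx; apply: xb; exists i.
have [p [u [Ap cu up ux]]] := interior_chart (FA i) Fx xb'.
have [r r0 hr] := side_local (FS (i := i)) (Fc (i := i)) (FA i) (@compat i) Ap cu up.
rewrite ux in hr.
have N1 : \forall y \near x, `|x - y| < r by exact: nbhs_dist_lt r0 (fun _ h => h).
apply: filterS (filterI N1 (surfaces_off_near x)) => y [xy off] [yS _].
have [Fy|Fy] := pselect (F i y).
  apply: (@filterE _ (nbhs y)) => z _; rewrite !(crossing_in _ _ Fx) (crossing_in _ _ Fy).
  by rewrite [`[< ~ F i y /\ _ >]]asboolF ?invg1 ?mul1g // => -[].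
have Fy' j : ~ F j y.
  have [<-//|ij] := eqVneq i j; apply: off => Fj; by rewrite (same Fx Fj) eqxx in ij.
have nF : F i !=set0 by exists x.
have [y0 yy0] := nearest_exists y (Fc (i := i)) nF.
have yny0 : y != y0 by apply: contra_notN Fy => /eqP ->; case: yy0.
have D0 : 0 < `|y - y0| by rewrite normr_gt0 subr_eq0.
have N2 : \forall z \near y, `|y - z| < r * `|y - y0|.
  exact: nbhs_dist_lt (mulr_gt0 r0 D0) (fun _ h => h).
have N3 : \forall z \near y, `|x - z| < r.
  apply: nbhs_dist_lt (_ : 0 < r - `|x - y|) _; first by rewrite subr_gt0.
  by move=> z yz; have := ler_normD (x - y) (y - z); rewrite addrA subrK; lra.
apply: filterS (filterI (filterI N2 N3) (surfaces_off_near y)) => z [[yz xz] offz] [zS _].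
have Fz : ~ F i z by exact: offz.
rewrite (crossing_out _ _ Fy') !(crossing_in _ _ Fx).
have e : sideF i y <-> sideF i z.
  have D1 : `|y - y| < r * `|y - y0| by rewrite subrr normr0 mulr_gt0.
  have h1 := hr y y0 y xy xy yS yS yy0 yny0 D1; have h2 := hr y y0 z xy xz yS zS yy0 yny0 yz.
  by rewrite h1 h2.
have -> : `[< ~ F i y /\ sideF i y >] = `[< ~ F i z /\ sideF i z >].
  by apply/asbool_equiv_eq; split => -[_ h]; split => //; apply/e.
by rewrite mulVg.
Qed.

Lemma crossing_Hol (gT : finGroupType) (s : 'I_n -> gT) i (q : R -> 'rV[R]_4) (b : bool) (d : R) :
  F i (q (1 / 2)) -> 0 < d ->
  (forall t, 0 <= t <= 1 -> t != 1 / 2 -> forall j, ~ F j (q t)) ->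
  (forall t, 0 <= t <= 1 -> 0 < `|t - 1 / 2| < d -> sideF i (q t) <-> (0 < t - 1 / 2) = b) ->
  Hol (crossing s) q 0 1 (if b then s i else (s i)^-1)%g.
Proof.
move=> Fq d0 off sd.
(* An explicit parallel section: [s i] on the positive side, and 1 on the negative side and at the
   crossing itself. *)
pose g (t : R) : gT := if (0 < t - 1 / 2) == b then (if t == 1 / 2 then 1%g else s i) else 1%g.
have g0 t : t - 1 / 2 < 0 -> g t = (if b then 1 else s i)%g.
  move=> t0; rewrite /g (lt_gtF t0); case: (b) => /=; [by []|]; by rewrite -subr_eq0 lt_eqF.
have g1 t : 0 < t - 1 / 2 -> g t = (if b then s i else 1)%g.
  move=> t0; rewrite /g t0; case: (b) => /=; [|by []]; by rewrite -subr_eq0 gt_eqF.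
exists g; last first.
  by rewrite g0 ?g1; [case: (b); rewrite ?invg1 ?mul1g ?mulg1|lra|lra].
move=> t t01; have [th|th|th] := ltrgt0P (t - 1 / 2).
- near=> t' => t'01; have t'h : 1 / 2 < t' by near: t'; apply: lt_nbhsr; lra.
  by rewrite (g1 t) // (g1 t') ?crossing_out ?mulg1 //; [apply: off => //; rewrite gt_eqF //; lra|lra].
- near=> t' => t'01; have t'h : t' < 1 / 2 by near: t'; apply: lt_nbhsl; lra.
  by rewrite (g0 t) // (g0 t') ?crossing_out ?mulg1 //; [apply: off => //; rewrite lt_eqF //; lra|lra].
have -> : t = 1 / 2 by lra.
near=> t' => t'01.
have gh : g (1 / 2) = 1%g by rewrite /g eqxx; case: ifP.
have t'd : `|t' - 1 / 2| < d.
  rewrite distrC; near: t'; exact: nbhs_dist_lt d0 (fun _ h => h).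
rewrite gh mul1g (crossing_in _ _ Fq) /g.
have [->|t'h] := eqVneq t' (1 / 2).
  by rewrite asboolF ?if_same // => -[].
have t'0 : 0 < `|t' - 1 / 2| < d by rewrite normr_gt0 subr_eq0 t'h.
have e := sd t' t'01 t'0; have Fq' := off t' t'01 t'h i.
case: eqP => [/e h|h]; first by rewrite asboolT.
by rewrite asboolF // => -[_ /e].
Unshelve. all: by end_near.
Qed.

(** The plane curve (bump, wave) is closed: it starts at (-1, 0), and as bump is 1 near s = 1/2 it
    crosses the half-line through (1, 0) vertically, at that time only. Placed across the edge, it
    avoids the surface except there. *)
Definition bump (s : R) : R := Num.min 1 (3 - 8 * `|s - 1 / 2|).
Definition wave (s : R) : R := s * (1 - s) * (2 * s - 1).

Lemma bump_cont : continuous bump.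
Proof.
move=> s; have c1 : continuous_at s (fun s : R => `|s - 1 / 2|).
  apply: (@forc_comp _ _ _ (fun s : R => s - 1 / 2) (@Num.norm R R)); first by cont.
  exact: norm_continuous.
apply: (@continuous_min _ _ (cst 1) (fun s : R => 3 - 8 * `|s - 1 / 2|)); first exact: cst_continuous.
by cont.
Qed.

(* q encircles b and crosses F i once, at an interior point; sg is the sign of this crossing. *)
Lemma meridian i b : surface_boundary (F i) b -> exists q (sg : bool),
  [/\ cpath X q, q 0 = q 1 & forall (gT : finGroupType) (s : 'I_n -> gT),
    Hol (crossing s) q 0 1 (if sg then s i else (s i)^-1)%g].
Proof.
move=> [p Fp [u0 [cu u00] ub]].
have sf := param_strict_diff Fp cu; have fr := param_frame (FS (i := i)) Fp cu.
have bF := param_in Fp cu; have bS := FS bF.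
pose n0 := pnormal p u0.
(* The tube uses the constant direction [n0]. Since [pmap p] is smooth on both sides of the edge,
   the tube also contains the outside of the surface, through which the loop passes. *)
have [N1 [Q NQ inj]] := tube_local sf (lip_cst n0 u0) bS fr.
pose Phi := tube (pmap p) (cst n0).
have Phi0 u : chart_dom p u -> Phi (u, 0) = pmap p u.
  by move=> cu'; rewrite /Phi tube0 //; exact/FS/(param_in Fp cu').
have cPhi : continuous_at (u0, 0 : R) Phi by have [] := nbhs_singleton N1.
have cpair : continuous_at u0 (fun u : 'rV[R]_2 => (u, 0 : R)) by cont.
(* With injectivity, the surface inside the tube is exactly the part with normal coordinate 0 and
   first coordinate in the half-plane. *)
have N3 : \forall y \near (u0, 0 : R), F i (Phi y) ->
    exists2 u, Q (u, 0) /\ chart_dom p u & pmap p u = Phi y.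
  have := param_near Fp cu (cpair _ NQ); rewrite -(Phi0 _ cu); exact: cPhi.
have N4 : \forall y \near (u0, 0 : R), forall j, j != i -> ~ F j (Phi y).
  have : \forall z \near Phi (u0, 0), forall j, j != i -> ~ F j z.
    have := surfaces_off_near (Phi (u0, 0)); apply: (@filterS _ (nbhs (Phi (u0, 0)))) => z h j ji.
    by apply: h => Fj; move: ji; rewrite (same Fj (_ : F i (Phi (u0, 0)))) ?eqxx // Phi0.
  exact: cPhi.
have N5 : \forall y \near (u0, 0 : R), dom p y.1 /\
    (chart_dom p y.1 -> 0 < dot n0 (conormal (pmap p y.1) (pjac p y.1))).
  have [[od sm] _ _ _] := Fp.
  have [d d0 hd] := lip_continuous (lip_normal od sm cu.1).
  have /hd cn : `|u0 - u0| < d by rewrite subrr normr0.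
  have cdot : continuous_at u0 (fun u => dot n0 (conormal (pmap p u) (partials (pmap p) u))).
    by apply: dot_continuous_at; [exact: forc_cst|exact: cn].
  have pos : 0 < dot n0 (conormal (pmap p u0) (partials (pmap p) u0)).
    rewrite partialsE; last exact: smooth_differentiable cu.1.
    rewrite -sqnormE sqnorm_gt0; apply: normal_neq0.
    - by rewrite -sqnorm_gt0 bS ltr01.
    - by have [_ fJ _ _] := Fp; exact: fJ.
    - by move=> k; exact: (param_tangent (FS (i := i)) Fp k cu).
  have NP := cdot _ (lt_nbhsr pos).
  have ND : nbhs u0 (dom p) by exact: open_nbhs_nbhs (conj od cu.1).
  have NN : nbhs u0 [set u | dom p u /\
      (chart_dom p u -> 0 < dot n0 (pnormal p u))].
    apply: (@filterS _ (nbhs u0) _ _ _ _ (@filterI _ (nbhs u0) _ _ _ NP ND)) => u [h1 du]; split => // _; move: h1 => /=.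
    by rewrite partialsE //; exact: smooth_differentiable du.
  have cfst : continuous_at (u0, 0 : R) (fun y : 'rV[R]_2 * R => y.1) by cont.
  exact: (cfst _ NN).
have [r r0 hr] := @nbhs_dist_ex _ ('rV[R]_2 * R)%type _ _ (filterI (filterI N1 NQ) (filterI N3 (filterI N4 N5))).
pose h := r / 2; have h0 : 0 < h by rewrite divr_gt0.
pose e : 'rV[R]_2 := delta_mx 0 ord_max.
have e1 : e 0 ord_max = 1 by rewrite mxE !eqxx.
have e_norm : `|e| <= 1.
  by apply: norm_le_coord => // j; rewrite mxE; case: (_ && _); rewrite ?normr1 ?normr0.
pose c (s : R) := (u0 + (h * bump (clamp s)) *: e, h * wave (clamp s)).
have bump1 s : 0 <= s <= 1 -> `|bump s| <= 1.
  move=> /andP[s0 s1]; have sh : `|s - 1 / 2| <= 1 / 2 by rewrite ler_norml; apply/andP; split; lra.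
  rewrite /bump ler_norml ge_min lexx andbT le_min; apply/andP; split; lra.
have wave1 s : 0 <= s <= 1 -> `|wave s| <= 1.
  move=> /andP[s0 s1]; rewrite /wave !normrM (ger0_norm s0) [`|1 - s|]ger0_norm ?subr_ge0 //.
  have : `|2 * s - 1| <= 1 by rewrite ler_norml; apply/andP; split; lra.
  have : 0 <= `|2 * s - 1| by []; move: (`|2 * s - 1|) => k; nra.
have cr s : `|(u0, 0) - c s| < r.
  have s01 := clamp01 s; rewrite /Num.norm /= gt_max; apply/andP; split.
    rewrite /c /= opprD addNKr normrN normrZ normrM (gtr0_norm h0).
    have : h * `|bump (clamp s)| * `|e| <= h * 1 * 1.
      apply: ler_pM; [exact: mulr_ge0 (ltW h0) _|exact: normr_ge0| |exact: e_norm].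
      by rewrite ler_pM2l // bump1.
    rewrite /h; lra.
  rewrite /c /= sub0r normrN normrM (gtr0_norm h0).
  have : h * `|wave (clamp s)| <= h * 1 by rewrite ler_pM2l // wave1.
  rewrite /h; lra.
have cc s : continuous_at s c.
  have cl := @clamp_continuous R; have cb := bump_cont.
  have c1 : continuous_at s (fun s => bump (clamp s)).
    by apply: (@forc_comp _ _ _ (@clamp R) bump); [exact: cl|exact: cb].
  by rewrite /c /wave; cont.
pose q s := Phi (c s).
have good s := hr _ (cr s).
(* On the surface [wave] vanishes, which leaves 0, 1/2 and 1; at 0 and 1 the value -1 of [bump] is
   outside the half-plane. *)
have only s : 0 <= s <= 1 -> F i (q s) -> s = 1 / 2.
  move=> s01 Fq; have [[_ Qc] [h3 _]] := good s.
  have [u [Qu cu'] uq] := h3 Fq.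
  have := inj _ _ Qc Qu (etrans (esym uq) (esym (Phi0 u cu'))).
  rewrite /c (clamp_id s01) => -[eu /eqP]; rewrite mulf_eq0 (gt_eqF h0) /= /wave.
  have := cu'.2; rewrite /half_plane -eu /= !mxE u00 !eqxx add0r mulr1 pmulr_rge0 // => hb.
  rewrite !mulf_eq0 => /orP[/orP[/eqP s0|/eqP s0]|/eqP s0]; last lra.
    move: hb; rewrite s0 /bump sub0r normrN gtr0_norm ?divr_gt0 // le_min => /andP[_]; lra.
  move: hb; have -> : s = 1 by lra.
  rewrite /bump; have -> : `|1 - 1 / 2 : R| = 1 / 2 by rewrite gtr0_norm; lra.
  by rewrite le_min => /andP[_]; lra.
have off s j : 0 <= s <= 1 -> s != 1 / 2 -> ~ F j (q s).
  move=> s01 sh; have [_ [_ [h4 _]]] := good s.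
  by have [->|ji] := eqVneq j i; [move=> /(only s s01)/eqP; rewrite (negPf sh)|exact: h4].
pose u1 := u0 + h *: e.
have bumph t : `|t - 1 / 2| < 1 / 4 -> bump t = 1.
  by move=> th; rewrite /bump min_l //; lra.
have ct t : `|t - 1 / 2| < 1 / 4 -> c t = (u1, h * wave t).
  move=> th; have t01 : 0 <= t <= 1 by move: th; rewrite ltr_norml => /andP[? ?]; apply/andP; split; lra.
  by rewrite /c clamp_id // bumph // mulr1.
have ch : c (1 / 2) = (u1, 0).
  rewrite ct; last by rewrite subrr normr0; lra.
  by rewrite /wave (_ : 2 * (1 / 2) - 1 = 0 :> R) ?mulr0 //; lra.
have u1p : 0 < u1 0 ord_max by rewrite /u1 !mxE u00 add0r !eqxx mulr1.
have [_ [_ [_ [du1 dn1]]]] := good (1 / 2); rewrite ch /= in du1 dn1.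
have cu1 : chart_dom p u1 by split => //; exact: ltW.
have qh : q (1 / 2) = pmap p u1 by rewrite /q ch Phi0.
have [sg [d [d0 hd]]] := side_crossing (FS (i := i)) (Fc (i := i)) (FA i) (@compat i) Fp cu1 u1p (dn1 cu1).
have X1 s : 0 <= s <= 1 -> X (q s).
  move=> s01; have [[[_ qS _] _] [_ [h4 _]]] := good s; split => // -[j _ bj].
  have [ji|ji] := eqVneq j i; last by apply: (h4 j ji); exact: boundary_sub bj.
  rewrite ji in bj; have sh := only s s01 (boundary_sub bj).
  case: bj => p' Fp' [u' [cu' u'0]]; rewrite sh qh => eu.
  by have := edge_invariance (FS (i := i)) Fp Fp' cu1 u1p cu' (esym eu); rewrite u'0 ltxx.
exists q, sg; split.
- split => [s|s]; last first.
    have -> : q s = q (clamp s) by rewrite /q /c (clamp_id (clamp01 s)).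
    by apply: X1; exact: clamp01.
  have [[[cP _ _] _] _] := good s.
  exact: (forc_comp (cc s) cP).
- rewrite /q /c !clamp_id ?lexx ?ler01 // /bump /wave.
  have -> : `|0 - 1 / 2 : R| = `|1 - 1 / 2|.
    by rewrite sub0r normrN; congr (`|_|); lra.
  by congr (Phi (_, h * _)); ring.
move=> gT s; have d' : 0 < Num.min (1 / 4) (d / (2 * h)) by rewrite lt_min !divr_gt0 // mulr_gt0.
apply: crossing_Hol d' _ _.
- by rewrite qh; exact (param_in Fp cu1).
- by move=> t t01 th j; exact: off.
move=> t t01 /andP[t0]; rewrite lt_min => /andP[t4 td].
have th : t != 1 / 2 by rewrite -subr_eq0 -normr_gt0.
have := off t i t01 th; rewrite /q ct // /Phi /tube /= => nF.
have wE : wave t = (t * (1 - t) * 2) * (t - 1 / 2) by rewrite /wave; field.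
have [t1 t2] : 0 < t /\ 0 < 1 - t by move: t4; rewrite ltr_norml => /andP[? ?]; split; lra.
have w2 : 0 < t * (1 - t) * 2 by rewrite !mulr_gt0.
have wt : 0 < `|h * wave t| < d.
  have hw : 0 < h * (t * (1 - t) * 2) by exact: mulr_gt0.
  rewrite wE mulrA normrM (gtr0_norm hw); apply/andP; split; first exact: mulr_gt0.
  move: td; rewrite ltr_pdivlMr ?mulr_gt0 // => td; apply: le_lt_trans td.
  by rewrite mulrC ler_pM2l // mulrC ler_pM2r //; nra.
have := hd _ wt nF; rewrite pmulr_rgt0 // wE pmulr_rgt0 //.
Qed.

End Crossing.

(** * Loops missing the surfaces *)

Section Conclusion.
Context {R : realType} {n : nat} {F : 'I_n -> set 'rV[R]_4} {A : 'I_n -> set (@param R)}.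
Hypotheses (FS : forall i, F i `<=` sphere3) (Fc : forall i, compact (F i)).
Hypothesis FA : forall i, is_atlas (F i) (A i).
Hypothesis compat : forall i p q, A i p -> A i q -> positively_compatible p q.
Hypothesis Fdisj : trivIset setT F.
Hypothesis boundary : forall i, surface_boundary (F i) !=set0.
Local Notation X := (off_boundary (F := F)).
Context {b0 : 'rV[R]_4} {eta : 'rV[R]_4 -> R -> 'rV[R]_4} {g : 'I_n -> R -> 'rV[R]_4}.
Hypothesis Xb0 : X b0.
Hypothesis gP : forall i, pth X b0 b0 (g i).
Hypothesis etaP : forall x, X x -> pth X b0 x (eta x).
Hypothesis gen : forall p, cpath X p -> exists w,
  htp X (pcat (eta (p 0)) p) (pcat (word_path b0 g w) (eta (p 1))).
Implicit Types (p q : R -> 'rV[R]_4) (gT : finGroupType).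
Local Notation crossing := (crossing (F := F) (A := A)).

Let flatc gT (s : 'I_n -> gT) : flat X (crossing s).
Proof. exact: flat_crossing. Qed.

Definition hol gT (s : 'I_n -> gT) p : gT :=
  if pselect (cpath X p) is left h then projT1 (cid (Hol_exists (flatc s) h)) else 1%g.

Lemma holP gT (s : 'I_n -> gT) p : cpath X p -> Hol (crossing s) p 0 1 (hol s p).
Proof. by rewrite /hol; case: pselect => // h _; case: cid. Qed.

Definition tuple_hol gT (s : 'I_n -> gT) i : gT := hol s (g i).

(** The tail to the start of the loop is the source of the conjugation. For a meridian it yields the
    conjugator u_i, and for a loop off the surfaces the value is 1 in spite of it. *)
Lemma hol_loop gT (s : 'I_n -> gT) p w h : cpath X p -> p 0 = p 1 ->
  htp X (pcat (eta (p 0)) p) (pcat (word_path b0 g w) (eta (p 1))) -> Hol (crossing s) p 0 1 h ->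
  word_eval (tuple_hol s) w = (hol s (eta (p 0)) * h * (hol s (eta (p 0)))^-1)%g.
Proof.
move=> Xp p01 hp Hp; have [Xe e0 e1] := etaP (Xp.2 0).
have [Xw w0 w1] := word_pathP Xb0 gP w.
have H1 := Hol_pcat e1 (holP s Xe) Hp.
have Hg i : Hol (crossing s) (g i) 0 1 (tuple_hol s i) by apply: holP; case: (gP i).
have Hw := Hol_word Xb0 gP w (flatc s) Hg.
have H2 := Hol_pcat (etrans w1 (esym e0)) Hw (holP s Xe).
rewrite -p01 in hp; have := htp_Hol (flatc s) hp H1 H2 => e.
by rewrite e -/(tuple_hol s) mulgK.
Qed.

Lemma crossing_mem gT (G : {group gT}) (s : 'I_n -> gT) x y : (forall i, s i \in G) -> crossing s x y \in G.
Proof. by move=> sG; rewrite /crossing; case: pickP => *; [exact: sG|exact: group1]. Qed.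

Lemma crossing_modulo gT (N : {group gT}) (s t : 'I_n -> gT) x y :
  (forall i, (s i)^-1 * t i \in N)%g -> ((crossing s x y)^-1 * crossing t x y \in N)%g.
Proof. by move=> sN; rewrite /crossing; case: pickP => *; [exact: sN|rewrite mulVg group1]. Qed.

Lemma hol_mem gT (G : {group gT}) (s : 'I_n -> gT) p : (forall i, s i \in G) -> cpath X p -> hol s p \in G.
Proof.
move=> sG Xp; have c1 x y : ((crossing s x y)^-1 * crossing s x y \in G)%g by rewrite mulVg group1.
by have [] := Hol_modulo (normG G) (fun x y => crossing_mem x y sG) c1 (holP s Xp) (holP s Xp).
Qed.

Lemma missing_loop_trivial p w : cpath X p -> p 0 = p 1 -> (forall t i, ~ F i (p t)) -> reduced w ->
  htp X (pcat (eta (p 0)) p) (pcat (word_path b0 g w) (eta (p 1))) -> w = [::].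
Proof.
move=> Xp p01 pF rw hw; apply: reduced_word_trivial rw _ => gT G t nG tG.
have mer i : {q : R -> 'rV[R]_4 & {sg : bool & {wi : seq ('I_n * bool) | [/\ cpath X q, q 0 = q 1,
    (forall s : 'I_n -> gT, Hol (crossing s) q 0 1 (if sg then s i else (s i)^-1)%g) &
    htp X (pcat (eta (q 0)) q) (pcat (word_path b0 g wi) (eta (q 1)))]}}}.
  have h := boundary i; move: h => /cid[b /(meridian FS Fc FA compat Fdisj)/cid[q /cid[sg [Xq q01 Hq]]]].
  by have /cid[wi hwi] := gen Xq; exists q, sg, wi.
pose q i := projT1 (mer i); pose sg i := projT1 (projT2 (mer i)).
pose W i := projT1 (projT2 (projT2 (mer i))).
have merP i : [/\ cpath X (q i), q i 0 = q i 1,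
    (forall s : 'I_n -> gT, Hol (crossing s) (q i) 0 1 (if sg i then s i else (s i)^-1)%g) &
    htp X (pcat (eta (q i 0)) (q i)) (pcat (word_path b0 g (W i)) (eta (q i 1)))].
  by rewrite /q /sg /W; case: (mer i) => ? [? [? ?]].
pose u (s : 'I_n -> gT) i := hol s (eta (q i 0)).
have Xeta i : cpath X (eta (q i 0)) by have [Xq _ _ _] := merP i; have [] := etaP (Xq.2 0).
have Xg i : cpath X (g i) by have [] := gP i.
(* Every family [t] is realized as holonomies of the [g i] for a suitable [s]; evaluating a word at
   [t] thus becomes computing a holonomy. *)
have [|||s sG Ts] := @conjugacy_determined_surjective n gT G (@tuple_hol gT) u W sg nG _ _ _ t tG.
- by move=> s sG i; exact: hol_mem.
- move=> s sG i; have [Xq q01 Hq hq] := merP i.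
  by rewrite (hol_loop Xq q01 hq (Hq s)) /u /letter_eval.
- move=> N s s' nN sG s'G sN i.
  have nG' := normal_norm nN.
  exact: (Hol_modulo nG' (fun x y => crossing_mem x y sG) (fun x y => crossing_modulo x y sN)
    (holP s (Xeta i)) (holP s' (Xeta i))).
have H1 : Hol (crossing s) p 0 1 (1 : gT)%g.
  by apply: Hol_trivial => r r'; apply: crossing_out => i; exact: pF.
have := hol_loop Xp p01 hw H1; rewrite mulg1 mulgV => <-.
by apply: eq_bigr => l _; rewrite /letter_eval Ts.
Qed.

Lemma missing_loop_contractible p : cpath X p -> p 0 = p 1 -> (forall t i, ~ F i (p t)) ->
  htp X p (cst (p 0)).
Proof.
move=> Xp p01 pF; have [w hw] := gen Xp.
have [w' rw' ww'] := word_path_reduced Xb0 gP w.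
have he := etaP (Xp.2 0); have hp : pth X (p 0) (p 0) p by split.
have h1 : htp X (pcat (eta (p 0)) p) (pcat (word_path b0 g w') (eta (p 1))).
  by apply: htp_trans hw _; rewrite -p01; apply: hcatl ww'; [exact: word_pathP|exact: he].
have w'0 := missing_loop_trivial Xp p01 pF rw' h1.
rewrite w'0 -p01 /= in h1; have {}h1 := htp_trans h1 (hcat1l he).
apply: htp_trans (htp_sym (hcatV he hp)) _.
apply: htp_trans (hcatr (pth_rev he) (pth_cat he hp) h1) _.
by have [Xe _ e1] := he; have := htp_catVl Xe; rewrite e1.
Qed.

End Conclusion.

Theorem corollary1p5 (R : realType) (n : nat) (L : 'I_n.+1 -> R -> 'rV[R]_4)
    (F : 'I_n -> set 'rV[R]_4) :
  is_link L ->
  trivial_link (delete_component L ord0) ->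
  (forall i, is_surface (F i) /\ orientable (F i)) ->
  (forall i, surface_boundary (F i) = range (delete_component L ord0 i)) ->
  trivIset setT F ->
  (\bigcup_i F i) `&` range (L ord0) = set0 ->
  null_homotopic (sphere3 `\` link_set (delete_component L ord0)) (L ord0).
Proof.
move=> [knots Ldisj] triv surf bF Fdisj FK.
have FS i : F i `<=` sphere3 by have [[]] := surf i.
have Fc i : compact (F i) by have [[]] := surf i.
have ori i : {A : set param | is_atlas (F i) A /\ forall p q, A p -> A q -> positively_compatible p q}.
  by apply: cid; have [_ [B h1 h2]] := surf i; exists B.
pose A i := projT1 (ori i).
have FA i : is_atlas (F i) (A i) by rewrite /A; case: (ori i) => ? [].
have compat i p q : A i p -> A i q -> positively_compatible p q.
  exact: (projT2 (ori i)).2.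
have [e [Phi [TS PhiL]]] := trivial_link_tube triv.
(* Disks and surfaces bound the same link, so the words of one construction and the holonomies of
   the other live in one space. *)
have XE : off_boundary (F := F) = outside_circles (Phi := Phi).
  by rewrite /off_boundary /outside_circles; congr (_ `\` _); apply: eq_bigcupr => i _; rewrite bF PhiL.
have XL : off_boundary (F := F) = sphere3 `\` link_set (delete_component L ord0).
  by rewrite /off_boundary /link_set; congr (_ `\` _); apply: eq_bigcupr => i _; rewrite bF.
have [b0 [eta [g [Xb0 gP etaP gen]]]] := generation TS.
rewrite -XE in Xb0 gP etaP gen; rewrite -XL.
have boundary i : surface_boundary (F i) !=set0 by rewrite bF; exists (delete_component L ord0 i 0), 0.
have [smooth Ls per _ _] := knots ord0.
have Xp : cpath (off_boundary (F := F)) (L ord0).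
  split; first by move=> t; have := smooth 0%N; apply.
  move=> t; rewrite XL; split; first exact: Ls.
  move=> [i _ [s _ e']]; have /(_ I I) := Ldisj ord0 (lift ord0 i).
  have ne : L ord0 t = L (lift ord0 i) s by rewrite -e'.
  by move=> /(_ (ex_intro _ (L ord0 t) (conj (ex_intro2 _ _ t I erefl) (ex_intro2 _ _ s I e')))).
have p01 : L ord0 0 = L ord0 1 by rewrite -(per 0) add0r.
have pF t i : ~ F i (L ord0 t).
  by move=> Fi; have : (set0 : set 'rV[R]_4) (L ord0 t) by rewrite -FK; split; [exists i|exists t].
have [H [cH XH Hp He]] := missing_loop_contractible FS Fc FA compat Fdisj boundary Xb0 gP etaP gen Xp p01 pF.
exists (L ord0 0), H; split.
- exact: continuous_subspaceT.
- by move=> t s _ _; exact: XH.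
- by move=> s _; have [-> ->] := He s.
- by move=> t; rewrite in_itv /= => /Hp[].
- by move=> t; rewrite in_itv /= => /Hp[].
Qed.
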